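(* Let $(M,d)$ be a locally compact separable metric space, let $\mu$ be a $\sigma$-finite Borel measure on $M$ and let $X=(\Omega,\mathscr{M},\{X_t\}_{t\in[0,\infty]},\{\mathbb{P}_x\}_{x\in M_\Delta})$ be a Hunt process on $(M,\mathscr{B}(M))$ with life time $\zeta$. Let $N\in\mathscr{B}(M)$ and assume that for any $x\in M\setminus N$, $$\mathbb{P}_x\bigl[X_t\in M_\Delta\setminus N\text{ for any }t\in[0,\infty),\ [0,\zeta)\ni t\mapsto X_t\in M\text{ is continuous}\bigr]=1.$$ Let $\beta\in(1,\infty)$, $R\in(0,\infty)$, let $U$ be a non-empty open subset of $M$ with $\operatorname{diam}U\le R$ and let $F=F_t(x,y):(0,R^\beta]\times U\times U\to(0,\infty)$ be Borel measurable. Let $c_F,\alpha_F,c,\gamma\in(0,\infty)$ and assume the following three conditions. (i) For any $(t,x,y),(s,z,w)\in(0,R^\beta]\times U\times U$ with $s\le t$, $$\frac{F_s(z,w)}{F_t(x,y)}\le c_F\Bigl(\frac{t\vee d(x,z)^\beta\vee d(y,w)^\beta}{s}\Bigr)^{\alpha_F}.$$ (ii) For any $(t,x)\in(0,R^\beta)\times(U\setminus N)$ and any $A\in\mathscr{B}(U)$, $$\mathbb{P}_x[X_t\in A,\,t<\tau_U]\le\int_A F_t(x,y)\,d\mu(y).$$ (iii) For any $(x,r)\in(U\setminus N)\times(0,R)$ with $B(x,r)\subset U$ and any $t\in(0,\infty)$, $$\mathbb{P}_x[\tau_{B(x,r)}\le t]\le c\exp\bigl(-\gamma(r^\beta/t)^{\frac1{\beta-1}}\bigr).$$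 Let $\varepsilon\in(0,1)$ and set $U^\circ_{\varepsilon R}:=\{x\in M\mid\inf_{y\in M\setminus U}d(x,y)>\varepsilon R\}$ (an open subset of $U$). Then there exists a Borel measurable function $p=p_t(x,y):(0,\infty)\times(M\setminus N)\times U^\circ_{\varepsilon R}\to[0,\infty)$ such that for any $(t,x)\in(0,\infty)\times(M\setminus N)$, $$\mathbb{P}_x[X_t\in A]=\int_A p_t(x,y)\,d\mu(y)\qquad\text{for any }A\in\mathscr{B}(U^\circ_{\varepsilon R}),$$ and for any $y\in U^\circ_{\varepsilon R}$, $$p_t(x,y)\le\begin{cases}c_\varepsilon F_t(x,y)\exp\bigl(-\gamma_\varepsilon(d(x,y)^\beta/t)^{\frac1{\beta-1}}\bigr)&\text{if }t<R^\beta\text{ and }x\in U,\\ c_\varepsilon\bigl(\inf_{U\times U}F_{(2t)\wedge R^\beta}\bigr)\exp\bigl(-\gamma_\varepsilon(R^\beta/t)^{\frac1{\beta-1}}\bigr)&\text{if }t<R^\beta\text{ and }x\notin U,\\ c_\varepsilon\bigl(\inf_{U\times U}F_{R^\beta}\bigr)&\text{if }t\ge R^\beta,\end{cases}$$ where $\gamma_\varepsilon:=(\tfrac15\varepsilon)^{\frac{\beta}{\beta-1}}\gamma$ and $c_\varepsilon\in(0,\infty)$ is a constant explicit in (in particular, depending only on) $\beta,c_F,\alpha_F,c,\gamma,\varepsilon$.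
   Context: Conventions: $a\vee b=\max\{a,b\}$, $a\wedge b=\min\{a,b\}$, $\inf\emptyset:=\infty$, $\sup\emptyset:=0$; $B(x,r):=\{y\in M\mid d(x,y)<r\}$; $\operatorname{diam}A:=\sup_{x,y\in A}d(x,y)$; $\mathscr{B}(E)$ is the Borel $\sigma$-field of $E$ (subsets of $M$ carry the relative topology). $M_\Delta=M\cup\{\Delta\}$ is the one-point compactification of $M$. A Hunt process $X$ on $(M,\mathscr{B}(M))$ consists of a measurable space $(\Omega,\mathscr{M})$, measurable maps $X_t:\Omega\to M_\Delta$ ($t\in[0,\infty]$), probability measures $\mathbb{P}_x$ ($x\in M_\Delta$) on $(\Omega,\mathscr{M})$ and shift operators $\theta_t:\Omega\to\Omega$ with $X_s\circ\theta_t=X_{s+t}$, such that, with $\zeta(\omega):=\inf\{t\in[0,\infty)\mid X_t(\omega)=\Delta\}$ (life time), $X_t(\omega)=\Delta$ for all $t\in[\zeta(\omega),\infty]$; for every $\omega$ the path $[0,\infty)\ni t\mapsto X_t(\omega)\in M_\Delta$ is right-continuous and has left limits in $M_\Delta$ on $(0,\infty)$; it is a normal Markov process on $(M,\mathscr{B}(M))$ ($\mathbb{P}_x[X_0=x]=1$, $x\mapsto\mathbb{P}_x[X_t\in A]$ is Borel for $A\in\mathscr{B}(M)$, and $\Delta$ is a trap: $\mathbb{P}_\Delta[X_t=\Delta]=1$); and its minimum completed admissible filtration $\{\mathscr{F}_t\}_{t\in[0,\infty]}$ is right-continuous and $X$ is strong Markov and quasi-left-continuous with respect to it. For $B\subset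 M$, $\tau_B:=\inf\{t\in[0,\infty)\mid X_t\in M_\Delta\setminus B\}$. *)

(* Defs.v *)
From HB Require Import structures.
From mathcomp Require Import all_boot all_order all_algebra.
From mathcomp Require Import all_classical all_reals all_analysis measurable_realfun.

Set Implicit Arguments.
Unset Strict Implicit.
Unset Printing Implicit Defensive.

Import Order.TTheory GRing.Theory Num.Theory.
Import numFieldNormedType.Exports.

Local Open Scope classical_set_scope.
Local Open Scope ring_scope.

(* Measurable types of the library are pointed, hence the base point. *)
#[short(type="pmetricType")]
HB.structure Definition PointedMetric (K : numDomainType) :=
  {M of Pointed M & Metric K M}.

Notation borel T := (g_sigma_algebraType (@open T)).

Definition separable (T : topologicalType) :=
  exists D : set T, countable D /\ dense D.

Section metric_sets.
Context {R : realType} {M : pmetricType R}.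
Implicit Type A : set M.
Local Open Scope ereal_scope.

Definition diam A : \bar R := ereal_sup [set (mdist x y)%:E | x in A & y in A].

Definition inner_part A (r : R) : set M :=
  [set x | r%:E < ereal_inf [set (mdist x y)%:E | y in ~` A]].

End metric_sets.

Section filtrations.
Context {R : realType} {T : pointedType}.
Implicit Types (G : set (set T)) (F : \bar R -> set (set T)).
Local Open Scope ereal_scope.

Definition stopping_time F (sigma : T -> \bar R) :=
  (forall w, 0 <= sigma w) /\
  (forall t : R, (0 <= t)%R -> F t%:E [set w | sigma w <= t%:E]).

Definition stopped_salgebra F (sigma : T -> \bar R) : set (set T) :=
  [set L | F +oo L /\
    forall t : R, (0 <= t)%R -> F t%:E (L `&` [set w | sigma w <= t%:E])].

(* [g] is a version of the conditional probability [Q[E | G]]; the integral is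
   that of the measurable space [(T, <<s G >>)], on which [g] is measurable. *)
Definition is_cond_probability (Q : set T -> \bar R) G (E : set T)
    (g : T -> \bar R) :=
  measurable_fun setT (g : g_sigma_algebraType G -> \bar R) /\
  forall L : set T, <<s G >> L ->
    Q (E `&` L) = @integral _ (g_sigma_algebraType G) R Q L g.

End filtrations.

(* The value [None] is the cemetery. Paths and shifts are total functions of an
   extended real time, only used at times in [0, +oo]. *)
Section paths.
Context {R : realType} {M : pmetricType R} {d : measure_display}
  {Omega : measurableType d}.
Local Notation MD := (one_point_compactification M).
Variables (X : \bar R -> Omega -> MD) (P : MD -> probability Omega R).
Local Open Scope ereal_scope.

Definition lifetime (w : Omega) : \bar R :=
  ereal_inf [set t%:E | t in [set t : R | (0 <= t)%R /\ X t%:E w = None]].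

Definition exit_time (B : set M) (w : Omega) : \bar R :=
  ereal_inf [set t%:E | t in
    [set t : R | (0 <= t)%R /\ (~` (Some @` B)) (X t%:E w)]].

Definition natural_filtration (t : \bar R) : set (set Omega) :=
  <<s [set X s @^-1` A | s in [set s | 0 <= s <= t]
                       & A in [set A : set (borel MD) | measurable A]] >>.

Definition initial_law (nu : probability (borel MD) R) (L : set Omega) : \bar R :=
  \int[nu]_x P x L.

(* The outer measure of [initial_law nu] on the final natural sigma-algebra; it
   coincides with the completed measure on completion-measurable sets. *)
Definition completed_law (nu : probability (borel MD) R) :
    set Omega -> \bar R :=
  @mu_ext _ (g_sigma_algebraType (natural_filtration +oo)) R (initial_law nu).

Definition null_sets (nu : probability (borel MD) R) : set (set Omega) :=
  @negligible _ (g_sigma_algebraType (natural_filtration +oo)) R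
    (initial_law nu).

Definition completed_filtration (t : \bar R) : set (set Omega) :=
  [set L | forall nu : probability (borel MD) R,
    <<s natural_filtration t `|` null_sets nu >> L].

End paths.

Record hunt_process (R : realType) (M : pmetricType R) (d : measure_display)
    (Omega : measurableType d) := HuntProcess {
  hunt_path :> \bar R -> Omega -> one_point_compactification M ;
  hunt_prob : one_point_compactification M -> probability Omega R ;
  hunt_shift : \bar R -> Omega -> Omega ;
  hunt_measurable : forall t : \bar R, (0 <= t)%E ->
    measurable_fun setT
      (hunt_path t : Omega -> borel (one_point_compactification M)) ;
  hunt_shiftE : forall (s t : \bar R) w, (0 <= s)%E -> (0 <= t)%E ->
    hunt_path s (hunt_shift t w) = hunt_path (s + t)%E w ;
  hunt_dead : forall (t : \bar R) w,
    (lifetime hunt_path w <= t)%E -> hunt_path t w = None ;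
  hunt_right_continuous : forall (t : R) w, 0 <= t ->
    hunt_path s%:E w @[s --> t^'+] --> hunt_path t%:E w ;
  hunt_left_limit : forall (t : R) w, 0 < t ->
    exists l : one_point_compactification M,
      hunt_path s%:E w @[s --> t^'-] --> l ;
  hunt_normal : forall x, hunt_prob x (hunt_path 0%E @^-1` [set x]) = 1%E ;
  hunt_transition_measurable : forall (t : R) (A : set (borel M)),
    0 <= t -> measurable A ->
    measurable_fun setT (fun x : borel M =>
      hunt_prob (Some x) (hunt_path t%:E @^-1` (Some @` A))) ;
  hunt_trap : forall t : R, 0 <= t ->
    hunt_prob None (hunt_path t%:E @^-1` [set None]) = 1%E ;
  hunt_markov : forall x (s t : R) (A : set (borel M)),
    0 <= s -> 0 <= t -> measurable A ->
    is_cond_probability (hunt_prob x) (natural_filtration hunt_path t%:E)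
      (hunt_path (s + t)%:E @^-1` (Some @` A))
      (fun w => hunt_prob (hunt_path t%:E w)
                  (hunt_path s%:E @^-1` (Some @` A))) ;
  hunt_filtration_right_continuous : forall t : R, 0 <= t ->
    \bigcap_(s in [set s : R | t < s])
      completed_filtration hunt_path hunt_prob s%:E =
    completed_filtration hunt_path hunt_prob t%:E ;
  hunt_strong_markov :
    forall (nu : probability (borel (one_point_compactification M)) R)
      (sigma : Omega -> \bar R) (s : R)
      (A : set (borel (one_point_compactification M))),
    stopping_time (completed_filtration hunt_path hunt_prob) sigma ->
    0 <= s -> measurable A ->
    is_cond_probability (completed_law hunt_path hunt_prob nu)
      (stopped_salgebra (completed_filtration hunt_path hunt_prob) sigma)
      [set w | A (hunt_path (s%:E + sigma w)%E w)]
      (fun w => hunt_prob (hunt_path (sigma w) w) (hunt_path s%:E @^-1` A)) ;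
  hunt_quasi_left_continuous :
    forall (nu : probability (borel (one_point_compactification M)) R)
      (sigma_ : nat -> Omega -> \bar R) (sigma : Omega -> \bar R),
    (forall n, stopping_time (completed_filtration hunt_path hunt_prob)
      (sigma_ n)) ->
    (forall n w, (sigma_ n w <= sigma_ n.+1 w)%E) ->
    (forall w, sigma w = ereal_sup (range (sigma_ ^~ w))) ->
    completed_law hunt_path hunt_prob nu
      [set w | hunt_path (sigma_ n w) w @[n --> \oo] --> hunt_path (sigma w) w
               /\ (sigma w < +oo)%E] =
    completed_law hunt_path hunt_prob nu [set w | (sigma w < +oo)%E]
}.

Notation "'Pr[ X ]_ x" := (hunt_prob X x)
  (at level 8, X at level 99, x at level 2, format "''Pr[' X ]_ x").

(* Exit-time events belong to the completion of the measurable space only: the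
   completed probability is given by the outer measure. *)
Notation "'Prc[ X ]_ x" := (mu_ext (hunt_prob X x))
  (at level 8, X at level 99, x at level 2, format "''Prc[' X ]_ x").

(* Main.v *)
(* Let f be the distance to a set A contained in the inner part of U, let
   q = 2^(1 - 2 beta), and let S_k be the event that X_t is in A and f(X) stays
   below eps r 2^(-k-1) during the last q^k t units of time, where r is t^(1/beta),
   a number comparable with the distance from x to A, or R. If X_t is in A, then
   S_0 holds, or S_k fails and S_(k+1) holds for some k, or every S_k fails. On
   S_0 the path does not leave U, and (ii) applies directly. If S_k fails and
   S_(k+1) holds, then the continuous path crosses an annulus of width comparable
   with eps r 2^-k before time t - q^(k+1) t; by (iii) this has probability at most
   c exp(-E 2^k), while the Markov property at this deterministic time, (ii) and
   (i) bound the remaining factor by B^k times int_A F_t dmu. The probability that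
   S_k fails tends to 0, and the sum over k converges. Applying this to shells
   around x, and the Markov property at t - R^beta/2 for large t, gives
   P_x[X_t in A] <= int_A b_t(x, y) dmu(y) with an explicit b, hence a density for
   each (t, x) by Radon-Nikodym. A jointly measurable version is the a.e. limit of
   simple functions selected measurably in (t, x) from a countable dense subset of
   L^1, and p is its minimum with b. *)

Require Import Defs.
From HB Require Import structures.
From mathcomp Require Import all_boot all_order all_algebra.
From mathcomp Require Import all_classical all_reals all_analysis measurable_realfun.
From mathcomp Require Import ring lra.

Set Implicit Arguments.
Unset Strict Implicit.
Unset Printing Implicit Defensive.

Import Order.TTheory GRing.Theory Num.Theory.
Import numFieldNormedType.Exports.

Local Open Scope classical_set_scope.
Local Open Scope ring_scope.

(** The obvious way to split {X_t in A} uses the hitting time of an annulus around A, but such times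
    are measurable only after completion. Every path event is therefore a countable combination of
    conditions at dyadic times. A continuous path crossing an annulus spends an open time interval
    in it, hence is there at some dyadic time; on a fixed grid, decomposing by the first such time
    takes the place of the hitting time. The resulting bound does not depend on the grid, so the
    mesh may tend to 0.

    One crossing scale does not suffice: after a crossing the remaining time may be arbitrarily
    short, and condition (i) then allows arbitrarily large values of F. Each shortening of the time
    by q costs one factor B = q^(-alphaF) but doubles the crossing exponent, and exp(-E 2^k) beats
    B^k.

    The estimate yields a single exponential factor for the whole set A, determined by r. To express
    it through d(x, y), the distance from x must vary little on A, hence the thin shells. The slack
    between 9/40 and 1/5 pays for this variation and for the polynomial factors of (i). *)

Section estimates.
Context {R : realType}.

Lemma expR_ge_expr (m : nat) (y : R) : 0 <= y -> (0 < m)%N ->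
  (y / m%:R) ^+ m <= expR y.
Proof.
move=> y0 m0; have m0' : m%:R != 0 :> R by rewrite pnatr_eq0 -lt0n.
rewrite -[in leRHS](divfK m0' y) expRM_natr lerXn2r ?nnegrE ?expR_ge0//.
  by rewrite divr_ge0.
by apply: le_trans (expR_ge1Dx _); rewrite lerDr.
Qed.

Lemma expr2_gt (e : R) : 0 < e -> exists n, 1 < e * 2 ^+ n.
Proof.
move=> e0; exists (Num.truncn e^-1).+1.
have : e^-1 < (Num.truncn e^-1).+1%:R by apply: truncnS_gt.
move=> eK; rewrite -[ltLHS](mulfV (lt0r_neq0 e0)) ltr_pM2l//; apply: (lt_le_trans eK).
by rewrite -natrX ler_nat ltnW// ltn_expl.
Qed.

(** With m so large that B / 2^m <= 1/2, the bound exp(E 2^k) >= (E 2^k / m)^m leaves a multiple of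
    (B / 2^m)^k. Taking m = n + 1 keeps m positive. *)
Lemma expr_expR_le (B E : R) : 0 < B -> 0 < E ->
  exists2 C : R, 0 < C & forall k, B ^+ k * expR (- (E * 2 ^+ k)) <= C * 2 ^- k.
Proof.
move=> B0 E0; have [n hn] := @expr2_gt (2 * B)^-1 ltac:(by rewrite invr_gt0 mulr_gt0).
pose m := n.+1; have m0 : 0 < m%:R :> R by rewrite ltr0n.
have hm : B / 2 ^+ m <= 2^-1.
  rewrite ler_pdivrMr ?exprn_gt0// exprS mulKf//.
  by move: hn; rewrite mulrC ltr_pdivlMr ?mulr_gt0// mul1r; lra.
exists ((m%:R / E) ^+ m); first by rewrite exprn_gt0// divr_gt0.
move=> k; have p0 : (0 : R) < 2 ^+ k by rewrite exprn_gt0.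
have := @expR_ge_expr m (E * 2 ^+ k) (ltW (mulr_gt0 E0 p0)) isT.
have q0 : 0 < (E * 2 ^+ k / m%:R) ^+ m by rewrite exprn_gt0// divr_gt0// mulr_gt0.
rewrite -(lef_pV2 (_ : _ \is Num.pos) (_ : _ \is Num.pos)) ?posrE ?expR_gt0// -expRN => h.
apply: (@le_trans _ _ (B ^+ k * ((E * 2 ^+ k / m%:R) ^+ m)^-1)).
  by rewrite ler_wpM2l// exprn_ge0// ltW.
have -> : B ^+ k * ((E * 2 ^+ k / m%:R) ^+ m)^-1 = (m%:R / E) ^+ m * (B / 2 ^+ m) ^+ k.
  rewrite !expr_div_n !exprMn -!exprM (mulnC k m); field.
  by rewrite !expf_neq0 ?gt_eqF.
apply: ler_wpM2l; first by rewrite exprn_ge0// divr_ge0// ltW.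
rewrite -[leRHS]exprVn lerXn2r ?nnegrE//.
by apply: divr_ge0; [exact: ltW|exact: exprn_ge0].
Qed.

Lemma sum_half_le n : \sum_(k < n) 2 ^- k <= 2 :> R.
Proof.
suff -> : \sum_(k < n) 2 ^- k = 2 - 2 * 2 ^- n :> R.
  by rewrite lerBlDr lerDl mulr_ge0// invr_ge0 exprn_ge0.
elim: n => [|n IH]; first by rewrite big_ord0 expr0; lra.
rewrite big_ord_recr/= IH exprS invfM; lra.
Qed.

(** The total weight of the iteration over k. The exponent vanishes at k = 0 because a factor
    exp(-E) has already been taken out of every term. *)
Lemma sum_expr_expR_le (B E : R) : 0 < B -> 0 < E ->
  exists2 S : R, 0 < S & forall n,
    \sum_(k < n) B ^+ k.+1 * expR (- (E * (2 ^+ k - 1))) <= S.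
Proof.
move=> B0 E0; have [C C0 hC] := expr_expR_le B0 E0.
have K0 : 0 < B * expR E * C by rewrite !mulr_gt0// expR_gt0.
exists (B * expR E * C * 2); first by rewrite mulr_gt0.
move=> n; apply: (@le_trans _ _ (\sum_(k < n) B * expR E * C * 2 ^- k)).
  apply: ler_sum => k _; rewrite mulrBr mulr1 opprB expRD exprS.
  rewrite mulrACA -[leRHS]mulrA; apply: ler_wpM2l; last exact: hC.
  by rewrite mulr_ge0 ?expR_ge0// ltW.
rewrite -mulr_sumr ler_pM2l//.
exact: sum_half_le.
Qed.

(** For an integer m >= a / b one has u^a <= (u^b)^m when u >= 1, and the exponential dominates the
    m-th power. A fraction of the exponent thus pays for the polynomial factors coming from
    condition (i). *)
Lemma powR_le_expR (a b s : R) : 0 < a -> 0 < b -> 0 < s ->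
  exists2 C : R, 0 < C & forall u, 1 <= u -> u `^ a <= C * expR (s * u `^ b).
Proof.
move=> a0 b0 s0; pose m := (Num.truncn (a / b)).+1.
have m0 : 0 < m%:R :> R by rewrite ltr0n.
have hm : a <= b * m%:R.
  rewrite mulrC -ler_pdivrMr//; apply: ltW; exact: truncnS_gt.
exists ((m%:R / s) ^+ m); first by rewrite exprn_gt0// divr_gt0.
move=> u u1; have u0 : 0 <= u by lra.
have := @expR_ge_expr m (s * u `^ b) (mulr_ge0 (ltW s0) (powR_ge0 _ _)) isT.
rewrite -(ler_pM2l (_ : 0 < (m%:R / s) ^+ m)); last by rewrite exprn_gt0// divr_gt0.
apply: le_trans; rewrite -exprMn.
have -> : m%:R / s * (s * u `^ b / m%:R) = u `^ b.
  by field; rewrite !gt_eqF.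
by rewrite -powR_mulrn ?powR_ge0// -powRrM; exact: ler_powR.
Qed.

(** Here x is the starting point, a a point of A and z a point near A; [xa], [az], [xz] are their
    distances and [er] is eps r. In this lemma r is t^(1/beta); in the next ones s is t^(1/beta) and
    r the inner radius of a shell. *)
Lemma dist_near_le (er xa az xz r : R) : er <= r -> xz <= xa + az ->
  xa <= 18 * r -> az < er / 2 -> 0 < r -> xz <= 20 * r.
Proof. lra. Qed.

Lemma dist_far_le (er xa az xz r s : R) : er <= r -> xz <= xa + az ->
  xa <= r + s -> az < er / 2 -> 18 * s <= r -> 0 < s -> xz <= 2 * r.
Proof. lra. Qed.

Lemma far_pos (r s : R) : 18 * s <= r -> 0 < s -> 0 < r /\ s <= r.
Proof. by move=> *; split; lra. Qed.

Lemma far_ratio (r s u : R) : 18 * s <= r -> u <= r + s -> u <= 19 / 18 * r.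
Proof. lra. Qed.

Lemma half_lt (e r : R) : 0 < r -> e <= r -> e / 2 < r.
Proof. lra. Qed.

End estimates.

(** * Measurable functions and monotone limits *)

Section ind.
Context {R : realType} {d} {T : measurableType d}.
Local Open Scope ereal_scope.
Import HBNNSimple.

(** Induction principle for nonnegative measurable functions: a simple function is built from
    indicators by finitely many steps k f + g, and any function is an increasing limit of simple
    ones. *)
Lemma ge0_measurable_fun_ind (Q : (T -> \bar R) -> Prop) :
  (forall A, measurable A -> Q (fun x => (\1_A x)%:E)) ->
  (forall (k : R) f g, (0 <= k)%R -> measurable_fun setT f ->
     measurable_fun setT g -> (forall x, 0 <= f x) -> (forall x, 0 <= g x) ->
     Q f -> Q g -> Q (fun x => k%:E * f x + g x)) ->
  (forall (F : (T -> \bar R)^nat) f, (forall n, measurable_fun setT (F n)) ->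
     (forall n x, 0 <= F n x) -> (forall x, nondecreasing_seq (F ^~ x)) ->
     (forall x, F ^~ x @ \oo --> f x) -> (forall n, Q (F n)) -> Q f) ->
  forall f, measurable_fun setT f -> (forall x, 0 <= f x) -> Q f.
Proof.
move=> Qindic Qlin Qlim f mf f0.
pose g := nnsfun_approx measurableT mf.
apply: (Qlim (fun n => EFin \o g n)) => //.
- by move=> n; exact/measurable_EFinP.
- by move=> n x; rewrite lee_fin.
- by move=> x n m nm; rewrite lee_fin; exact/lefP/nd_nnsfun_approx.
- by move=> x; exact: cvg_nnsfun_approx.
move=> n; move: (g n) => h {g}.
(* Over an arbitrary list of values the filter keeps the coefficients nonnegative, as the linear
   case demands; it discards nothing when the list enumerates the range of [h]. *)
suff H (s : seq R) : Q (fun x => (\sum_(y <- s | (0 <= y)%R) y * \1_(h @^-1` [set y]) x)%:E).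
  have := H (finmap.enum_fset (fset_set (range h))); congr Q.
  apply/funext => x /=; congr EFin; rewrite fimfunE fsbig_finite//=.
  rewrite big_seq_cond [RHS]big_seq_cond; apply: eq_bigl => y.
  rewrite andbT in_fset_set// andb_idr//.
  by rewrite inE => -[z _ <-].
elim: s => [|y s IH].
  have := Qindic set0 measurable0; congr Q.
  by apply/funext => x; rewrite big_nil indic0.
case: (boolP (0 <= y)%R) => y0; last first.
  by move: IH; congr Q; apply/funext => x; rewrite big_cons (negbTE y0).
have -> : (fun x => (\sum_(z <- y :: s | (0 <= z)%R) z * \1_(h @^-1` [set z]) x)%:E) =
  (fun x => y%:E * (\1_(h @^-1` [set y]) x)%:E +
   (\sum_(z <- s | (0 <= z)%R) z * \1_(h @^-1` [set z]) x)%:E).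
  by apply/funext => x; rewrite big_cons y0 EFinD EFinM.
apply: Qlin => //.
- exact/measurable_EFinP.
- apply/measurable_EFinP.
  rewrite (_ : (fun x => _) = (fun x => (\sum_(z <- s) if (0 <= z)%R then z * \1_(h @^-1` [set z]) x else 0)%R)); last first.
    by apply/funext => x; rewrite big_mkcond.
  apply: measurable_sum => z; case: (0 <= z)%R => //.
  by apply: measurable_funM => //; exact: measurable_indic.
- by move=> x; rewrite lee_fin sumr_ge0// => z z0; rewrite mulr_ge0.
- exact: Qindic.
Qed.

Lemma ge0_integral_lin (mu : {measure set T -> \bar R}) D (k : R) f g :
  measurable D -> (0 <= k)%R -> measurable_fun setT f -> measurable_fun setT g ->
  (forall x, 0 <= f x) -> (forall x, 0 <= g x) ->
  \int[mu]_(x in D) (k%:E * f x + g x) =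
  k%:E * \int[mu]_(x in D) f x + \int[mu]_(x in D) g x.
Proof.
move=> mD k0 mf mg f0 g0.
have mf' : measurable_fun D f by exact: measurable_funTS.
have mg' : measurable_fun D g by exact: measurable_funTS.
rewrite ge0_integralD//.
- by rewrite ge0_integralZl_EFin.
- by move=> w _; rewrite mule_ge0.
- exact: measurable_funeM.
Qed.

Lemma ge0_cvg_monotone_convergence (mu : {measure set T -> \bar R}) D
    (F : (T -> \bar R)^nat) f :
  measurable D -> (forall n, measurable_fun setT (F n)) ->
  (forall n x, 0 <= F n x) -> (forall x, nondecreasing_seq (F ^~ x)) ->
  (forall x, F ^~ x @ \oo --> f x) ->
  \int[mu]_(x in D) F n x @[n --> \oo] --> \int[mu]_(x in D) f x.
Proof.
move=> mD mF F0 Fnd Ff.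
rewrite (_ : (\int[_]_(_ in _) f _) = \int[mu]_(x in D) limn (F ^~ x)).
  apply: cvg_monotone_convergence => //.
  by move=> n; exact: measurable_funTS.
by apply: eq_integral => w _; exact/esym/cvg_lim.
Qed.

End ind.

(** * The simple Markov property *)

Section hunt.
Context {R : realType} {M : pmetricType R} {d : measure_display}
  {Omega : measurableType d}.
Local Notation MD := (one_point_compactification M).
Variable X : hunt_process M Omega.
Local Open Scope ereal_scope.
Implicit Types (A B : set (borel M)) (L : set Omega).

Lemma open_measurable_borel (T : ptopologicalType) (A : set T) :
  open A -> measurable (A : set (borel T)).
Proof. exact: sub_gen_smallest. Qed.

Lemma measurable_Some A : measurable A -> measurable (Some @` A : set (borel MD)).
Proof.
have mT : measurable (Some @` [set: M] : set (borel MD)).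
  by apply: open_measurable_borel; apply: one_point_compactification_open_some; exact: openT.
suff : (measurable : set (set (borel M))) `<=`
    [set A : set M | measurable (Some @` A : set (borel MD))] by apply.
apply: smallest_sub; first split => /=.
  - by rewrite image_set0; exact: measurable0.
  - move=> B mB.
    rewrite (_ : Some @` _ = (Some @` [set: M] : set (borel MD)) `\` (Some @` B)); first exact: measurableD.
    apply/seteqP; split => [_ [x [_ Bx] <-]|[x|] [[y _ //= [yx]] Bx]].
      by split; [exists x|move=> [y By [yx]]; apply: Bx; rewrite -yx].
    by exists x => //; split => // Bx'; apply: Bx; exists x.
  - move=> F mF; rewrite image_bigcup; exact: bigcup_measurable.
move=> B oB /=; apply: open_measurable_borel.
exact: one_point_compactification_open_some.
Qed.

Definition at_time (t : R) A : set Omega := X t%:E @^-1` (Some @` A).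

Lemma measurable_at_time (t : R) A :
  (0 <= t)%R -> measurable A -> measurable (at_time t A).
Proof.
move=> t0 mA; rewrite -[at_time _ _]setTI.
by apply: (hunt_measurable X) => //; exact: measurable_Some.
Qed.

Local Notation Fil t := (natural_filtration X t%:E).

Lemma natural_filtration_at_time (s t : R) A :
  (0 <= s <= t)%R -> measurable A -> Fil t (at_time s A).
Proof.
move=> st mA; apply: sub_gen_smallest; exists s%:E; rewrite ?lee_fin//=.
by exists (Some @` A) => //=; exact: measurable_Some.
Qed.

Lemma natural_filtration_le (s t : R) : (s <= t)%R -> Fil s `<=` Fil t.
Proof.
move=> st; apply: smallest_sub; first exact: smallest_sigma_algebra.
move=> L [u /= /andP[u0 us] [A mA <-]].
apply: sub_gen_smallest; exists u; last by exists A.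
by rewrite /= u0 (le_trans us)// lee_fin.
Qed.

Lemma measurable_natural_filtration (t : R) L : (0 <= t)%R -> Fil t L -> measurable L.
Proof.
move=> t0; move: L; apply: smallest_sub; first exact: sigma_algebra_measurable.
move=> _ [u /= /andP[u0 us] [A mA <-]].
rewrite -[_ @^-1` _]setTI.
by apply: (hunt_measurable X).
Qed.

Lemma natural_filtrationI (t : R) L L' : Fil t L -> Fil t L' -> Fil t (L `&` L').
Proof.
have H : <<s Fil t >> = Fil t by apply: sigma_algebra_id; exact: smallest_sigma_algebra.
by rewrite -H; exact: (@measurableI _ (g_sigma_algebraType (Fil t))).
Qed.

Lemma natural_filtration_bigcup (t : R) (F : (set Omega)^nat) :
  (forall n, Fil t (F n)) -> Fil t (\bigcup_n F n).
Proof. exact: sigma_algebra_bigcup. Qed.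

Lemma natural_filtrationC (t : R) L : Fil t L -> Fil t (~` L).
Proof. by move=> FL; rewrite -setTD; exact: sigma_algebraCD. Qed.

(** The value 0 at the cemetery means that only living paths contribute to expectations. *)
Definition ext (phi : M -> \bar R) (z : MD) : \bar R :=
  if z is Some x then phi x else 0.

Lemma ext_ge0 phi z : (forall x, 0 <= phi x) -> 0 <= ext phi z.
Proof. by move=> phi0; case: z => //=. Qed.

Lemma measurable_ext phi : measurable_fun setT (phi : borel M -> \bar R) ->
  (forall x, 0 <= phi x) ->
  measurable_fun setT (ext phi : borel MD -> \bar R).
Proof.
move=> mphi _ mY Y mYY; rewrite setTI.
have [Y0|Y0] := pselect (Y 0).
  rewrite (_ : _ @^-1` _ = ~` (Some @` (phi @^-1` (~` Y)))).
    apply: measurableC; apply: measurable_Some.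
    by rewrite -[X in measurable X]setTI; apply: mphi => //; exact: measurableC.
  apply/seteqP; split => [[x|] /= Yx|[x|] /= H].
  - by move=> [y nYy [yx]]; apply: nYy; rewrite yx.
  - by move=> [y _].
  - by apply: contrapT => nYx; apply: H; exists x.
  - by [].
rewrite (_ : _ @^-1` _ = Some @` (phi @^-1` Y)).
  apply: measurable_Some.
  by rewrite -[X in measurable X]setTI; exact: mphi.
apply/seteqP; split => [[x|] /= Yx|[x|] /= H] //.
- by exists x.
- by case: H => y Yy [<-].
- by case: H.
Qed.

Lemma dead_event (s : R) A : (0 <= s)%R -> measurable A ->
  'Pr[X]_None (at_time s A) = 0.
Proof.
move=> s0 mA.
have mN : measurable (X s%:E @^-1` [set None]).
  rewrite (_ : _ @^-1` _ = ~` at_time s setT).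
    by apply: measurableC; exact: measurable_at_time.
  apply/seteqP; split => w; rewrite /at_time /=; first by move=> -> [].
  by case: (X _ w) => // x; case; exists x.
have H : 'Pr[X]_None (~` (X s%:E @^-1` [set None])) = 0.
  by rewrite probability_setC// (hunt_trap X)// subee.
apply: (subset_measure0 _ _ _ H).
- exact: measurable_at_time.
- exact: measurableC.
- by move=> w [x _ xw] /= nw; rewrite nw in xw.
Qed.

(** The Markov property is stated with an integral over the measurable space carrying only F_t. The
    identity map onto that space is measurable, and the pushforward formula brings the integral back
    to the original space. *)
Lemma integral_natural_filtration (P : probability Omega R) (t : R) L f :
  (0 <= t)%R -> Fil t L -> (forall w, 0 <= f w) ->
  measurable_fun setT (f : g_sigma_algebraType (Fil t) -> \bar R) ->
  @integral _ (g_sigma_algebraType (Fil t)) R P L f = \int[P]_(w in L) f w.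
Proof.
move=> t0 FL f0 mf.
have mid : measurable_fun setT (id : Omega -> g_sigma_algebraType (Fil t)).
  move=> _ Y mY; rewrite setTI; apply: measurable_natural_filtration t0 _.
  rewrite -[X in X _](sigma_algebra_id (smallest_sigma_algebra _ _)).
  exact: mY.
have := @ge0_integral_pushforward _ _ Omega (g_sigma_algebraType (Fil t)) R id mid P L f.
rewrite /=; apply.
- exact: sub_gen_smallest.
- exact: measurable_funTS.
- by move=> w _; exact: f0.
Qed.

Lemma markov_event x (s t : R) A L : (0 <= s)%R -> (0 <= t)%R -> measurable A ->
  Fil t L ->
  'Pr[X]_x (at_time (s + t) A `&` L) =
  \int['Pr[X]_x]_(w in L) ext (fun z => 'Pr[X]_(Some z) (at_time s A)) (X t%:E w).
Proof.
move=> s0 t0 mA FL.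
have [mg ->] := hunt_markov X x s0 t0 mA; last exact: sub_gen_smallest.
rewrite integral_natural_filtration//.
apply: eq_integral => w _.
by case: (X t%:E w) => //=; exact: dead_event.
Qed.


Lemma measurable_transition (s : R) A : (0 <= s)%R -> measurable A ->
  measurable_fun setT ((fun z => 'Pr[X]_(Some z) (at_time s A)) : borel M -> \bar R).
Proof. exact: hunt_transition_measurable. Qed.

Lemma measurable_path (t : R) : (0 <= t)%R ->
  measurable_fun setT (X t%:E : Omega -> borel MD).
Proof. by move=> t0; apply: (hunt_measurable X). Qed.

Definition trans (s : R) (phi : M -> \bar R) (x : M) : \bar R :=
  \int['Pr[X]_(Some x)]_w ext phi (X s%:E w).

Lemma ext_indic A s w : ext (fun x => (\1_A x)%:E) (X s%:E w) = (\1_(at_time s A) w)%:E.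
Proof.
rewrite /at_time /ext/= !indicE.
case E: (X s%:E w) => [x|] /=.
  congr (_%:R%:E); congr (nat_of_bool _); apply/idP/idP.
    by rewrite !inE => Ax; rewrite /= E; exists x.
  by rewrite !inE /= E => -[y Ay [<-]].
by rewrite memNset//= E => -[].
Qed.

Lemma trans_indic s A x : (0 <= s)%R -> measurable A ->
  trans s (fun x => (\1_A x)%:E) x = 'Pr[X]_(Some x) (at_time s A).
Proof.
move=> s0 mA; rewrite /trans.
under eq_integral do rewrite ext_indic.
by rewrite integral_indic ?setIT//; exact: measurable_at_time.
Qed.

Lemma measurable_ext_path phi s : (0 <= s)%R ->
  measurable_fun setT (phi : borel M -> \bar R) ->
  (forall x, 0 <= phi x) ->
  measurable_fun setT (fun w => ext phi (X s%:E w)).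
Proof.
move=> s0 mphi phi0.
apply: (@measurableT_comp _ _ _ _ (borel MD) _ (ext phi) _ (X s%:E)).
- exact: measurable_ext.
- exact: measurable_path.
Qed.

Lemma trans_ge0 s phi x : (forall x, 0 <= phi x) -> 0 <= trans s phi x.
Proof. by move=> phi0; apply: integral_ge0 => w _; exact: ext_ge0. Qed.

Lemma extD k phi psi z : ext (fun x => k%:E * phi x + psi x) z =
  k%:E * ext phi z + ext psi z.
Proof. by case: z => //=; rewrite mule0 adde0. Qed.

Lemma ext_cvg (F : (M -> \bar R)^nat) f z :
  (forall x, F ^~ x @ \oo --> f x) -> ext (F n) z @[n --> \oo] --> ext f z.
Proof. by move=> Ff; case: z => [x|] /=; [exact: Ff|exact: cvg_cst]. Qed.

Lemma transD s (k : R) f g x : (0 <= s)%R -> (0 <= k)%R ->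
  measurable_fun setT (f : borel M -> \bar R) ->
  measurable_fun setT (g : borel M -> \bar R) ->
  (forall x, 0 <= f x) -> (forall x, 0 <= g x) ->
  trans s (fun x => k%:E * f x + g x) x = k%:E * trans s f x + trans s g x.
Proof.
move=> s0 k0 mf mg f0 g0; rewrite /trans.
under eq_integral do rewrite extD.
apply: ge0_integral_lin.
- exact: measurableT.
- exact: k0.
- exact: measurable_ext_path.
- exact: measurable_ext_path.
- by move=> w; exact: ext_ge0.
- by move=> w; exact: ext_ge0.
Qed.

Lemma ext_nd (F : (M -> \bar R)^nat) z :
  (forall x, nondecreasing_seq (F ^~ x)) -> nondecreasing_seq (fun n => ext (F n) z).
Proof. by move=> Fnd; case: z => //= x; exact: Fnd. Qed.

Lemma trans_cvg s (F : (M -> \bar R)^nat) f x : (0 <= s)%R ->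
  (forall n, measurable_fun setT (F n : borel M -> \bar R)) ->
  (forall n x, 0 <= F n x) -> (forall x, nondecreasing_seq (F ^~ x)) ->
  (forall x, F ^~ x @ \oo --> f x) ->
  trans s (F n) x @[n --> \oo] --> trans s f x.
Proof.
move=> s0 mF F0 Fnd Ff; rewrite /trans.
apply: ge0_cvg_monotone_convergence.
- exact: measurableT.
- by move=> n; exact: measurable_ext_path.
- by move=> n w; exact: ext_ge0.
- by move=> w; exact: ext_nd.
- by move=> w; exact: ext_cvg.
Qed.

Lemma measurable_trans s phi : (0 <= s)%R ->
  measurable_fun setT (phi : borel M -> \bar R) ->
  (forall x, 0 <= phi x) ->
  measurable_fun setT (trans s phi : borel M -> \bar R).
Proof.
move=> s0; move: phi; apply: ge0_measurable_fun_ind.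
- move=> A mA; rewrite (_ : trans s _ = fun z => 'Pr[X]_(Some z) (at_time s A)).
    exact: measurable_transition.
  by apply/funext => z; exact: trans_indic.
- move=> k f g k0 mf mg f0 g0 mtf mtg.
  rewrite (_ : trans s _ = fun z => k%:E * trans s f z + trans s g z); last first.
    by apply/funext => z; exact: transD.
  by apply: emeasurable_funD => //; exact: measurable_funeM.
- move=> F f mF F0 Fnd Ff mtF.
  by apply: (emeasurable_fun_cvg _ _ mtF) => x _; exact: trans_cvg.
Qed.

(** Both sides are linear in [phi] and continuous along increasing limits, so the case of
    indicators, [markov_event], is enough. *)
Lemma simple_markov x (s t : R) phi L : (0 <= s)%R -> (0 <= t)%R ->
  Fil t L ->
  measurable_fun setT (phi : borel M -> \bar R) ->
  (forall x, 0 <= phi x) ->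
  \int['Pr[X]_x]_(w in L) ext phi (X (s + t)%:E w) =
  \int['Pr[X]_x]_(w in L) ext (trans s phi) (X t%:E w).
Proof.
move=> s0 t0 FL.
have mL : measurable L by exact: measurable_natural_filtration FL.
have st0 : (0 <= s + t)%R by rewrite addr_ge0.
move: phi; apply: ge0_measurable_fun_ind.
- move=> A mA.
  under eq_integral do rewrite ext_indic.
  rewrite integral_indic//; last exact: measurable_at_time.
  apply: etrans; first exact: (markov_event x s0 t0 mA FL).
  apply: eq_integral => w _.
  by case: (X _ w) => //= z; apply/esym; exact: trans_indic.
- move=> k f g k0 mf mg f0 g0 IHf IHg.
  have mtf := measurable_trans s0 mf f0; have mtg := measurable_trans s0 mg g0.
  have tf0 := fun y => @trans_ge0 s f y f0; have tg0 := fun y => @trans_ge0 s g y g0.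
  transitivity (\int['Pr[X]_x]_(w in L)
    (k%:E * ext f (X (s + t)%:E w) + ext g (X (s + t)%:E w))).
    by apply: eq_integral => w _; exact: extD.
  transitivity (\int['Pr[X]_x]_(w in L)
    (k%:E * ext (trans s f) (X t%:E w) + ext (trans s g) (X t%:E w))); last first.
    apply: eq_integral => w _; rewrite -extD.
    by case: (X _ w) => [z|//]; apply/esym; exact: transD.
  apply: etrans.
    apply: (ge0_integral_lin _ mL k0 (measurable_ext_path st0 mf f0)
      (measurable_ext_path st0 mg g0)) => w; exact: ext_ge0.
  apply: etrans; last first.
    apply/esym/(ge0_integral_lin _ mL k0 (measurable_ext_path t0 mtf tf0)
      (measurable_ext_path t0 mtg tg0)) => w; exact: ext_ge0.
  by rewrite IHf IHg.
- move=> F f mF F0 Fnd Ff IH.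
  have mt n := measurable_trans s0 (mF n) (F0 n).
  have tf0 n := fun y => @trans_ge0 s (F n) y (F0 n).
  have tnd y : nondecreasing_seq (fun n => trans s (F n) y).
    move=> n m nm; apply: ge0_le_integral.
    - exact: measurableT.
    - by move=> w _; apply: ext_ge0; exact: F0.
    - by apply: measurable_ext_path; [exact: s0|exact: mF|exact: F0].
    - by apply: measurable_ext_path; [exact: s0|exact: mF|exact: F0].
    - by move=> w _; apply: ext_nd.
  have tcv z : (fun n => trans s (F n) z) @ \oo --> trans s f z by exact: trans_cvg.
  have H1 : \int['Pr[X]_x]_(w in L) ext (F n) (X (s + t)%:E w) @[n --> \oo] -->
      \int['Pr[X]_x]_(w in L) ext f (X (s + t)%:E w).
    apply: ge0_cvg_monotone_convergence.
    - exact: mL.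
    - by move=> n; exact: measurable_ext_path.
    - by move=> n w; exact: ext_ge0.
    - by move=> w; exact: ext_nd.
    - by move=> w; exact: ext_cvg.
  have H2 : \int['Pr[X]_x]_(w in L) ext (trans s (F n)) (X t%:E w) @[n --> \oo] -->
      \int['Pr[X]_x]_(w in L) ext (trans s f) (X t%:E w).
    apply: ge0_cvg_monotone_convergence.
    - exact: mL.
    - by move=> n; exact: measurable_ext_path.
    - by move=> n w; exact: ext_ge0.
    - by move=> w; exact: ext_nd.
    - by move=> w; exact: ext_cvg.
  apply: (cvg_unique _ H1); first exact: ereal_hausdorff.
  by rewrite (_ : (fun n => _) = (fun n =>
    \int['Pr[X]_x]_(w in L) ext (trans s (F n)) (X t%:E w))) //; apply/funext.
Qed.

End hunt.

(** * Finite-dimensional events and the iterated Markov property *)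

Section cylinders.
Context {R : realType} {M : pmetricType R} {d : measure_display}
  {Omega : measurableType d}.
Variable X : hunt_process M Omega.
Local Open Scope ereal_scope.
Local Notation Fil t := (natural_filtration X t%:E).
Local Notation at_time := (at_time X).

(* A step (h, B) stands for waiting a time h and then being in B. *)
Definition step : Type := (R * set (borel M))%type.

(** Backward recursion for the probability, from a given starting point, of performing all the steps
    of the list; [killedE] makes this precise. *)
Fixpoint killed (l : seq step) : M -> \bar R :=
  if l is (h, B) :: l' then trans X h (fun z => (\1_B z)%:E * killed l' z)
  else cst 1.

Fixpoint cylinder (a : R) (l : seq step) : set Omega :=
  if l is (h, B) :: l' then at_time (h + a) B `&` cylinder (h + a) l' else setT.

Fixpoint valid (l : seq step) : Prop :=
  if l is (h, B) :: l' then [/\ (0 <= h)%R, measurable B & valid l'] else True.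

Lemma killed_ge0 l x : 0 <= killed l x.
Proof.
elim: l x => [|[h B] l IH] x //=.
by apply: trans_ge0 => z; rewrite mule_ge0.
Qed.

Lemma measurable_killed l : valid l ->
  measurable_fun setT (killed l : borel M -> \bar R).
Proof.
elim: l => [_|[h B] l IH /= [h0 mB vl]] /=; first exact: measurable_cst.
apply: measurable_trans => //.
- apply: emeasurable_funM; last exact: IH.
  by apply/measurable_EFinP; exact: measurable_indic.
- by move=> z; rewrite mule_ge0//; exact: killed_ge0.
Qed.

Lemma measurable_cylinder a l : (0 <= a)%R -> valid l -> measurable (cylinder a l).
Proof.
elim: l a => [|[h B] l IH] a a0 //= [h0 mB vl].
apply: measurableI.
- by apply: measurable_at_time => //; rewrite addr_ge0.
- by apply: IH => //; rewrite addr_ge0.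
Qed.

(** The first step is moved into L, the induction hypothesis is applied at its end, and the Markov
    property over its duration brings the integrand back to time a. L must consist of paths alive at
    time a, since the empty list has weight 1 on M but 0 at the cemetery. *)
Lemma markov_cylinder x (a : R) L l : (0 <= a)%R -> Fil a L ->
  L `<=` at_time a setT -> valid l ->
  'Pr[X]_x (L `&` cylinder a l) = \int['Pr[X]_x]_(w in L) ext (killed l) (X a%:E w).
Proof.
elim: l a L => [|[h B] l IH] a L a0 FL La vl.
  have mL : measurable L by exact: measurable_natural_filtration FL.
  rewrite /= setIT.
  transitivity (\int['Pr[X]_x]_(w in L) (cst 1) w).
    by rewrite integral_cst// mul1e.
  by apply: eq_integral => w /set_mem /La[y _ /= <-].
have mL : measurable L by exact: measurable_natural_filtration FL.
case: vl => h0 mB vl; have ha0 : (0 <= h + a)%R by rewrite addr_ge0.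
have mK := measurable_killed vl.
rewrite [cylinder _ _]/= setIA IH//; first last.
- by move=> w [_ [y _ yw]]; exists y.
- apply: natural_filtrationI; first by apply: natural_filtration_le FL; rewrite lerDr.
  by apply: natural_filtration_at_time; rewrite ?ha0 ?lexx.
have mphi : measurable_fun setT
    ((fun z => (\1_B z)%:E * killed l z) : borel M -> \bar R).
  apply: emeasurable_funM; last exact: mK.
  by apply/measurable_EFinP; exact: measurable_indic.
have phi0 z : 0 <= (\1_B z)%:E * killed l z by rewrite mule_ge0//; exact: killed_ge0.
have mk := simple_markov x h0 a0 FL mphi phi0.
transitivity (\int['Pr[X]_x]_(w in L)
  ext (fun z : borel M => (\1_B z)%:E * killed l z) (X (h + a)%:E w)); last first.
  exact: mk.
rewrite integral_mkcondr; apply: eq_integral => w _.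
rewrite /patch; case: ifPn => [/set_mem|/negP H].
- by rewrite /at_time => -[y By /= <-] /=; rewrite indicE mem_set// mul1e.
- case E: (X (h + a)%:E w) => [y|//] /=.
  rewrite indicE memNset ?mul0e// => By; apply: H; rewrite inE.
  by exists y => //; rewrite E.
Qed.

Lemma measurable_singleton (x : M) : measurable ([set x] : set (borel M)).
Proof.
have : closed [set x].
  by apply: accessible_closed_set1; apply: hausdorff_accessible; exact: metric_hausdorff.
move=> /closed_openC oC; rewrite -(setCK [set x]); apply: measurableC.
exact: open_measurable_borel.
Qed.

Lemma start_at_time (x : M) : 'Pr[X]_(Some x) (at_time 0 [set x]) = 1.
Proof. by rewrite -(hunt_normal X (Some x)) /at_time image_set1. Qed.

Lemma probability_setI1 (P : probability Omega R) (D C : set Omega) :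
  measurable D -> measurable C -> P D = 1 -> P (D `&` C) = P C.
Proof.
move=> mD mC PD.
have nD : P (~` D) = 0 by rewrite probability_setC// PD subee.
apply/esym; apply: etrans; first exact: (measureDI P mC mD).
rewrite [X in X + _ = _](_ : _ = 0) ?add0e 1?setIC//.
apply: (subset_measure0 _ _ _ nD).
- exact: measurableD.
- exact: measurableC.
- by move=> w [].
Qed.

(** This is [markov_cylinder] at time 0, with L the event X_0 = z of full measure. *)
Lemma killedE l z : valid l -> killed l z = 'Pr[X]_(Some z) (cylinder 0 l).
Proof.
move=> vl; have mz := measurable_singleton z.
have Fz : Fil 0 (at_time 0 [set z]).
  by apply: natural_filtration_at_time; rewrite ?lexx.
have zT : at_time 0 [set z] `<=` at_time 0 setT by move=> w [y _ yw]; exists y.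
have mCz : measurable (at_time 0 [set z]) by exact: measurable_at_time.
apply/esym; rewrite -(@probability_setI1 _ (at_time 0 [set z]))//.
- apply: etrans; first exact: (markov_cylinder _ (lexx _) Fz zT vl).
  transitivity (\int['Pr[X]_(Some z)]_(w in at_time 0 [set z]) (cst (killed l z)) w).
    by apply: eq_integral => w /set_mem[y /= -> <-].
  by rewrite integral_cst// -[RHS]mule1; congr (_ * _); exact: start_at_time.
- exact: measurable_cylinder.
- exact: start_at_time.
Qed.

(** A Markov inequality for decreasing limits of cylinders. The same lists describe the event after
    time a and its copy started at 0; the two sides of [markov_cylinder] pass to the limit by
    continuity from above and by dominated convergence with bound 1. *)
Lemma markov_cylinders_le x (a : R) L G (l : nat -> seq step) kappa :
  (0 <= a)%R -> Fil a L -> L `<=` at_time a G -> 0 <= kappa ->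
  (forall n, valid (l n)) ->
  (forall b, nonincreasing_seq (fun n => cylinder b (l n))) ->
  (forall z, G z -> 'Pr[X]_(Some z) (\bigcap_n cylinder 0 (l n)) <= kappa) ->
  'Pr[X]_x (L `&` \bigcap_n cylinder a (l n)) <= kappa * 'Pr[X]_x L.
Proof.
move=> a0 FL LG kappa0 vl ndl Gk.
have mL : measurable L by exact: measurable_natural_filtration FL.
have mC b n : (0 <= b)%R -> measurable (cylinder b (l n)) by move=> b0; exact: measurable_cylinder.
have LT : L `<=` at_time a setT by move=> w /LG[y _ yw]; exists y.
have cvgP : 'Pr[X]_x (L `&` cylinder a (l n)) @[n --> \oo] -->
    'Pr[X]_x (L `&` \bigcap_n cylinder a (l n)).
  rewrite -bigcapIr; last by exists 0%N.
  apply: nonincreasing_cvg_mu.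
  - by rewrite ltey_eq fin_num_measure//; apply: measurableI => //; exact: mC.
  - by move=> n; apply: measurableI => //; exact: mC.
  - by apply: bigcapT_measurable => n; apply: measurableI => //; exact: mC.
  - by move=> n m nm; apply/subsetPset; apply: setIS; apply/subsetPset/ndl.
have cvgz z : killed (l n) z @[n --> \oo] --> 'Pr[X]_(Some z) (\bigcap_n cylinder 0 (l n)).
  rewrite (_ : (fun n => _) = (fun n => 'Pr[X]_(Some z) (cylinder 0 (l n)))); last first.
    by apply/funext => n; exact: killedE.
  apply: nonincreasing_cvg_mu.
  - by rewrite ltey_eq fin_num_measure//; exact: mC.
  - by move=> n; exact: mC.
  - by apply: bigcapT_measurable => n; exact: mC.
  - exact: ndl.
have mext n := measurable_ext_path X a0 (measurable_killed (vl n)) (killed_ge0 (l n)).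
pose phi z := 'Pr[X]_(Some z) (\bigcap_n cylinder 0 (l n)).
have ccv : \int['Pr[X]_x]_(w in L) ext (killed (l n)) (X a%:E w) @[n --> \oo]
    --> \int['Pr[X]_x]_(w in L) ext phi (X a%:E w).
  apply: (@dominated_cvg _ _ _ _ _ mL _ _ (cst 1)).
  - by move=> n; apply: measurable_funTS; exact: mext.
  - by move=> w _; exact: ext_cvg.
  - by [].
  - by apply: finite_measure_integrable_cst.
  - move=> n w _; rewrite gee0_abs; last by apply: ext_ge0; exact: killed_ge0.
    case: (X a%:E w) => [z|] //=; rewrite killedE//; apply: probability_le1; exact: mC.
have -> : 'Pr[X]_x (L `&` \bigcap_n cylinder a (l n)) =
    \int['Pr[X]_x]_(w in L) ext phi (X a%:E w).
  apply: (cvg_unique _ cvgP).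
    exact: ereal_hausdorff.
  rewrite /= (_ : (fun n => 'Pr[X]_x _) = (fun n =>
    \int['Pr[X]_x]_(w in L) ext (killed (l n)) (X a%:E w))) //.
  by apply/funext => n; exact: markov_cylinder.
apply: (@le_trans _ _ (\int['Pr[X]_x]_(w in L) (cst kappa) w)); last by rewrite integral_cst.
apply: ge0_le_integral => //.
- by move=> w _; apply: ext_ge0.
- apply: (emeasurable_fun_cvg (fun n w => ext (killed (l n)) (X a%:E w))).
    by move=> n; apply: measurable_funTS; exact: mext.
  by move=> w _; exact: ext_cvg.
- by move=> w /LG[z Gz <-]; exact: Gk.
Qed.

End cylinders.

(** * Crossing estimates along continuous paths *)

Section dyadic.
Context {R : realType}.

Lemma dyadic_dense (x y : R) : 0 <= x -> x < y -> y <= 1 ->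
  exists n i : nat, (0 < i <= 2 ^ n)%N /\ x < i%:R / 2 ^+ n < y.
Proof.
move=> x0 xy y1; have [n hn] := @expr2_gt R (y - x) ltac:(by rewrite subr_gt0).
have p0 : (0 : R) < 2 ^+ n by rewrite exprn_gt0.
pose i := (Num.truncn (x * 2 ^+ n)).+1.
have /andP[i1 i2] : i.-1%:R <= x * 2 ^+ n < i%:R.
  by apply: truncn_itv; rewrite mulr_ge0// ltW.
have i3 : i%:R < y * 2 ^+ n.
  have : i%:R = i.-1%:R + 1 :> R by rewrite -natr1.
  move=> ->; lra.
exists n, i; split.
  rewrite /i ltn0Sn/= -/i -(ler_nat R) natrX; nra.
by rewrite ltr_pdivlMr// ltr_pdivrMr// i2 i3.
Qed.

End dyadic.

Section paths.
Context {R : realType} {M : pmetricType R} {d : measure_display}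
  {Omega : measurableType d}.
Variable X : hunt_process M Omega.
Local Open Scope ereal_scope.
Local Notation Fil t := (natural_filtration X t%:E).
Local Notation at_time := (at_time X).
Local Notation MD := (one_point_compactification M).

(** Exchanging x and y gives the absolute value, so these are the 1-Lipschitz functions. *)
Definition lip (f : M -> R) := forall x y, (f x - f y <= mdist x y)%R.

Lemma lip_continuous f : lip f -> continuous f.
Proof.
move=> lf x; apply/cvgrPdist_lt => e e0.
have : nbhs x (ball x e) by exact: nbhsx_ballx.
apply: filterS => y; rewrite ballEmdist/= => xy.
by rewrite ltr_norml; have := lf x y; have := lf y x; rewrite metric_sym; lra.
Qed.

Lemma mdist_lip (x : M) : lip (mdist x).
Proof.
move=> y z; rewrite lerBlDr addrC.
by have := metric_triangle x z y; rewrite (metric_sym z y).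
Qed.

Lemma measurable_continuous_borel (phi : M -> R) : continuous phi ->
  measurable_fun setT (phi : borel M -> R).
Proof.
move=> cphi.
apply: (measurability _ (RGenOpens.measurableE R)) => _ [_ [a [e ->] <-]].
rewrite setTI; apply: open_measurable_borel.
by apply: open_comp => // y _; exact: cphi.
Qed.

Lemma measurable_mdist_section (x : M) : measurable_fun setT (mdist x : borel M -> R).
Proof. by apply: measurable_continuous_borel; apply: lip_continuous; exact: mdist_lip. Qed.

Lemma open_lip_lt f r : lip f -> open [set z | (f z < r)%R].
Proof. by move=> /lip_continuous cf; exact: (open_comp (fun x _ => cf x) (@open_lt R r)). Qed.

Lemma open_lip_gt f r : lip f -> open [set z | (r < f z)%R].
Proof. by move=> /lip_continuous cf; exact: (open_comp (fun x _ => cf x) (@open_gt R r)). Qed.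

Lemma measurable_lip_lt f r : lip f -> measurable ([set z | (f z < r)%R] : set (borel M)).
Proof. by move=> lf; apply: open_measurable_borel; exact: open_lip_lt. Qed.

Lemma dead_mono (s t : R) w : (s <= t)%R -> (0 <= s)%R -> X s%:E w = None -> X t%:E w = None.
Proof.
move=> st s0 Xs; apply: (@hunt_dead _ _ _ _ X); apply: (@le_trans _ _ s%:E); last by rewrite lee_fin.
by apply: ereal_inf_lbound; exists s.
Qed.

Lemma right_open (t v : R) (G : set M) w : (0 <= t)%R -> (t < v)%R -> open G -> at_time t G w ->
  exists u, [/\ (t < u)%R, (u <= v)%R & forall s, (t < s < u)%R -> at_time s G w].
Proof.
move=> t0 tv oG [y Gy yX].
have nG : nbhs (X t%:E w) (Some @` G : set MD).
  rewrite -yX; apply: one_point_compactification_some_nbhs.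
  by apply: open_nbhs_nbhs.
have := @hunt_right_continuous _ _ _ _ X _ w t0 _ nG.
rewrite /nbhs/= /nbhs/= /at_right /within /= => /nbhs_ballP[e /= e0 He].
exists (Num.min v (t + e)%R); split.
- by rewrite lt_min tv ltrDl.
- by rewrite ge_min lexx.
- move=> s /andP[ts]; rewrite lt_min => /andP[_ se]; apply: He => //.
  rewrite /ball/= ltr_norml; lra.
Qed.

Definition dyadic_time (a h : R) (n i : nat) : R := (a + h * (i%:R / 2 ^+ n))%R.

(* Dyadic times keep the event measurable; right-continuity recovers the other
   times up to the closure of G. *)
Definition stay (a h : R) (G A : set (borel M)) : set Omega :=
  [set w | forall n i, (0 < i <= 2 ^ n)%N -> at_time (dyadic_time a h n i) G w]
  `&` at_time (a + h) A.

Lemma dyadic_dense_time (a h u v : R) : (0 < h)%R -> (a <= u)%R -> (u < v)%R -> (v <= a + h)%R ->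
  exists n i : nat, (0 < i <= 2 ^ n)%N /\ (u < dyadic_time a h n i < v)%R.
Proof.
move=> h0 au uv va; have [||| n [i [i1 /andP[i2 i3]]]] := @dyadic_dense R ((u - a) / h) ((v - a) / h).
- by apply: divr_ge0; [rewrite subr_ge0|exact: ltW].
- by rewrite ltr_pM2r ?invr_gt0// ltrD2r.
- by rewrite ler_pdivrMr// mul1r lerBlDl.
exists n, i; split => //; rewrite /dyadic_time.
move: i2 i3; rewrite ltr_pdivrMr// ltr_pdivlMr// [(_ * h)%R]mulrC.
by move=> ? ?; apply/andP; split; lra.
Qed.

(** If f exceeded [rho] at time u, right-continuity would keep it above [rho] during an interval
    after u, and this interval contains a dyadic time. The final time leaves no room to its right,
    but is itself dyadic. The path is alive throughout because it ends in A. *)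
Lemma stay_closed (a h rho : R) f A w : (0 <= a)%R -> (0 < h)%R -> lip f ->
  stay a h [set z | (f z < rho)%R] A w ->
  forall u, (a <= u <= a + h)%R -> at_time u [set z | (f z <= rho)%R] w.
Proof.
move=> a0 h0 lf [sG [z Az zX]] u /andP[au uah].
have u0 : (0 <= u)%R by exact: le_trans au.
case E : (X u%:E w) => [y|]; last first.
  by have := dead_mono uah u0 E; rewrite -zX.
exists y => //=; rewrite leNgt; apply/negP => ry.
have [uE|uah'] := eqVneq u (a + h)%R.
  have := sG 0%N 1%N isT; rewrite /dyadic_time expr0 divr1 mulr1 -uE => -[y' /= fy'].
  by rewrite E => -[yy]; move: ry; rewrite -yy ltNge ltW.
have {}uah : (u < a + h)%R by rewrite lt_neqAle uah' uah.
have [|v [uv va Hv]] := @right_open u (a + h)%R [set z | (rho < f z)%R] w u0 uah (open_lip_gt rho lf).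
  by exists y.
have [n [i [ni iuv]]] := dyadic_dense_time h0 au uv va.
have [y1 /= ry1 E1] := Hv _ iuv.
have [y2 /= ry2] := sG _ _ ni; rewrite -E1 => -[yy].
by move: ry1; rewrite -yy ltNge ltW.
Qed.

(** The inequality is strict, as condition (ii) requires: U is open, so right-continuity prolongs
    the stay in U beyond t. *)
Lemma exit_time_gt (U : set M) (t : R) w : (0 <= t)%R -> open U ->
  (forall u, (0 <= u <= t)%R -> at_time u U w) -> t%:E < exit_time X U w.
Proof.
move=> t0 oU HU.
have [v [tv _ Hv]] := @right_open t (t + 1)%R U w t0 ltac:(by rewrite ltrDl) oU (HU t ltac:(by rewrite t0 lexx)).
apply: (@lt_le_trans _ _ v%:E); first by rewrite lte_fin.
apply: le_ereal_inf_tmp => _ [s [s0 nU] <-]; rewrite lee_fin leNgt; apply/negP => sv.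
have [st|ts] := leP s t; first by apply: nU; apply: HU; rewrite s0.
by apply: nU; apply: Hv; rewrite ts.
Qed.


Lemma dyadic_timeS (a h : R) n i : dyadic_time a h n.+1 (2 * i)%N = dyadic_time a h n i.
Proof.
rewrite /dyadic_time; congr (_ + _ * _)%R.
by rewrite natrM exprS invfM mulrACA divff ?mul1r// pnatr_eq0.
Qed.

Lemma dyadic_time_le (a h : R) n i : (0 <= h)%R -> (i <= 2 ^ n)%N ->
  (a <= dyadic_time a h n i <= a + h)%R.
Proof.
move=> h0 ni; rewrite /dyadic_time lerDl lerD2l mulr_ge0//=.
by rewrite ler_piMr// ler_pdivrMr ?exprn_gt0// mul1r -natrX ler_nat.
Qed.

Lemma stay_steps_cylinder (b k : R) m G A w :
  cylinder X b (nseq m (k, G) ++ [:: (0%R, A)]) w <->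
  (forall i, (0 < i <= m)%N -> at_time (b + i%:R * k) G w) /\ at_time (b + m%:R * k) A w.
Proof.
elim: m b => [|m IH] b.
  rewrite /= mul0r addr0 add0r; split => [[? _]|[_ ?]]; split => // i.
  by case: i.
rewrite [nseq _ _]/= [cylinder _ _ _]/=; split.
  move=> [H1 /IH[H2 H3]]; split; last first.
    by move: H3; congr (at_time _ A w); rewrite -natr1; lra.
  move=> [//|[_|i ni]]; first by move: H1; congr (at_time _ G w); lra.
  have := H2 i.+1 ni; congr (at_time _ G w); rewrite -[in RHS]natr1; lra.
move=> [H1 H2]; split.
  by have := H1 1%N isT; congr (at_time _ G w); lra.
apply/IH; split.
  move=> i /andP[i0 im]; have im' : (0 < i.+1 <= m.+1)%N by [].
  by have := H1 _ im'; congr (at_time _ G w); rewrite -natr1; lra.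
by move: H2; congr (at_time _ A w); rewrite -natr1; lra.
Qed.

(** The last step has length 0: it tests A at the moment reached by the last step in G. *)
Definition stay_steps (h : R) G A n : seq (@step R M) :=
  nseq (2 ^ n) ((h / 2 ^+ n)%R, G) ++ [:: (0%R, A)].

Lemma stay_stepsP (a h : R) G A n w :
  cylinder X a (stay_steps h G A n) w <->
  (forall i, (0 < i <= 2 ^ n)%N -> at_time (dyadic_time a h n i) G w) /\ at_time (a + h) A w.
Proof.
have E i : dyadic_time a h n i = (a + i%:R * (h / 2 ^+ n))%R.
  by rewrite /dyadic_time mulrCA.
have Eh : (a + h)%R = (a + (2 ^ n)%N%:R * (h / 2 ^+ n))%R.
  by rewrite natrX mulrCA divff ?mulr1// expf_neq0// pnatr_eq0.
rewrite Eh; split => [/stay_steps_cylinder[H1 H2]|[H1 H2]].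
  by split => // i ni; rewrite E; exact: H1.
by apply/stay_steps_cylinder; split => // i ni; rewrite -E; exact: H1.
Qed.

Lemma stay_bigcap (a h : R) G A :
  stay a h G A = \bigcap_n cylinder X a (stay_steps h G A n).
Proof.
apply/seteqP; split => [w [H1 H2] n _|w H].
  by apply/stay_stepsP; split => // i ni; exact: H1.
split; last by have /stay_stepsP[] := H 0%N I.
by move=> n i; have /stay_stepsP[+ _] := H n I; exact.
Qed.

Lemma stay_steps_valid (h : R) G A n : (0 <= h)%R -> measurable G -> measurable A ->
  valid (stay_steps h G A n).
Proof.
move=> h0 mG mA; rewrite /stay_steps; elim: (2 ^ n)%N => [|m IH] /=; first by split.
by split => //; rewrite divr_ge0// exprn_ge0.
Qed.

Lemma stay_steps_nonincreasing (a h : R) G A :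
  nonincreasing_seq (fun n => cylinder X a (stay_steps h G A n)).
Proof.
apply/nonincreasing_seqP => n; apply/subsetPset => w /stay_stepsP[H1 H2].
apply/stay_stepsP; split => // i /andP[i0 ni]; rewrite -dyadic_timeS; apply: H1.
by rewrite muln_gt0 i0 expnS leq_pmul2l.
Qed.

Lemma measurable_stay (a h : R) G A : (0 <= a)%R -> (0 <= h)%R ->
  measurable G -> measurable A -> measurable (stay a h G A).
Proof.
move=> a0 h0 mG mA; rewrite stay_bigcap; apply: bigcapT_measurable => n.
by apply: measurable_cylinder => //; exact: stay_steps_valid.
Qed.

Lemma markov_stay_le x (a h : R) L G H A kappa :
  (0 <= a)%R -> (0 <= h)%R -> measurable G -> measurable A ->
  Fil a L -> L `<=` at_time a H -> 0 <= kappa ->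
  (forall z, H z -> 'Pr[X]_(Some z) (stay 0 h G A) <= kappa) ->
  'Pr[X]_x (L `&` stay a h G A) <= kappa * 'Pr[X]_x L.
Proof.
move=> a0 h0 mG mA FL LH k0 Hk; rewrite stay_bigcap.
apply: markov_cylinders_le LH k0 _ _ _ => //.
- by move=> n; exact: stay_steps_valid.
- by move=> b; exact: stay_steps_nonincreasing.
- by move=> z Hz; rewrite -stay_bigcap; exact: Hk.
Qed.

Lemma markov_at_time_le x (a h : R) L H A kappa :
  (0 <= a)%R -> (0 <= h)%R -> measurable A ->
  Fil a L -> L `<=` at_time a H -> 0 <= kappa ->
  (forall z, H z -> 'Pr[X]_(Some z) (at_time h A) <= kappa) ->
  'Pr[X]_x (L `&` at_time (a + h) A) <= kappa * 'Pr[X]_x L.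
Proof.
move=> a0 h0 mA FL LH k0 Hk.
have E b : at_time (b + h) A = \bigcap_(n : nat) cylinder X b [:: (h, A)].
  rewrite bigcap_const; last by exists 0%N.
  by rewrite /= setIT addrC.
rewrite E.
apply: (@markov_cylinders_le _ _ _ _ X x a L H (fun=> [:: (h, A)])) => //.
  by move=> b n m _; exact: lexx.
by move=> z Hz; rewrite -E add0r; exact: Hk.
Qed.


Section crossing.
Variables (N : set (borel M)).
Hypothesis mN : measurable N.

Definition good_path (w : Omega) :=
  (forall t : R, (0 <= t)%R -> (~` (Some @` N)) (X t%:E w)) /\
  {within [set t : R | (0 <= t)%R /\ (t%:E < lifetime X w)],
        continuous (fun t : R => X t%:E w)}.

Lemma alive (t : R) A w : at_time t A w -> t%:E < lifetime X w.
Proof.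
move=> [y _ yX]; rewrite ltNge; apply/negP => H.
by have := @hunt_dead _ _ _ _ X _ w H; rewrite -yX.
Qed.

Definition lipMD (f : M -> R) (z : MD) : R := if z is Some x then f x else 0%R.

(* By the intermediate value theorem, a good path leaving {f >= rho} for
   {f < rho'} spends a nonempty open time interval in {m < f < rho}. *)
Lemma good_path_crossing f (a h u m rho rho' : R) w :
  good_path w -> lip f -> (0 <= a)%R -> (0 < h)%R -> (rho' <= m)%R -> (m < rho)%R ->
  (a <= u <= a + h)%R -> ~ at_time u [set z | (f z < rho)%R] w ->
  at_time (a + h) [set z | (f z < rho')%R] w ->
  exists n i, (0 < i <= 2 ^ n)%N /\
    at_time (dyadic_time a h n i) ([set z | (m < f z)%R] `&` [set z | (f z < rho)%R] `&` ~` N) w.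
Proof.
move=> [wN wc] lf a0 h0 rm mr /andP[au uah] nu ahw.
have life := alive ahw.
have u0 : (0 <= u)%R by exact: le_trans au.
have fc := lip_continuous lf.
pose phi t := lipMD f (X t%:E w).
have Xlive (t : R) : (u <= t <= a + h)%R -> exists y, X t%:E w = Some y.
  move=> /andP[ut tah]; case E : (X t%:E w) => [y|]; first by exists y.
  have := dead_mono tah (le_trans u0 ut) E.
  by case: ahw => y _ <-.
have phic : {within `[u, (a + h)%R], continuous phi}.
  have H := @continuous_subspaceW _ _ `[u, (a + h)%R] _ _ _ wc.
  have /subspace_continuousP {}H := H ltac:(by move=> t /=; rewrite in_itv/= => /andP[ut tah]; split; [exact: le_trans ut|apply: le_lt_trans life; rewrite lee_fin]).
  apply/subspace_continuousP => t tI.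
  have [y Xt] := Xlive t ltac:(by move: tI; rewrite /= in_itv).
  have H' : X s%:E w @[s --> within `[u, (a + h)%R] (nbhs t)] --> (Some y : MD).
    by rewrite -Xt; exact: H.
  have gc : lipMD f z @[z --> (Some y : MD)] --> f y by exact: fc.
  have := cvg_comp _ _ H' gc; rewrite -[f y]/(lipMD f (Some y)) -Xt; exact.
have phiu : (rho <= phi u)%R.
  have [y Xu] := Xlive u ltac:(by rewrite lexx).
  rewrite /phi Xu /= leNgt; apply/negP => fy; apply: nu.
  by exists y.
have phib : (phi (a + h) < rho')%R by case: ahw => y fy; rewrite /phi => <-.
(* The midpoint level lies strictly inside the annulus, so the path remains in the open annulus
   right after c. There is room to the right of c, since at the final time f is already below [rho']
   <= m. *)
have [c cI fcE] : exists2 c, c \in `[u, (a + h)%R] & phi c = ((m + rho) / 2)%R.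
  apply: IVT => //.
  rewrite ge_min le_max.
  by apply/andP; split; apply/orP; [right|left]; lra.
move: cI; rewrite in_itv/= => /andP[uc cah].
have {}cah : (c < a + h)%R.
  rewrite lt_neqAle cah andbT; apply/eqP => E; move: phib; rewrite -E fcE; lra.
have [|v [cv va Hv]] := @right_open c (a + h)%R
    ([set z | (m < f z)%R] `&` [set z | (f z < rho)%R]) w (le_trans u0 uc) cah
    (openI (open_lip_gt m lf) (open_lip_lt rho lf)).
  have [y Xc] := Xlive c ltac:(by rewrite uc ltW).
  exists y => //; move: fcE; rewrite /phi Xc /= => ->; split; rewrite /=; lra.
have [n [i [ni iuv]]] := dyadic_dense_time h0 (le_trans au uc) cv va.
exists n, i; split => //.
have [y fy yX] := Hv _ iuv.
exists y => //; split => // Ny.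
have := wN (dyadic_time a h n i); rewrite -yX; case; last by exists y.
by apply: le_trans a0 _; have /andP[] := dyadic_time_le a (ltW h0) (proj2 (andP ni)).
Qed.

(** Decomposition by the first grid index at which the path is in [Ann]. The event at index j splits
    L: on it the Markov property applies at once, off it the next index takes over, and the two
    masses add up to that of L. The factor [kappa] therefore does not depend on the number of grid
    points. *)
Lemma first_hit_le (x : MD) (a k : R) (m : nat) L (Ann B : set (borel M)) kappa (j : nat) :
  (0 <= a)%R -> (0 <= k)%R -> measurable Ann -> measurable B ->
  Fil (a + j%:R * k)%R L -> 0 <= kappa ->
  (forall i z, (i <= m)%N -> Ann z -> 'Pr[X]_(Some z : MD) (at_time (i%:R * k)%R B) <= kappa) ->
  'Pr[X]_x (L `&` (\bigcup_(i in `I_m) at_time (a + (j + i)%:R * k)%R Ann)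
      `&` at_time (a + (j + m)%:R * k)%R B) <= kappa * 'Pr[X]_x L.
Proof.
move=> a0 k0 mAnn mB; elim: m j L => [|m IH] j L FL kp0 HA.
  have -> : `I_0 = set0 by apply/seteqP; split.
  by rewrite bigcup_set0 setI0 set0I measure0 mule_ge0.
have t0 i : (0 <= a + i%:R * k)%R by rewrite addr_ge0// mulr_ge0.
have mL : measurable L by exact: measurable_natural_filtration FL.
pose A0 := at_time (a + j%:R * k)%R Ann.
have FA0 : Fil (a + j%:R * k)%R A0.
  by apply: natural_filtration_at_time => //; rewrite t0 lexx.
have mA0 : measurable A0 by exact: measurable_natural_filtration FA0.
have FL1 : Fil (a + j%:R * k)%R (L `&` A0) by exact: natural_filtrationI.
have FL2 : Fil (a + j.+1%:R * k)%R (L `&` ~` A0).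
  apply: (@natural_filtration_le _ _ _ _ X (a + j%:R * k)%R).
    by rewrite lerD2l ler_wpM2r// ler_nat.
  by apply: natural_filtrationI => //; exact: natural_filtrationC.
have H1 := @markov_at_time_le x _ (m.+1%:R * k)%R _ Ann B kappa (t0 j)
  ltac:(by rewrite mulr_ge0) mB FL1 (@subIsetr _ _ _) kp0 (fun z Hz => HA m.+1 z (leqnn _) Hz).
have H2 := IH j.+1 _ FL2 kp0 (fun i z im Hz => HA i z (leqW im) Hz).
have mU jj mm : measurable (\bigcup_(i in `I_mm) at_time (a + (jj + i)%:R * k)%R Ann).
  by apply: bigcup_measurable => i _; exact: measurable_at_time.
set E1 := _ `&` at_time _ B in H1; set E2 := _ `&` at_time _ B in H2.
have mE1 : measurable E1.
  by apply: measurableI; [exact: measurableI|apply: measurable_at_time => //; rewrite addr_ge0// mulr_ge0].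
have mE2 : measurable E2.
  by apply: measurableI; [apply: measurableI => //; apply: measurableI => //; exact: measurableC|exact: measurable_at_time].
apply: (@le_trans _ _ ('Pr[X]_x (E1 `|` E2))).
  apply: le_measure; rewrite ?inE.
  - by apply: measurableI; [exact: measurableI|exact: measurable_at_time].
  - exact: measurableU.
  - move=> w [[Lw [i /= im iw]] Bw].
    have [A0w|nA0w] := pselect (A0 w).
      left; split; first by [].
      by move: Bw; congr (at_time _ B w); rewrite natrD mulrDl addrA.
    right; split; last by move: Bw; rewrite addSnnS.
    split; first by [].
    case: i im iw => [|i] im iw; first by exfalso; apply: nA0w; move: iw; rewrite addn0.
    by exists i => //=; rewrite addSnnS.
apply: (@le_trans _ _ ('Pr[X]_x E1 + 'Pr[X]_x E2)).
  exact: measureU2.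
apply: (le_trans (leeD H1 H2)).
rewrite -ge0_muleDr//; apply: lee_wpmul2l => //.
rewrite addeC le_eqVlt; apply/orP; left; apply/eqP/esym.
exact: (measureDI ('Pr[X]_x) mL mA0).
Qed.

(** For each dyadic level, [first_hit_le] bounds the event of being in the annulus at a grid time
    and below [rho'] at the end. These events increase with the level, and up to the null set of bad
    paths their union contains E. *)
Lemma crossing_le (x : MD) f (a h m rho rho' : R) (E : set Omega) kappa :
  {ae 'Pr[X]_x, forall w, good_path w} -> lip f ->
  (0 <= a)%R -> (0 < h)%R -> (rho' <= m)%R -> (m < rho)%R ->
  0 <= kappa -> measurable E ->
  (forall w, E w -> exists u, [/\ (a <= u <= a + h)%R,
     ~ at_time u [set z | (f z < rho)%R] w & at_time (a + h) [set z | (f z < rho')%R] w]) ->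
  (forall z t, ~ N z -> (m < f z < rho)%R -> (0 <= t <= h)%R ->
     'Pr[X]_(Some z : MD) (at_time t [set y | (f y < rho')%R]) <= kappa) ->
  'Pr[X]_x E <= kappa.
Proof.
move=> [B [mB PB0 goodB]] lf a0 h0 rm mr k0 mE HE Hk.
pose Ann : set (borel M) := [set z | (m < f z)%R] `&` [set z | (f z < rho)%R] `&` ~` N.
have mAnn : measurable Ann.
  apply: measurableI; last exact: measurableC.
  by apply: measurableI; apply: open_measurable_borel; [exact: open_lip_gt|exact: open_lip_lt].
have mf' : measurable ([set z | (f z < rho')%R] : set (borel M)) by exact: measurable_lip_lt.
have dt0 n i : (i <= 2 ^ n)%N -> (0 <= dyadic_time a h n i)%R.
  by move=> ni; apply: (le_trans a0); have /andP[] := dyadic_time_le a (ltW h0) ni.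
pose C n := (\bigcup_(i in `I_(2 ^ n)) at_time (dyadic_time a h n i) Ann)
   `&` at_time (a + h) [set z | (f z < rho')%R].
have mC n : measurable (C n).
  apply: measurableI; last by apply: measurable_at_time => //; rewrite addr_ge0// ltW.
  by apply: bigcup_measurable => i /= /ltnW ni; apply: measurable_at_time => //; exact: dt0.
have PC n : 'Pr[X]_x (C n) <= kappa.
  have Hm : (a + (2 ^ n)%:R * (h / 2 ^+ n) = a + h)%R.
    by rewrite natrX mulrCA divff ?mulr1// expf_neq0// pnatr_eq0.
  have FT : Fil (a + 0%:R * (h / 2 ^+ n))%R setT.
    rewrite -setC0; apply: natural_filtrationC; exact: sigma_algebra0.
  have k1 : (0 <= h / 2 ^+ n)%R by rewrite divr_ge0// ?exprn_ge0// ltW.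
  have := @first_hit_le x a (h / 2 ^+ n)%R (2 ^ n) setT Ann [set z | (f z < rho')%R] kappa 0
    a0 k1 mAnn mf' FT k0.
  rewrite probability_setT mule1 setTI add0n Hm.
  rewrite (_ : \bigcup_(i in _) _ =
      \bigcup_(i in `I_(2 ^ n)) at_time (dyadic_time a h n i) Ann); last first.
    apply: eq_bigcupr => i _; congr (at_time _ Ann).
    by rewrite add0n /dyadic_time mulrCA.
  apply => i z im [[z1 z2] z3]; apply: Hk => //; first by rewrite z1.
  rewrite mulr_ge0//= mulrCA; apply: ler_piMr; first exact: ltW.
  by rewrite ler_pdivrMr ?exprn_gt0// mul1r -natrX ler_nat.
have ndC : nondecreasing_seq C.
  apply/nondecreasing_seqP => n; apply/subsetPset => w [[i /= im iw] Bw]; split => //.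
  exists (2 * i)%N; first by rewrite /= expnS ltn_pmul2l.
  by rewrite dyadic_timeS.
have mUC : measurable (\bigcup_n C n) by exact: bigcup_measurable.
have cC := @nondecreasing_cvg_mu _ _ _ ('Pr[X]_x) C mC mUC ndC.
have PUC : 'Pr[X]_x (\bigcup_n C n) <= kappa.
  rewrite -(cvg_lim (@ereal_hausdorff R) cC); apply: lime_le; last by apply: nearW.
  by apply/cvg_ex; eexists; exact: cC.
apply: (@le_trans _ _ ('Pr[X]_x (B `|` \bigcup_n C n))).
  apply: le_measure; rewrite ?inE//; first exact: measurableU.
  move=> w Ew; have [Bw|nBw] := pselect (B w); [by left|right].
  have gw : good_path w by apply: contrapT => ngw; apply: nBw; apply: goodB.
  have [u [uah nu ahw]] := HE w Ew.
  have [n [i [/andP[i0 ni] iw]]] := good_path_crossing gw lf a0 h0 rm mr uah nu ahw.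
  exists n => //; split => //; exists i => //=.
  (* The last index does not belong to [I_(2 ^ n)]; it cannot occur, because at the final time f is
     below [rho'] <= m, outside the annulus. *)
  rewrite ltn_neqAle ni andbT; apply/eqP => iE; move: iw.
  rewrite iE /dyadic_time natrX divff ?mulr1 ?expf_neq0 ?pnatr_eq0//.
  case: ahw => y fy yX [y' [[my' _] _]]; rewrite -yX => -[yy].
  by move: my' fy; rewrite yy /=; lra.
apply: (le_trans (measureU2 _ _ _)) => //.
by rewrite [X in X + _](_ : _ = 0) ?add0e.
Qed.

End crossing.

End paths.

(** * The iteration over shrinking final time intervals *)

Section iteration.
Context {R : realType} {M : pmetricType R} {d : measure_display}
  {Omega : measurableType d}.
Variable X : hunt_process M Omega.
Local Open Scope ereal_scope.
Local Notation Fil t := (natural_filtration X t%:E).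
Local Notation at_time := (at_time X).
Local Notation MD := (one_point_compactification M).
Variable N : set (borel M).
Hypothesis mN : measurable N.
Hypothesis goodN : forall x : M, ~ N x -> {ae 'Pr[X]_(Some x), forall w, good_path X N w}.

Lemma at_time_exceptional (x : M) (s : R) : ~ N x -> (0 <= s)%R ->
  'Pr[X]_(Some x : MD) (at_time s N) = 0.
Proof.
move=> Nx s0; have [B [mB PB HB]] := goodN Nx.
apply: (subset_measure0 _ _ _ PB) => //; first exact: measurable_at_time.
by move=> w ws; apply: HB => -[/(_ s s0)].
Qed.

(* With S_k the event that X_t is in A and f(X) < rho k from t - t_ k to t, the
   k-th summand bounds the event that S_k fails and S_(k+1) holds, and ck n bounds
   the event that S_n fails. *)
Lemma iteration_le (x : M) f (A : set (borel M)) (t_ rho m1 m2 : nat -> R) (ck kk : nat -> \bar R) :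
  ~ N x -> lip f -> measurable A ->
  (forall k, (0 < t_ k)%R) -> (forall k, (t_ k.+1 < t_ k)%R) ->
  (forall k y, A y -> (f y < m1 k)%R) ->
  (forall k, (rho k.+1 < m1 k)%R) -> (forall k, (m1 k <= m2 k)%R) -> (forall k, (m2 k < rho k)%R) ->
  (forall k, 0 <= ck k) -> (forall k, 0 <= kk k) ->
  (forall k z s, ~ N z -> (m2 k < f z < rho k)%R -> (0 <= s <= t_ k)%R ->
     'Pr[X]_(Some z : MD) (at_time s [set y | (f y < m1 k)%R]) <= ck k) ->
  (forall k z, ~ N z -> (f z < m1 k)%R ->
     'Pr[X]_(Some z : MD) (stay X 0 (t_ k.+1) [set y | (f y < rho k.+1)%R] A) <= kk k) ->
  forall n, 'Pr[X]_(Some x : MD) (at_time (t_ 0%N) A) <=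
    'Pr[X]_(Some x : MD) (stay X 0 (t_ 0%N) [set y | (f y < rho 0%N)%R] A)
    + \sum_(k < n) (kk k * ck k) + ck n.
Proof.
move=> Nx lf mA t0 tS Am rm m12 mr c0 k0 Hc Hk.
(* [T k] is the start of the k-th time interval, of length [t_ k]; all of them end at t. *)
pose t := t_ 0%N; pose T k := (t - t_ k)%R.
have T0 : T 0%N = 0%R by rewrite /T subrr.
have TS k : (T k < T k.+1)%R by rewrite ltrD2l ltrN2.
have Tge0 k : (0 <= T k)%R by elim: k => [|k IH]; rewrite ?T0// (le_trans IH)// ltW.
have Tt k : (T k + t_ k)%R = t by rewrite /T subrK.
have t00 : (0 <= t)%R by exact: ltW (t0 0%N).
pose G k : set (borel M) := [set y | (f y < rho k)%R].
have mG k : measurable (G k) by exact: measurable_lip_lt.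
pose S k := stay X (T k) (t_ k) (G k) A.
have mS k : measurable (S k) by apply: measurable_stay => //; exact: ltW.
have mAt : measurable (at_time t A) by exact: measurable_at_time.
pose P := 'Pr[X]_(Some x : MD).
have gP : {ae P, forall w, good_path X N w} by exact: goodN.
have last_le n : P (at_time t A `\` S n) <= ck n.
  apply: (@crossing_le _ _ _ _ X N mN (Some x) f (T n) (t_ n) (m2 n) (rho n) (m1 n)) => //.
  - exact: measurableD.
  - move=> w [[y Ay yX] nS]; apply: contrapT => H; apply: nS; split; last by rewrite Tt; exists y.
    move=> m i ni; apply: contrapT => nG; apply: H.
    exists (dyadic_time (T n) (t_ n) m i); split => //.
      by apply: dyadic_time_le; [exact: ltW|case/andP: ni].
    by exists y; [exact: Am|rewrite Tt].
  - by move=> z s Nz zf st; exact: Hc.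
(* The induction carries the remainder itself, the probability that S_n fails; its bound [ck n] is
   inserted only at the end. *)
suff H n : P (at_time t A) <= P (stay X 0 t (G 0%N) A) + \sum_(k < n) (kk k * ck k)
    + P (at_time t A `\` S n).
  by move=> n; apply: (le_trans (H n)); exact: leeD2l.
elim: n => [|n IH].
  rewrite big_ord0 adde0.
  have -> : stay X 0 t (G 0%N) A = S 0%N by rewrite /S T0.
  apply: (@le_trans _ _ (P (S 0%N `|` at_time t A `\` S 0%N))); last first.
    by apply: measureU2 => //; exact: measurableD.
  apply: le_measure; rewrite ?inE//; first by apply: measurableU => //; exact: measurableD.
  by move=> w Aw; have [|] := pselect (S 0%N w); [left|right].
apply: (le_trans IH); rewrite big_ord_recr/= -!addeA; apply: leeD2l; apply: leeD2l.
pose h := (T n.+1 - T n)%R.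
have h0 : (0 < h)%R by rewrite subr_gt0.
have Th : (T n + h)%R = T n.+1 by rewrite /h addrC subrK.
(* Only the dyadic times up to [T n.+1] are kept, so that [D] belongs to the past of that time and
   the Markov property can be applied there. *)
pose D0 m i := if (i <= 2 ^ m)%N && (dyadic_time (T n) (t_ n) m i <= T n.+1)%R
  then ~` at_time (dyadic_time (T n) (t_ n) m i) (G n) else set0.
pose D := (\bigcup_m \bigcup_i D0 m i) `&` at_time (T n.+1) ([set y | (f y < m1 n)%R] `&` ~` N).
have mH : measurable ([set y | (f y < m1 n)%R] `&` ~` N : set (borel M)).
  by apply: measurableI; [exact: measurable_lip_lt|exact: measurableC].
have FD : Fil (T n.+1) D.
  apply: natural_filtrationI; last by apply: natural_filtration_at_time => //; rewrite Tge0 lexx.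
  apply: natural_filtration_bigcup => m; apply: natural_filtration_bigcup => i.
  rewrite /D0; case: ifPn => [/andP[mi dT]|_]; last exact: sigma_algebra0.
  apply: natural_filtrationC; apply: natural_filtration_at_time => //.
  rewrite dT andbT; apply: (le_trans (Tge0 n)).
  by have /andP[] := @dyadic_time_le _ (T n) (t_ n) _ _ (ltW (t0 _)) mi.
have mD : measurable D by apply: measurable_natural_filtration FD.
have PD : P D <= ck n.
  apply: (@crossing_le _ _ _ _ X N mN (Some x) f (T n) h (m2 n) (rho n) (m1 n)) => //.
  - move=> w [[m _ [i _]]]; rewrite /D0; case: ifPn => // /andP[mi dT] nG [y [fy _] yX].
    exists (dyadic_time (T n) (t_ n) m i); split => //.
      have /andP[-> _] := @dyadic_time_le _ (T n) (t_ n) _ _ (ltW (t0 _)) mi.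
      by rewrite Th.
    by rewrite Th; exists y.
  - move=> z s Nz zf /andP[s0 sh]; apply: Hc => //; rewrite s0/= (le_trans sh)//.
    rewrite /h /T; have := t0 n.+1; lra.
have PDS : P (D `&` S n.+1) <= kk n * ck n.
  apply: (@le_trans _ _ (kk n * P D)); last exact: lee_wpmul2l.
  apply: (@markov_stay_le _ _ _ _ X (Some x) (T n.+1) (t_ n.+1) D (G n.+1)
    ([set y | (f y < m1 n)%R] `&` ~` N)) => //.
  - exact: ltW.
  - by move=> w [].
  - by move=> z [fz Nz]; exact: Hk.
have PN : P (at_time (T n.+1) N) = 0 by exact: at_time_exceptional.
have mTN : measurable (at_time (T n.+1) N) by exact: measurable_at_time.
have mDS : measurable (D `&` S n.+1) by exact: measurableI.
have mAS : measurable (at_time t A `\` S n.+1) by exact: measurableD.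
(* On S_(n+1) the path satisfies f <= rho (n+1) < rho n from [T n.+1] on, by [stay_closed]; so if
   S_n fails it fails before that time, which is the event [D], apart from the null event that the
   path is in N at [T n.+1]. *)
apply: (@le_trans _ _ (P ((D `&` S n.+1) `|` (at_time t A `\` S n.+1) `|` at_time (T n.+1) N))).
  apply: le_measure; rewrite ?inE.
  - exact: measurableD.
  - by apply: measurableU => //; exact: measurableU.
  move=> w [Aw nSw].
  have [Nw|nNw] := pselect (at_time (T n.+1) N w); [by right|left].
  have [Sw|] := pselect (S n.+1 w); [left|by right].
  split => //.
  have cl := @stay_closed _ _ _ _ X (T n.+1) (t_ n.+1) (rho n.+1) f A w (Tge0 _) (t0 _) lf Sw.
  have [m [i [mi nG]]] : exists m i, (0 < i <= 2 ^ m)%N /\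
      ~ at_time (dyadic_time (T n) (t_ n) m i) (G n) w.
    apply: contrapT => H; apply: nSw; split; last by rewrite Tt.
    by move=> m i mi; apply: contrapT => nG; apply: H; exists m, i.
  have rr : (rho n.+1 < rho n)%R.
    by apply: (lt_trans (rm n)); apply: (le_lt_trans (m12 n)).
  split.
    exists m => //; exists i => //; rewrite /D0.
    case/andP: mi => i0 mi; rewrite mi/=.
    case: ifPn => // /negP dT; exfalso; apply: nG.
    have [|y /= fy yX] := cl (dyadic_time (T n) (t_ n) m i).
      have /andP[_ d2] := @dyadic_time_le _ (T n) (t_ n) _ _ (ltW (t0 _)) mi.
      rewrite Tt; rewrite Tt in d2; rewrite d2 andbT.
      by apply: ltW; rewrite ltNge; exact/negP.
    by exists y => //; exact: le_lt_trans rr.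
  have [|y /= fy yX] := cl (T n.+1); first by rewrite lexx lerDl ltW.
  exists y => //; split; first exact: le_lt_trans (rm n).
  by move=> Ny; apply: nNw; exists y.
apply: (le_trans (measureU2 _ _ _)) => //; first exact: measurableU.
rewrite [X in _ + X](_ : _ = 0)// adde0.
by apply: (le_trans (measureU2 _ _ _)) => //; exact: leeD2r.
Qed.

End iteration.

(** * Bounds on the transition probabilities *)

Section distance.
Context {R : realType} {M : pmetricType R}.
Implicit Types (A : set M).

Definition dist_to A (z : M) : R := inf [set mdist z y | y in A].

Let has_lb A z : has_lbound [set mdist z y | y in A].
Proof. by exists 0 => _ [y _ <-]; exact: mdist_ge0. Qed.

Lemma dist_to_le A z y : A y -> dist_to A z <= mdist z y.
Proof. by move=> Ay; apply: ge_inf => //; exists y. Qed.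

Lemma dist_to_lt A z r : A !=set0 -> dist_to A z < r -> exists2 y, A y & mdist z y < r.
Proof.
move=> [y0 Ay0] /(@inf_lt _ _ _) [|_ [y Ay <-] yr]; last by exists y.
by exists (mdist z y0); exists y0.
Qed.

Lemma le_dist_to A z r : A !=set0 -> (forall y, A y -> r <= mdist z y) -> r <= dist_to A z.
Proof.
move=> [y0 Ay0] H; apply: lb_le_inf; first by exists (mdist z y0); exists y0.
by move=> _ [y Ay <-]; exact: H.
Qed.

Lemma dist_to_lip A : A !=set0 -> lip (dist_to A).
Proof.
move=> A0 x y; rewrite lerBlDr -lerBlDl; apply: le_dist_to => // a Aa.
rewrite lerBlDl; apply: (le_trans (dist_to_le x Aa)).
exact: metric_triangle.
Qed.

Lemma inner_part_sub (U : set M) (e : R) y z : inner_part U e y -> mdist y z <= e -> U z.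
Proof.
move=> Vy yz; apply: contrapT => nUz.
have : (ereal_inf [set (mdist y z)%:E | z in ~` U] <= (mdist y z)%:E)%E.
  by apply: ereal_inf_lbound; exists z.
by move=> /(lt_le_trans Vy); rewrite lte_fin ltNge yz.
Qed.

Lemma inner_part_subset (U : set M) (e : R) : 0 <= e -> inner_part U e `<=` U.
Proof. by move=> e0 y Vy; apply: (inner_part_sub Vy); rewrite mdistxx. Qed.

Lemma open_inner_part (U : set M) (e : R) : open (inner_part U e).
Proof.
rewrite openE => y Vy; rewrite /interior.
(* A real number is inserted because the infimum is infinite when U is the whole space. *)
have [s [es sV]] : exists s : R, e < s /\ (s%:E <= ereal_inf [set (mdist y z)%:E | z in ~` U])%E.
  move: Vy; rewrite /inner_part /=; case: ereal_inf => [r||] //=.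
  - by rewrite lte_fin => er; exists r.
  - by move=> _; exists (e + 1); split; [rewrite ltrDl|rewrite leey].
apply/nbhs_ballP; exists ((s - e) / 2) => /=; first by rewrite divr_gt0// subr_gt0.
move=> x; rewrite ballEmdist /= => yx.
rewrite /inner_part /=; apply: (@lt_le_trans _ _ ((e + s) / 2)%:E).
  by rewrite lte_fin; lra.
apply: le_ereal_inf_tmp => _ [z nUz <-]; rewrite lee_fin.
have : (s%:E <= (mdist y z)%:E)%E.
  by apply: (le_trans sV); apply: ereal_inf_lbound; exists z.
rewrite lee_fin => sz; have := metric_triangle y x z; lra.
Qed.

End distance.

(** * The core estimate and the three regimes of the bound *)

Section core.
Context {R : realType} {beta cF alphaF c gamma eps : R}.
Hypotheses (beta1 : 1 < beta) (cF0 : 0 < cF) (alphaF0 : 0 < alphaF) (c0 : 0 < c)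
  (gamma0 : 0 < gamma) (eps01 : 0 < eps < 1).
Context {M : pmetricType R} {mu : {measure set (borel M) -> \bar R}}
    {d : measure_display} {Omega : measurableType d}.
Variables
    (X : hunt_process M Omega) (N : set (borel M))
    (rad : R) (U : set M) (F : R -> M -> M -> R).
Hypotheses (mN : measurable N)
  (goodN : forall x : M, ~ N x -> {ae 'Pr[X]_(Some x), forall w, good_path X N w})
  (rad0 : 0 < rad) (oU : open U)
  (mF : measurable_fun
    (([set t : R | 0 < t <= rad `^ beta] `*` U `*` U)
      : set (R * borel M * borel M))
    (fun z => F z.1.1 z.1.2 z.2))
  (F0 : forall t x y, 0 < t <= rad `^ beta -> U x -> U y -> 0 < F t x y)
  (Hker : forall t x (A : set (borel M)), 0 < t < rad `^ beta -> U x -> ~ N x ->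
    measurable A -> A `<=` U ->
    ('Prc[X]_(Some x) ((X t%:E @^-1` (Some @` A)) `&`
                       [set w | t%:E < exit_time X U w])
     <= \int[mu]_(y in A) (F t x y)%:E)%E)
  (Hexit : forall x r t, U x -> ~ N x -> 0 < r < rad -> ball x r `<=` U -> 0 < t ->
    ('Prc[X]_(Some x) [set w | exit_time X (ball x r) w <= t%:E]
     <= (c * expR (- gamma * (r `^ beta / t) `^ (beta - 1)^-1))%:E)%E).
Local Notation V := (inner_part U (eps * rad)).
Local Notation at_time := (at_time X).
Local Notation MD := (one_point_compactification M).

(** Conditions (ii) and (iii) bound outer measures, their events being measurable only after
    completion; this transfers such a bound to a measurable event contained in them. *)
Lemma probability_le_mu_ext (x : MD) (E E' : set Omega) :
  measurable E -> E `<=` E' -> ('Pr[X]_x E <= 'Prc[X]_x E')%E.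
Proof.
move=> mE EE'; rewrite -(measurable_mu_extE ('Pr[X]_x) mE).
exact: le_mu_ext.
Qed.

Lemma exit_le z (w s t : R) (D : set (borel M)) : U z -> ~ N z -> 0 < w < rad -> ball z w `<=` U ->
  0 <= s <= t -> 0 < t -> measurable D -> (forall y, D y -> w <= mdist z y) ->
  ('Pr[X]_(Some z : MD) (at_time s D) <=
    (c * expR (- gamma * (w `^ beta / t) `^ (beta - 1)^-1))%:E)%E.
Proof.
move=> Uz Nz w0 zU /andP[s0 st] t0 mD Dw; apply: (le_trans _ (Hexit Uz Nz w0 zU t0)).
apply: probability_le_mu_ext; first exact: measurable_at_time.
move=> om [y Dy yX] /=; apply: (@le_trans _ _ s%:E); last by rewrite lee_fin.
apply: ereal_inf_lbound; exists s => //; split => // -[y' + y'X].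
rewrite ballEmdist /=; move: yX; rewrite -y'X => -[<-].
by rewrite ltNge Dw.
Qed.

Lemma measurable_F_section t x : 0 < t <= rad `^ beta -> U x ->
  measurable_fun (U : set (borel M)) (F t x : borel M -> R).
Proof.
move=> t0 Ux.
have mU : measurable (U : set (borel M)) by exact: open_measurable_borel.
have mD : measurable (([set t : R | 0 < t <= rad `^ beta] `*` U `*` U)
      : set (R * borel M * borel M)).
  apply: measurableX => //; apply: measurableX => //.
  rewrite (_ : [set t | _] = `]0, rad `^ beta]%classic)//.
apply: (@measurable_comp _ _ _ _ _ _ _ (fun z : R * borel M * borel M => F z.1.1 z.1.2 z.2) _
  (fun y => (t, x, y)) mD _ mF).
  by move=> _ [y Uy <-].
by apply: measurable_funTS; exact: pair1_measurable.
Qed.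

(** On [stay] the path remains in the closed sublevel set {f <= rho}, contained in U, up to and
    including time t. Hence t < tau_U and condition (ii) applies. *)
Lemma kernel_le z (t rho : R) f (A : set (borel M)) : U z -> ~ N z -> 0 < t < rad `^ beta ->
  lip f -> [set y | f y <= rho] `<=` U -> measurable A -> A `<=` U ->
  ('Pr[X]_(Some z : MD) (stay X 0 t [set y | (f y < rho)%R] A) <=
   \int[mu]_(y in A) (F t z y)%:E)%E.
Proof.
move=> Uz Nz /andP[t0 tR] lf fU mA AU.
apply: (le_trans _ (Hker (t := t) _ Uz Nz mA AU)); last by rewrite t0.
apply: probability_le_mu_ext.
  by apply: measurable_stay => //; [exact: ltW|exact: measurable_lip_lt].
move=> w Sw; split; first by case: Sw => _; rewrite add0r.
apply: exit_time_gt => //; first exact: ltW.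
move=> u ut; have [|y /= fy yX] := @stay_closed _ _ _ _ X 0 t rho f A w (lexx _) t0 lf Sw u.
  by rewrite add0r.
by exists y => //; exact: fU.
Qed.


(** q is the ratio of consecutive time scales and B the price of one such shortening in condition
    (i). E1 is the smallest crossing exponent, the one for t = r^beta; bounding the sum with E1
    makes S independent of t and r. *)
Local Notation q := (2 `^ (1 - 2 * beta) : R).
Local Notation B := ((q^-1) `^ alphaF).
Local Notation E1 := (gamma * (9 / 40 * eps) `^ (beta / (beta - 1))).
Variable S : R.
Hypotheses (S0 : 0 < S)
  (hS : forall n, \sum_(k < n) B ^+ k.+1 * expR (- (E1 * (2 ^+ k - 1))) <= S).

Let q0 : 0 < q. Proof. exact: powR_gt0. Qed.
Let q1 : q < 1.
Proof.
rewrite /powR pnatr_eq0/= expR_lt1 pmulr_llt0 ?ln_gt0 ?ltr1n//.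
by move: beta1; lra.
Qed.

(* The time scale q is chosen so that halving distances doubles the exponent. *)
Lemma crossing_exponent (t r : R) k : 0 < t -> 0 < r ->
  ((9 / 40 * (eps * r) / 2 ^+ k) `^ beta / (t * q ^+ k)) `^ (beta - 1)^-1 =
  ((9 / 40 * (eps * r)) `^ beta / t) `^ (beta - 1)^-1 * 2 ^+ k.
Proof.
move=> t0 r0; have /andP[e0 _] := eps01.
have b1 : beta - 1 != 0 by rewrite subr_eq0 gt_eqF.
have a0 : 0 <= 9 / 40 * (eps * r) by rewrite !mulr_ge0// ltW.
have p0 : (0 : R) < 2 ^+ k by rewrite exprn_gt0.
rewrite (@powRM _ (9 / 40 * (eps * r)) (2 ^+ k)^-1 beta)// ?invr_ge0 ?ltW//.
have -> : (9 / 40 * (eps * r)) `^ beta * (2 ^+ k)^-1 `^ beta / (t * q ^+ k) =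
    (9 / 40 * (eps * r)) `^ beta / t * ((2 ^+ k)^-1 `^ beta / q ^+ k).
  by field; rewrite !gt_eqF// exprn_gt0.
rewrite powRM ?divr_ge0 ?powR_ge0 ?exprn_ge0 ?ltW//; congr (_ * _).
rewrite -powR_inv1 ?ltW// -!powR_mulrn ?ltW// -!powRrM -powRB; last first.
  by rewrite pnatr_eq0 implybT.
rewrite -powRrM; congr (_ `^ _); field.
by rewrite b1.
Qed.

Lemma exponent_ge (t r : R) : 0 < t -> 0 < r -> t <= r `^ beta ->
  E1 <= gamma * ((9 / 40 * (eps * r)) `^ beta / t) `^ (beta - 1)^-1.
Proof.
move=> t0 r0 tr; have /andP[e0 _] := eps01.
rewrite ler_pM2l// powRrM; apply: ge0_ler_powR.
- by rewrite invr_ge0 subr_ge0 ltW.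
- by rewrite nnegrE powR_ge0.
- by rewrite nnegrE divr_ge0 ?powR_ge0// ltW.
rewrite mulrA (@powRM _ (9 / 40 * eps) r) ?mulr_ge0 ?(ltW e0) ?(ltW r0)//.
by rewrite ler_pdivlMr// ler_wpM2l ?powR_ge0.
Qed.

(* With rho_k = eps r 2^(-k-1), the levels 39/40 rho_k and 21/40 rho_k > rho_(k+1)
   leave a gap of 9/40 eps r 2^-k, whence the constant 9/40. *)
Lemma core_le (x : M) (A : set (borel M)) (t r H J : R) :
  ~ N x -> measurable A -> A `<=` V -> A !=set0 -> 0 < t < rad `^ beta ->
  0 < r <= rad -> t <= r `^ beta -> 0 <= H -> 0 <= J ->
  (forall k z, U z -> dist_to A z < eps * r / 2 ->
    (\int[mu]_(y in A) (F (t * q ^+ k.+1) z y)%:E <= (H * B ^+ k.+1 * J)%:E)%E) ->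
  ('Pr[X]_(Some x : MD) (at_time t A) <=
   'Pr[X]_(Some x : MD) (stay X 0 t [set y | (dist_to A y < eps * r / 2)%R] A) +
   (c * S * H * J * expR (- (gamma * ((9 / 40 * (eps * r)) `^ beta / t) `^ (beta - 1)^-1)))%:E)%E.
Proof.
move=> Nx mA AV A0 /andP[t0 tR] /andP[r0 rR] tr H0 J0 HF.
have /andP[e0 e1] := eps01.
set E := gamma * _.
have er0 : 0 < eps * r by rewrite mulr_gt0.
have err : eps * r <= eps * rad by rewrite ler_pM2l.
have EE1 : E1 <= E by exact: exponent_ge.
have E10 : 0 < E1 by rewrite mulr_gt0// powR_gt0// mulr_gt0.
have E0 : 0 < E by exact: lt_le_trans EE1.
have B0 : 0 < B by rewrite powR_gt0// invr_gt0.
have p0 k : (0 : R) < 2 ^+ k by rewrite exprn_gt0.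
pose f := dist_to A.
have lf : lip f by exact: dist_to_lip.
pose t_ k := t * q ^+ k.
have t_0 k : 0 < t_ k by rewrite mulr_gt0// exprn_gt0.
have t_S k : t_ k.+1 < t_ k.
  by rewrite [t_ k.+1]/t_ exprSr mulrA -/(t_ k) gtr_pMr.
have t_R k : t_ k < rad `^ beta.
  by elim: k => [|k IH]; [rewrite /t_ expr0 mulr1|exact: lt_trans IH].
pose rho k := eps * r / 2 / 2 ^+ k.
have rho0 k : 0 < rho k by rewrite !divr_gt0.
have rhoS k : rho k.+1 = rho k / 2.
  by rewrite /rho exprS; field; rewrite gt_eqF.
have rhole k : rho k <= eps * r / 2.
  elim: k => [|k IH]; first by rewrite /rho expr0 divr1.
  by rewrite rhoS; have := rho0 k; lra.
pose m1 k := rho k * (21 / 40); pose m2 k := rho k * (39 / 40).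
(* A point within eps r / 2 of A, enlarged by 9/40 eps r, is still within eps rad of a point of V.
   So the balls to which condition (iii) is applied lie in U. *)
have Ulem z s : f z < s -> s <= eps * r / 2 ->
    U z /\ (forall p, mdist z p <= 9 / 40 * (eps * r) -> U p).
  move=> fz ser; have [y Ay yz] := dist_to_lt A0 fz; rewrite metric_sym in yz.
  have U' p : mdist z p <= 9 / 40 * (eps * r) -> U p.
    move=> zp; apply: (inner_part_sub (AV _ Ay)).
    have := metric_triangle y z p; lra.
  split => //; apply: U'; rewrite mdistxx; lra.
have AU : A `<=` U by move=> y /AV; apply: inner_part_subset; rewrite mulr_ge0 ?ltW.
have Hc k z s : ~ N z -> m2 k < f z < rho k -> 0 <= s <= t_ k ->
    ('Pr[X]_(Some z : MD) (at_time s [set y | (f y < m1 k)%R]) <= (c * expR (- (E * 2 ^+ k)))%:E)%E.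
  move=> Nz /andP[mz zr] st; have [Uz Up] := Ulem z _ zr (rhole k).
  have wE : 9 / 40 * (eps * r) / 2 ^+ k = m2 k - m1 k.
    by rewrite /m1 /m2 /rho; field; rewrite gt_eqF.
  have w0 : 0 < 9 / 40 * (eps * r) / 2 ^+ k.
    by rewrite wE /m1 /m2; have := rho0 k; lra.
  have wer : 9 / 40 * (eps * r) / 2 ^+ k <= 9 / 40 * (eps * r).
    by rewrite wE /m1 /m2; have := rhole k; lra.
  have -> : - (E * 2 ^+ k) = - gamma * ((9 / 40 * (eps * r) / 2 ^+ k) `^ beta / t_ k) `^ (beta - 1)^-1.
    by rewrite /t_ crossing_exponent// /E; ring.
  apply: exit_le => //.
  - have erad : eps * rad < rad by rewrite gtr_pMl.
    by rewrite w0/=; apply: (le_lt_trans wer); lra.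
  - by move=> p; rewrite ballEmdist /= => zp; apply: Up; lra.
  - exact: measurable_lip_lt.
  - by move=> y /= fy; have := lf z y; rewrite wE; lra.
have Hk k z : ~ N z -> f z < m1 k ->
    ('Pr[X]_(Some z : MD) (stay X 0 (t_ k.+1) [set y | (f y < rho k.+1)%R] A) <=
      (H * B ^+ k.+1 * J)%:E)%E.
  move=> Nz fz.
  have fz' : f z < eps * r / 2.
    by apply: (lt_le_trans fz); rewrite /m1; have := rhole k; have := rho0 k; lra.
  have [Uz _] := Ulem z _ fz' (lexx _).
  apply: (le_trans _ (HF k z Uz fz')); apply: kernel_le => //; first by rewrite t_0 t_R.
  move=> y /= fy; have [|//] := Ulem y (eps * r / 2) _ (lexx _).
  by apply: (le_lt_trans fy); rewrite rhoS; have := rhole k; have := rho0 k; lra.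
have it n := @iteration_le _ _ _ _ X N mN goodN x f A t_ rho m1 m2
  (fun k => (c * expR (- (E * 2 ^+ k)))%:E) (fun k => (H * B ^+ k.+1 * J)%:E) Nx lf mA t_0 t_S
  ltac:(by move=> k y Ay; apply: (le_lt_trans (dist_to_le y Ay)); rewrite mdistxx /m1; have := rho0 k; lra)
  ltac:(by move=> k; rewrite rhoS /m1; have := rho0 k; lra)
  ltac:(by move=> k; rewrite /m1 /m2; have := rho0 k; lra)
  ltac:(by move=> k; rewrite /m2; have := rho0 k; lra)
  ltac:(by move=> k; rewrite lee_fin mulr_ge0 ?expR_ge0// ltW)
  ltac:(by move=> k; rewrite lee_fin !mulr_ge0// ?exprn_ge0// ltW) Hc Hk n.
have t0E : t_ 0%N = t by rewrite /t_ expr0 mulr1.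
have r0E : rho 0%N = eps * r / 2 by rewrite /rho expr0 divr1.
rewrite t0E r0E in it.
apply/lee_addgt0Pr => e ep.
(* This n makes the remainder c exp(-E 2^n) at most e, since exp(u) >= u and c / e < E 2^n. *)
have [n hn] := @expr2_gt R (E * e / c) ltac:(by rewrite divr_gt0// mulr_gt0).
apply: (le_trans (it n)); rewrite -[leRHS]addeA -[leLHS]addeA; apply: leeD2l.
rewrite sumEFin -!EFinD lee_fin; apply: lerD.
  apply: (@le_trans _ _ (\sum_(k < n) c * H * J * expR (- E) *
      (B ^+ k.+1 * expR (- (E1 * (2 ^+ k - 1)))))).
    apply: ler_sum => k _.
    (* Write 2^k = 1 + (2^k - 1): the first part keeps the full factor exp(-E), and in the second E
       is lowered to E1 so that the sum is bounded by S. *)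
    have : expR (- (E * 2 ^+ k)) <= expR (- E) * expR (- (E1 * (2 ^+ k - 1))).
      rewrite -expRD ler_expR.
      have p1 : (1 : R) <= 2 ^+ k by rewrite exprn_ege1// ler1n.
      have : E1 * (2 ^+ k - 1) <= E * (2 ^+ k - 1) by rewrite ler_wpM2r// subr_ge0.
      lra.
    move=> h; have K0 : 0 <= H * B ^+ k.+1 * J * c.
      by rewrite !mulr_ge0// ?exprn_ge0// ltW.
    have := ler_wpM2l K0 h.
    by move=> h'; apply: le_trans (le_trans h' _); rewrite le_eqVlt; apply/orP; left; apply/eqP; ring.
  rewrite -mulr_sumr.
  have -> : c * S * H * J * expR (- E) = c * H * J * expR (- E) * S by ring.
  apply: ler_wpM2l (hS n).
  by rewrite !mulr_ge0 ?expR_ge0// ltW.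
rewrite expRN ler_pdivrMr ?expR_gt0//.
have : c / e < E * 2 ^+ n.
  rewrite ltr_pdivrMr//; move: hn; rewrite mulrAC ltr_pdivlMr// mul1r.
  by rewrite mulrAC.
move=> h; have : c / e <= expR (E * 2 ^+ n).
  apply: (le_trans (ltW h)); apply: le_trans (expR_ge1Dx _); lra.
by rewrite ler_pdivrMr// mulrC.
Qed.

Hypotheses (diamU : forall x y, U x -> U y -> mdist x y <= rad)
  (HF : forall t x y s z w, 0 < t <= rad `^ beta -> U x -> U y ->
    0 < s <= rad `^ beta -> U z -> U w -> s <= t ->
    F s z w / F t x y <=
    cF * (Num.max (Num.max t (mdist x z `^ beta)) (mdist y w `^ beta) / s)
           `^ alphaF).

Let e0 : 0 < eps. Proof. by case/andP: eps01. Qed.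
Let e1 : eps < 1. Proof. by case/andP: eps01. Qed.
Let erad0 : 0 < eps * rad. Proof. exact: mulr_gt0. Qed.
Let VU : V `<=` U.
Proof. by apply: inner_part_subset; exact: ltW. Qed.
Let B0 : 0 < B. Proof. by rewrite powR_gt0// invr_gt0. Qed.

(** Condition (i) with every term of the maximum bounded by m. The quotient m / (t q^k) splits into
    m / t and q^(-k), and the latter contributes B^k. *)
Lemma F_le t t' x y z w k m : 0 < t -> t <= t' -> t' <= rad `^ beta ->
  U x -> U y -> U z -> U w -> t' <= m -> mdist x z `^ beta <= m -> mdist y w `^ beta <= m ->
  F (t * q ^+ k) z w <= cF * (m / t) `^ alphaF * B ^+ k * F t' x y.
Proof.
move=> t0 tt' t'R Ux Uy Uz Uw t'm xz yw.
have t'0 : 0 < t' by exact: lt_le_trans tt'.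
have qk0 : 0 < q ^+ k by rewrite exprn_gt0.
have s0 : 0 < t * q ^+ k by rewrite mulr_gt0.
have st : t * q ^+ k <= t'.
  apply: le_trans tt'; rewrite ler_piMr ?(ltW t0)// exprn_ile1// ltW//.
have m0 : 0 < m by exact: lt_le_trans t'm.
have := @HF t' x y (t * q ^+ k) z w; rewrite t'0 t'R s0 (le_trans st t'R).
move=> /(_ isT Ux Uy isT Uz Uw st).
rewrite ler_pdivrMr; last by apply: F0; rewrite ?t'0.
move=> h; apply: (le_trans h); apply: ler_wpM2r.
  by apply: ltW; apply: F0; rewrite ?t'0.
rewrite -[leRHS]mulrA; apply: ler_wpM2l; first exact: ltW.
have -> : (m / t) `^ alphaF * B ^+ k = (m / (t * q ^+ k)) `^ alphaF.
  rewrite -powR_mulrn ?(ltW B0)// powRAC powR_mulrn ?invr_ge0 ?(ltW q0)//.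
  rewrite -powRM ?exprn_ge0 ?invr_ge0 ?(ltW q0)//; last by rewrite divr_ge0// ltW.
  by rewrite exprVn invfM mulrA.
apply: ge0_ler_powR; rewrite ?nnegrE.
- exact: ltW.
- by rewrite divr_ge0 ?(ltW s0)// !le_max (ltW t'0).
- by rewrite divr_ge0// ltW.
- by rewrite ler_pM2r ?invr_gt0// !ge_max t'm xz.
Qed.

(** Time 0 is not among the dyadic times of [stay], but [stay_closed] reaches it and would place the
    starting point x in {dist_to A <= rho}. *)
Lemma stay_far (x : M) (A : set (borel M)) t rho : A !=set0 -> 0 < t ->
  measurable A -> rho < dist_to A x ->
  'Pr[X]_(Some x : MD) (stay X 0 t [set y | (dist_to A y < rho)%R] A) = 0%E.
Proof.
move=> A0 t0 mA rx; have lf := dist_to_lip A0.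
have mx : measurable (at_time 0 [set x]).
  by apply: measurable_at_time => //; exact: measurable_singleton.
have P0 : 'Pr[X]_(Some x : MD) (~` at_time 0 [set x]) = 0%E.
  by rewrite probability_setC// start_at_time subee.
apply: (subset_measure0 _ _ _ P0).
- by apply: measurable_stay => //; [exact: ltW|exact: measurable_lip_lt].
- exact: measurableC.
move=> w Sw [_ /= -> xX].
have [|y /= fy] := @stay_closed _ _ _ _ X 0 t rho (dist_to A) A w (lexx _) t0 lf Sw 0.
  by rewrite lexx add0r ltW.
by rewrite -xX => -[yx]; move: fy; rewrite yx leNgt rx.
Qed.

Lemma stay_near (x : M) (A : set (borel M)) t rho : A !=set0 -> 0 < t < rad `^ beta ->
  measurable A -> A `<=` V -> U x -> ~ N x -> rho < eps * rad ->
  ('Pr[X]_(Some x : MD) (stay X 0 t [set y | (dist_to A y < rho)%R] A) <=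
  \int[mu]_(y in A) (F t x y)%:E)%E.
Proof.
move=> A0 tR mA AV Ux Nx rr.
apply: kernel_le => //.
- exact: dist_to_lip.
- move=> y /= fy; have [a Aa ya] := dist_to_lt A0 (le_lt_trans fy rr).
  by apply: (inner_part_sub (AV _ Aa)); rewrite metric_sym ltW.
- by move=> y /AV /VU.
Qed.

(** The integrated form of [core_le], with J the integral of [Phi] over A. [Phi] will be F_t(x, .)
    for x in U and t < rad^beta, and otherwise a constant value of F at a base point. An infinite
    integral makes the bound trivial and is set aside. *)
Lemma bound_le (x : M) (A : set (borel M)) (t r H : R) (Phi : borel M -> R) :
  ~ N x -> measurable A -> A `<=` V -> A !=set0 -> 0 < t < rad `^ beta ->
  0 < r <= rad -> t <= r `^ beta -> 0 < H ->
  measurable_fun A Phi -> (forall y, A y -> 0 <= Phi y) ->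
  (forall k z y, U z -> dist_to A z < eps * r / 2 -> A y ->
    F (t * q ^+ k) z y <= H * B ^+ k * Phi y) ->
  ('Pr[X]_(Some x : MD) (at_time t A) <=
   'Pr[X]_(Some x : MD) (stay X 0 t [set y | (dist_to A y < eps * r / 2)%R] A) +
   (c * S * H * expR (- (gamma * ((9 / 40 * (eps * r)) `^ beta / t) `^ (beta - 1)^-1)))%:E
   * \int[mu]_(y in A) (Phi y)%:E)%E.
Proof.
move=> Nx mA AV A0 tR rR tr H0 mPhi Phi0 HPhi.
have J0 : (0 <= \int[mu]_(y in A) (Phi y)%:E)%E.
  by apply: integral_ge0 => y Ay; rewrite lee_fin Phi0.
have K0 : 0 < c * S * H * expR (- (gamma * ((9 / 40 * (eps * r)) `^ beta / t) `^ (beta - 1)^-1)).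
  by rewrite !mulr_gt0// expR_gt0.
have [Joo|Joo] := eqVneq (\int[mu]_(y in A) (Phi y)%:E)%E +oo%E.
  by rewrite Joo gt0_muley ?lte_fin// addey// ?leey// -ltNye (lt_le_trans _ (measure_ge0 _ _)).
have Jfin : (\int[mu]_(y in A) (Phi y)%:E)%E \is a fin_num by rewrite ge0_fin_numE// ltey.
have JE := fineK Jfin; rewrite -JE -EFinM.
set J := fine _ in JE *.
have -> : c * S * H * expR (- (gamma * ((9 / 40 * (eps * r)) `^ beta / t) `^ (beta - 1)^-1)) * J =
  c * S * H * J * expR (- (gamma * ((9 / 40 * (eps * r)) `^ beta / t) `^ (beta - 1)^-1)).
  by ring.
apply: core_le => //.
- exact: ltW.
- by rewrite -lee_fin JE.
move=> k z Uz fz.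
rewrite -mulrA [(B ^+ _ * _)%R]mulrC mulrA.
have HB0 : 0 <= H * B ^+ k.+1 by rewrite mulr_ge0 ?exprn_ge0// ltW.
have -> : (H * J * B ^+ k.+1)%:E = ((H * B ^+ k.+1)%:E * J%:E)%E by rewrite -EFinM mulrAC.
rewrite JE -ge0_integralZl_EFin//; last exact/measurable_EFinP.
have AU : A `<=` U by move=> y /AV /VU.
have /andP[t0 tR'] := tR.
have s0 : 0 < t * q ^+ k.+1 <= rad `^ beta.
  rewrite mulr_gt0 ?exprn_gt0//=; apply: le_trans (ltW tR').
  by rewrite ler_piMr ?(ltW t0)// exprn_ile1// ltW.
apply: ge0_le_integral => //.
- by move=> y Ay; rewrite lee_fin ltW// F0//; exact: AU.
- apply/measurable_EFinP; apply: (measurable_funS _ AU).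
    exact: open_measurable_borel.
  exact: measurable_F_section.
- by apply: measurable_funeM; exact/measurable_EFinP.
- by move=> y Ay; rewrite -EFinM lee_fin; exact: HPhi.
Qed.


Local Notation gamma_eps := ((eps / 5) `^ (beta / (beta - 1)) * gamma).
Local Notation E2 := (gamma * (19 / 90 * eps) `^ (beta / (beta - 1))).
Local Notation b := ((beta - 1)^-1).

Let b0 : 0 < b. Proof. by rewrite invr_gt0 subr_gt0. Qed.
Let beta0 : 0 < beta. Proof. exact: lt_trans beta1. Qed.
Let bb0 : 0 < beta / (beta - 1). Proof. exact: mulr_gt0. Qed.

(* On the shell r <= d(x, y) <= r + t^(1/beta) with r >= 18 t^(1/beta) one has
   r >= 18/19 d(x, y), so 19/90 in E2 becomes 1/5; the gap between 9/40 and 19/90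
   absorbs the polynomial factors. *)
Lemma E2_lt_E1 : E2 < E1.
Proof.
rewrite ltr_pM2l//; apply: gt0_ltr_powR => //; rewrite ?nnegrE ?mulr_ge0 ?ltW//.
by rewrite ltr_pM2r//; lra.
Qed.

Lemma gamma_eps_lt_E1 : gamma_eps < E1.
Proof.
rewrite mulrC ltr_pM2l//; apply: gt0_ltr_powR => //; rewrite ?nnegrE ?mulr_ge0 ?ltW//.
by rewrite mulrC ltr_pM2r//; lra.
Qed.

Lemma gamma_eps_ge0 : 0 <= gamma_eps.
Proof. by rewrite mulr_ge0 ?powR_ge0// ltW. Qed.

Lemma exponentE (t r : R) : 0 < t -> 0 < r ->
  gamma * ((9 / 40 * (eps * r)) `^ beta / t) `^ b = E1 * (r `^ beta / t) `^ b.
Proof.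
move=> t0 r0; rewrite mulrA (@powRM _ (9 / 40 * eps) r) ?mulr_ge0 ?(ltW e0) ?(ltW r0)//.
rewrite -mulrA (@powRM _ _ (r `^ beta / t)) ?powR_ge0 ?divr_ge0 ?powR_ge0 ?(ltW t0)//.
by rewrite -powRrM mulrA.
Qed.

Lemma E2_exponent (t r : R) : 0 < t -> 0 < r ->
  E2 * (r `^ beta / t) `^ b = gamma_eps * ((19 / 18 * r) `^ beta / t) `^ b.
Proof.
move=> t0 r0.
have p1 : 0 <= eps / 5 by apply: divr_ge0; [exact: ltW|exact: ler0n].
have p2 : (0 : R) <= 19 / 18 by apply: divr_ge0; exact: ler0n.
have p3 : 0 <= r `^ beta / t by apply: divr_ge0; [exact: powR_ge0|exact: ltW].
have -> : 19 / 90 * eps = eps / 5 * (19 / 18) by field.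
rewrite (powRM _ p1 p2) (powRM _ p2 (ltW r0)) -[(_ * r `^ beta) / t]mulrA.
rewrite (powRM _ (powR_ge0 _ _) p3) -(powRrM (19 / 18)).
by rewrite !mulrA; congr (_ * _); rewrite -!mulrA mulrCA.
Qed.

Lemma E2_exponent_ge (t r u : R) : 0 < t -> 0 < r -> 0 <= u -> u <= 19 / 18 * r ->
  gamma_eps * (u `^ beta / t) `^ b <= E2 * (r `^ beta / t) `^ b.
Proof.
move=> t0 r0 u0 ur; rewrite (E2_exponent t0 r0).
apply: ler_wpM2l; first exact: gamma_eps_ge0.
have it0 : 0 < t^-1 by rewrite invr_gt0.
apply: ge0_ler_powR; rewrite ?nnegrE.
- exact: ltW.
- by apply: mulr_ge0; [exact: powR_ge0|exact: ltW].
- by apply: mulr_ge0; [exact: powR_ge0|exact: ltW].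
rewrite (ler_pM2r it0); apply: ge0_ler_powR; rewrite ?nnegrE.
- exact: ltW.
- exact: u0.
- exact: le_trans ur.
- exact: ur.
Qed.

Lemma at_time_set0 t : at_time t set0 = set0.
Proof. by rewrite /at_time image_set0 preimage_set0. Qed.

Lemma powR_root (t : R) : 0 < t -> (t `^ beta^-1) `^ beta = t.
Proof. by move=> t0; rewrite -powRrM mulVf ?gt_eqF// powRr1// ltW. Qed.

Lemma root_le (t : R) : 0 < t <= rad `^ beta -> 0 < t `^ beta^-1 <= rad.
Proof.
move=> /andP[t0 tR]; rewrite powR_gt0//=.
have -> : rad = (rad `^ beta) `^ beta^-1.
  by rewrite -powRrM mulfV ?gt_eqF// powRr1// ltW.
by apply: ge0_ler_powR; rewrite ?nnegrE ?powR_ge0// ?invr_ge0 ltW.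
Qed.

Definition kernel_bound t x y := F t x y * expR (- gamma_eps * (mdist x y `^ beta / t) `^ b).

Lemma measurable_kernel_bound t x : 0 < t <= rad `^ beta -> U x ->
  measurable_fun (U : set (borel M)) (kernel_bound t x).
Proof.
move=> t0 Ux; apply: measurable_funM; first exact: measurable_F_section.
apply: measurable_funTS.
apply: (@measurableT_comp _ _ _ _ _ _ (@expR R)); first exact: measurable_expR.
apply: measurable_funM; first exact: measurable_cst.
apply: (@measurableT_comp _ _ _ _ _ _ (fun u : R => u `^ b)); first exact: measurable_powR.
apply: measurable_funM; last exact: measurable_cst.
apply: (@measurableT_comp _ _ _ _ _ _ (fun u : R => u `^ beta)); first exact: measurable_powR.
exact: measurable_mdist_section.
Qed.

Lemma integral_F_le t x (A : set (borel M)) (k K : R) : 0 < t <= rad `^ beta -> U x ->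
  measurable A -> A `<=` U -> 0 <= k ->
  (forall y, A y -> k <= K * expR (- gamma_eps * (mdist x y `^ beta / t) `^ b)) ->
  (k%:E * \int[mu]_(y in A) (F t x y)%:E <= \int[mu]_(y in A) (K * kernel_bound t x y)%:E)%E.
Proof.
move=> tR Ux mA AU k0 HK.
have Fge y : A y -> 0 <= F t x y by move=> Ay; apply: ltW; apply: F0 => //; exact: AU.
have mFA : measurable_fun A (F t x : borel M -> R).
  apply: (measurable_funS _ AU); first exact: open_measurable_borel.
  exact: measurable_F_section.
rewrite -ge0_integralZl_EFin//; last exact/measurable_EFinP.
apply: ge0_le_integral => //.
- by move=> y Ay; rewrite -EFinM lee_fin mulr_ge0// Fge.
- by apply: measurable_funeM; exact/measurable_EFinP.
- apply/measurable_EFinP; apply: measurable_funM; first exact: measurable_cst.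
  apply: (measurable_funS _ AU); first exact: open_measurable_borel.
  exact: measurable_kernel_bound.
move=> y Ay; rewrite -EFinM lee_fin /kernel_bound mulrCA mulrC.
by apply: ler_wpM2l; [exact: Fge|exact: HK].
Qed.


(** The summand 1 comes from the paths that stay near A, the other from the crossings, where the
    relevant distances are at most 20 t^(1/beta). The last factor undoes the exponential of
    [kernel_bound], which is bounded below within distance 18 t^(1/beta). *)
Definition near_const :=
  (1 + c * S * (cF * (20 `^ beta) `^ alphaF)) * expR (gamma_eps * (18 `^ beta) `^ b).

Lemma near_le (x : M) (A : set (borel M)) (t : R) : U x -> ~ N x -> 0 < t < rad `^ beta ->
  measurable A -> A `<=` V -> (forall y, A y -> mdist x y <= 18 * t `^ beta^-1) ->
  ('Pr[X]_(Some x : MD) (at_time t A) <=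
   \int[mu]_(y in A) (near_const * kernel_bound t x y)%:E)%E.
Proof.
move=> Ux Nx tR mA AV Ad; have /andP[t0 tR'] := tR.
have [-> |/set0P A0] := eqVneq A set0.
  by rewrite at_time_set0 measure0 integral_set0.
have tR2 : 0 < t <= rad `^ beta by rewrite t0 ltW.
have /andP[r0 rR] := root_le tR2.
pose r := t `^ beta^-1; have rE : r `^ beta = t by exact: powR_root.
have AU : A `<=` U by move=> y /AV /VU.
have err : eps * r / 2 < eps * rad.
  by apply: half_lt => //; rewrite ler_pM2l.
have H0 : 0 < cF * (20 `^ beta) `^ alphaF by rewrite mulr_gt0// !powR_gt0.
have mFA : measurable_fun A (F t x : borel M -> R).
  apply: (measurable_funS _ AU); first exact: open_measurable_borel.
  exact: measurable_F_section.
apply: (le_trans (@bound_le x A t r _ (F t x) Nx mA AV A0 tR _ _ H0 mFA _ _)).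
- by rewrite r0.
- by rewrite rE.
- by move=> y Ay; apply: ltW; apply: F0 => //; exact: AU.
- move=> k z y Uz fz Ay.
  have -> : (20 `^ beta) = (20 * r) `^ beta / t.
    by rewrite powRM ?(ltW r0)// rE mulfK ?gt_eqF.
  apply: F_le => //.
  + exact: ltW.
  + exact: AU.
  + exact: AU.
  + rewrite -{1}rE; apply: ge0_ler_powR; rewrite ?nnegrE ?mulr_ge0 ?(ltW beta0) ?(ltW r0)//.
    by rewrite ler_peMl ?(ltW r0)// ler1n.
  + apply: ge0_ler_powR; rewrite ?nnegrE ?mulr_ge0 ?mdist_ge0 ?(ltW beta0) ?(ltW r0)//.
    have [a Aa az] := dist_to_lt A0 fz; rewrite metric_sym in az.
    apply: (dist_near_le _ (metric_triangle x a z) (Ad _ Aa) az r0).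
    by rewrite ler_piMl ?(ltW r0)// ltW.
  + by rewrite mdistxx powR0 ?gt_eqF// powR_ge0.
set E := gamma * _.
have E0 : 0 <= E by rewrite mulr_ge0 ?powR_ge0// ltW.
have I0 : (0 <= \int[mu]_(y in A) (F t x y)%:E)%E.
  by apply: integral_ge0 => y Ay; rewrite lee_fin; apply: ltW; apply: F0 => //; exact: AU.
pose K := c * S * (cF * (20 `^ beta) `^ alphaF).
have K0 : 0 < K by rewrite !mulr_gt0.
apply: (@le_trans _ _ ((1 + K)%:E * \int[mu]_(y in A) (F t x y)%:E)%E).
  rewrite EFinD ge0_muleDl ?lee_fin ?(ltW K0)// mul1e; apply: leeD.
    exact: stay_near.
  apply: lee_wpmul2r => //; rewrite lee_fin -[leRHS]mulr1.
  by apply: ler_wpM2l; rewrite ?(ltW K0)// expR_le1 oppr_le0.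
apply: integral_F_le => //; first by rewrite addr_ge0// ltW.
move=> y Ay; rewrite /near_const -mulrA -expRD ler_peMr//.
  by rewrite addr_ge0// ltW.
rewrite -[leLHS]expR0 ler_expR mulNr subr_ge0; apply: ler_wpM2l; first exact: gamma_eps_ge0.
apply: ge0_ler_powR; rewrite ?nnegrE ?powR_ge0 ?divr_ge0 ?powR_ge0 ?(ltW b0) ?(ltW t0)//.
rewrite ler_pdivrMr// -[X in _ * X]rE -powRM ?(ltW r0)//.
by apply: ge0_ler_powR; rewrite ?nnegrE ?mulr_ge0 ?mdist_ge0 ?(ltW beta0) ?(ltW r0)//; exact: Ad.
Qed.

Variables C1 C2 : R.
Hypotheses (C10 : 0 < C1) (hC1 : forall u, 1 <= u -> u `^ alphaF <= C1 * expR ((E1 - E2) * u `^ b)).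
Hypotheses (C20 : 0 < C2)
  (hC2 : forall u, 1 <= u -> u `^ (2 * alphaF) <= C2 * expR ((E1 - gamma_eps) * u `^ b)).

(** All relevant distances are at most 2 r. [C1] pays for (r^beta / t)^alphaF by giving up the part
    E1 - E2 of the exponent. *)
Definition far_const := c * S * (cF * (2 `^ beta) `^ alphaF) * C1.

(** The scale of the core estimate is now the inner radius r of the shell. Since x is farther than
    eps r / 2 from A, staying near A from the start has probability 0, and all that remains carries
    the exponential factor. *)
Lemma far_le (x : M) (A : set (borel M)) (t r : R) : U x -> ~ N x -> 0 < t < rad `^ beta ->
  measurable A -> A `<=` V -> 18 * t `^ beta^-1 <= r ->
  (forall y, A y -> r <= mdist x y <= r + t `^ beta^-1) ->
  ('Pr[X]_(Some x : MD) (at_time t A) <=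
   \int[mu]_(y in A) (far_const * kernel_bound t x y)%:E)%E.
Proof.
move=> Ux Nx tR mA AV tr Ad; have /andP[t0 tR'] := tR.
have [-> |/set0P A0] := eqVneq A set0.
  by rewrite at_time_set0 measure0 integral_set0.
have tR2 : 0 < t <= rad `^ beta by rewrite t0 ltW.
have /andP[s0 sR] := root_le tR2.
pose s := t `^ beta^-1; have sE : s `^ beta = t by exact: powR_root.
have AU : A `<=` U by move=> y /AV /VU.
have [r0 sr] := far_pos tr s0.
have rR : r <= rad.
  have [a Aa] := A0; have /andP[ra _] := Ad _ Aa.
  by apply: (le_trans ra); apply: diamU => //; exact: AU.
have trb : t <= r `^ beta.
  rewrite -[leLHS]sE; apply: ge0_ler_powR; rewrite ?nnegrE ?(ltW beta0) ?(ltW r0) ?(ltW s0)//.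
pose v := r `^ beta / t; have v1 : 1 <= v by rewrite ler_pdivlMr// mul1r.
have v0 : 0 <= v by apply: le_trans v1.
have H0 : 0 < cF * (2 `^ beta) `^ alphaF * v `^ alphaF.
  by rewrite !mulr_gt0// ?powR_gt0// ?powR_gt0//; apply: lt_le_trans v1.
have mFA : measurable_fun A (F t x : borel M -> R).
  apply: (measurable_funS _ AU); first exact: open_measurable_borel.
  exact: measurable_F_section.
apply: (le_trans (@bound_le x A t r _ (F t x) Nx mA AV A0 tR _ _ H0 mFA _ _)) => //.
- by rewrite r0.
- by move=> y Ay; apply: ltW; apply: F0 => //; exact: AU.
- move=> k z y Uz fz Ay.
  have -> : cF * (2 `^ beta) `^ alphaF * v `^ alphaF = cF * ((2 * r) `^ beta / t) `^ alphaF.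
    by rewrite -mulrA -powRM ?powR_ge0// mulrA -powRM// ltW.
  apply: F_le => //.
  + exact: ltW.
  + exact: AU.
  + exact: AU.
  + apply: (le_trans trb); apply: ge0_ler_powR; rewrite ?nnegrE ?mulr_ge0 ?(ltW beta0) ?(ltW r0)//.
    by rewrite ler_peMl ?(ltW r0)// ler1n.
  + apply: ge0_ler_powR; rewrite ?nnegrE ?mulr_ge0 ?mdist_ge0 ?(ltW beta0) ?(ltW r0)//.
    have [a Aa az] := dist_to_lt A0 fz; rewrite metric_sym in az.
    have /andP[_ xa] := Ad _ Aa.
    apply: (dist_far_le _ (metric_triangle x a z) xa az tr s0).
    by rewrite ler_piMl ?(ltW r0)// ltW.
  + by rewrite mdistxx powR0 ?gt_eqF// powR_ge0.
rewrite stay_far// ?add0e; last first.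
  apply: (@lt_le_trans _ _ r); last by apply: le_dist_to => // y /Ad/andP[].
  by apply: half_lt => //; rewrite ler_piMl ?(ltW r0)// ltW.
apply: integral_F_le => //.
  by rewrite !mulr_ge0 ?powR_ge0 ?expR_ge0// ltW.
move=> y Ay; rewrite exponentE// -/v.
have h1 : c * S * (cF * (2 `^ beta) `^ alphaF * v `^ alphaF) * expR (- (E1 * v `^ b)) <=
    far_const * expR (- (E2 * v `^ b)).
  have -> : c * S * (cF * (2 `^ beta) `^ alphaF * v `^ alphaF) * expR (- (E1 * v `^ b)) =
    c * S * (cF * (2 `^ beta) `^ alphaF) * (v `^ alphaF * expR (- (E1 * v `^ b))) by ring.
  rewrite /far_const -[leRHS]mulrA; apply: ler_wpM2l.
    by rewrite !mulr_ge0 ?powR_ge0// ltW.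
  have -> : - (E2 * v `^ b) = (E1 - E2) * v `^ b + - (E1 * v `^ b) by ring.
  by rewrite expRD mulrA ler_pM2r ?expR_gt0//; exact: hC1.
apply: (le_trans h1); apply: ler_wpM2l; first by rewrite !mulr_ge0 ?powR_ge0// ltW.
rewrite ler_expR mulNr lerN2.
have /andP[_ xy] := Ad _ Ay.
exact: (E2_exponent_ge t0 r0 (mdist_ge0 x y) (far_ratio tr xy)).
Qed.


(** Induction on the number of shells of width t^(1/beta) around the ball of radius 18 t^(1/beta);
    finitely many suffice because U has diameter at most [rad]. The constant does not grow with
    their number, the bounds being integrals over disjoint sets. *)
Lemma inside_le (x : M) (A : set (borel M)) (t : R) : U x -> ~ N x -> 0 < t < rad `^ beta ->
  measurable A -> A `<=` V ->
  ('Pr[X]_(Some x : MD) (at_time t A) <=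
   \int[mu]_(y in A) ((near_const + far_const) * kernel_bound t x y)%:E)%E.
Proof.
move=> Ux Nx tR mA AV; have /andP[t0 tR'] := tR.
have tR2 : 0 < t <= rad `^ beta by rewrite t0 ltW.
have /andP[s0 _] := root_le tR2; set s := t `^ beta^-1 in s0.
have near0 : 0 <= near_const.
  by rewrite !mulr_ge0 ?expR_ge0// addr_ge0// !mulr_ge0 ?powR_ge0// ltW.
have far0 : 0 <= far_const by rewrite !mulr_ge0 ?powR_ge0// ltW.
have AU' (A' : set (borel M)) : A' `<=` V -> A' `<=` U by move=> A'V y /A'V /VU.
have kb0 y : U y -> 0 <= kernel_bound t x y.
  by move=> Uy; rewrite mulr_ge0 ?expR_ge0// ltW// F0.
have mK (A' : set (borel M)) (K : R) : A' `<=` V ->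
    measurable_fun A' (fun y => (K * kernel_bound t x y)%:E).
  move=> A'V; apply/measurable_EFinP; apply: measurable_funM; first exact: measurable_cst.
  apply: (measurable_funS _ (AU' _ A'V)); first exact: open_measurable_borel.
  exact: measurable_kernel_bound.
have le_int (A' : set (borel M)) (K : R) : 0 <= K -> K <= near_const + far_const ->
    measurable A' -> A' `<=` V ->
    (\int[mu]_(y in A') (K * kernel_bound t x y)%:E <=
     \int[mu]_(y in A') ((near_const + far_const) * kernel_bound t x y)%:E)%E.
  move=> K0 KK mA' A'V; apply: ge0_le_integral => //.
  - by move=> y A'y; rewrite lee_fin; apply: mulr_ge0 => //; apply: kb0; exact: AU' A'y.
  - exact: mK.
  - exact: mK.
  - by move=> y A'y; rewrite lee_fin; apply: ler_wpM2r => //; apply: kb0; exact: AU' A'y.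
have mball (u : R) : measurable ([set y | mdist x y < u] : set (borel M)).
  by rewrite -[X in measurable X]setTI; have := measurable_mdist_section x measurableT
    (measurable_itv `]-oo, u[); congr (measurable (_ `&` _));
    apply/seteqP; split => y /=; rewrite in_itv.
suff H n : forall A' : set (borel M), measurable A' -> A' `<=` V ->
    (forall y, A' y -> mdist x y < (18 + n%:R) * s) ->
    ('Pr[X]_(Some x : MD) (at_time t A') <=
    \int[mu]_(y in A') ((near_const + far_const) * kernel_bound t x y)%:E)%E.
  have [n hn] : exists n : nat, rad < (18 + n%:R) * s.
    exists (Num.truncn (rad / s)).+1; rewrite -ltr_pdivrMr//.
    by apply: (lt_le_trans (truncnS_gt _)); rewrite lerDr.
  apply: (H n) => // y Ay; apply: le_lt_trans hn; apply: diamU => //.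
  exact: (AU' _ AV).
elim: n => [|n IH] A' mA' A'V A'd.
  apply: (le_trans (near_le Ux Nx tR mA' A'V _)).
    by move=> y /A'd; rewrite addr0 => /ltW.
  by apply: le_int => //; rewrite lerDl.
pose D := [set y | mdist x y < (18 + n%:R) * s] : set (borel M).
have mD : measurable D by exact: mball.
have mA1 : measurable (A' `&` D) by exact: measurableI.
have mA2 : measurable (A' `\` D) by exact: measurableD.
have A1V : A' `&` D `<=` V by move=> y [/A'V].
have A2V : A' `\` D `<=` V by move=> y [/A'V].
have h1 := IH (A' `&` D) mA1 A1V (fun y H => H.2).
have h2 : ('Pr[X]_(Some x : MD) (at_time t (A' `\` D)) <=
    \int[mu]_(y in A' `\` D) ((near_const + far_const) * kernel_bound t x y)%:E)%E.
  apply: (le_trans (@far_le x (A' `\` D) t ((18 + n%:R) * s) Ux Nx tR mA2 A2V _ _)).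
  - by rewrite ler_pM2r// lerDl.
  - move=> y [A'y nD]; apply/andP; split; first by rewrite leNgt; exact/negP.
    have E : (18 + n.+1%:R) * s = (18 + n%:R) * s + s.
      by rewrite -[n.+1%:R]natr1 addrA mulrDl mul1r.
    by have := A'd y A'y; rewrite E => /ltW.
  - by apply: le_int => //; rewrite lerDr.
have tt0 : 0 <= t by exact: ltW.
have UE : A' = (A' `&` D) `|` (A' `\` D) by rewrite setUIDK.
rewrite UE ge0_integral_setU//; last 3 first.
- by rewrite -UE; exact: mK.
- by move=> y; rewrite -UE => A'y; rewrite lee_fin mulr_ge0 ?addr_ge0// kb0//; exact: AU' A'y.
- by rewrite disj_set2E; apply/eqP/seteqP; split => // y [[_ ?] [_]].
apply: (le_trans _ (leeD h1 h2)).
have -> : at_time t ((A' `&` D) `|` (A' `\` D)) = at_time t (A' `&` D) `|` at_time t (A' `\` D).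
  by rewrite /at_time image_setU preimage_setU.
by apply: measureU2; exact: measurable_at_time.
Qed.

Variable z0 : M.
Hypothesis Uz0 : U z0.
Local Notation infF s := (inf [set F s z w | z in U & w in U]).

(** F_t(x, .) has no meaning for x outside U. Its value at a fixed point of U replaces it, all
    distances in condition (i) being bounded by [rad]. *)
Definition outside_bound t := c * S * cF * (rad `^ beta / t) `^ alphaF *
  expR (- (E1 * (rad `^ beta / t) `^ b)) * F t z0 z0.

Lemma outside_le (x : M) (A : set (borel M)) (t : R) : ~ U x -> ~ N x -> 0 < t < rad `^ beta ->
  measurable A -> A `<=` V ->
  ('Pr[X]_(Some x : MD) (at_time t A) <= \int[mu]_(y in A) (outside_bound t)%:E)%E.
Proof.
move=> nUx Nx tR mA AV; have /andP[t0 tR'] := tR.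
have [-> |/set0P A0] := eqVneq A set0.
  by rewrite at_time_set0 measure0 integral_set0.
have AU : A `<=` U by move=> y /AV /VU.
have tR2 : 0 < t <= rad `^ beta by rewrite t0 ltW.
have F00 : 0 <= F t z0 z0 by apply: ltW; exact: F0.
have v0 : 0 < rad `^ beta / t by rewrite divr_gt0// powR_gt0.
have H0 : 0 < cF * (rad `^ beta / t) `^ alphaF by rewrite mulr_gt0// powR_gt0.
apply: (le_trans (@bound_le x A t rad _ (cst (F t z0 z0)) Nx mA AV A0 tR _ (ltW tR') H0 _ _ _)) => //.
- by rewrite rad0/=.
- move=> k z y Uz fz Ay; apply: F_le => //.
  + exact: ltW.
  + exact: AU.
  + exact: ltW.
  + by apply: ge0_ler_powR; rewrite ?nnegrE ?mdist_ge0 ?(ltW beta0) ?(ltW rad0)//; exact: diamU.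
  + by apply: ge0_ler_powR; rewrite ?nnegrE ?mdist_ge0 ?(ltW beta0) ?(ltW rad0)//; apply: diamU => //; exact: AU.
(* A point outside U is at distance at least eps rad from every point of A, hence the path cannot
   have stayed near A from the start. *)
rewrite stay_far// ?add0e; last first.
  apply: (@lt_le_trans _ _ (eps * rad)); first exact: half_lt.
  apply: le_dist_to => // y /AV Vy; rewrite leNgt; apply/negP => xy; apply: nUx.
  by apply: (inner_part_sub Vy); rewrite metric_sym ltW.
rewrite exponentE// -ge0_integralZl_EFin//.
- apply: ge0_le_integral => //.
  - by move=> y _; rewrite -EFinM lee_fin /outside_bound !mulr_ge0 ?powR_ge0 ?expR_ge0// ltW.
  - by apply: measurable_funeM; apply/measurable_EFinP; exact: measurable_cst.
  - by move=> y _; rewrite -EFinM lee_fin /outside_bound /= -!mulrA.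
- by apply/measurable_EFinP; exact: measurable_cst.
- by rewrite !mulr_ge0 ?powR_ge0 ?expR_ge0// ltW.
Qed.

Definition late_bound := (cF * 2 `^ alphaF * (1 + c * S)) * F (rad `^ beta) z0 z0.

(** At time rad^beta / 2 one bound holds for every starting point outside N, in U or not, so it
    survives averaging over the position at t - rad^beta / 2. The ratio of rad^beta to this time is
    the 2 in [late_bound]. *)
Lemma late_le (x : M) (A : set (borel M)) (t : R) : ~ N x -> rad `^ beta <= t ->
  measurable A -> A `<=` V ->
  ('Pr[X]_(Some x : MD) (at_time t A) <= \int[mu]_(y in A) late_bound%:E)%E.
Proof.
move=> Nx tR mA AV.
have [-> |/set0P A0] := eqVneq A set0.
  by rewrite at_time_set0 measure0 integral_set0.
have AU : A `<=` U by move=> y /AV /VU.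
have R0 : 0 < rad `^ beta by exact: powR_gt0.
have RR : 0 < rad `^ beta <= rad `^ beta by rewrite R0 lexx.
pose t0 := rad `^ beta / 2.
have t00 : 0 < t0 by rewrite divr_gt0.
have t0R : t0 < rad `^ beta by rewrite /t0 gtr_pMr// invf_lt1// ltr1n.
have t0R' : 0 < t0 < rad `^ beta by rewrite t00.
have F00 : 0 < F (rad `^ beta) z0 z0 by exact: F0.
have Et0 : rad `^ beta / t0 = 2 by rewrite /t0 invf_div mulrCA divff ?mulr1// gt_eqF.
have H0 : 0 < cF * 2 `^ alphaF by rewrite mulr_gt0// powR_gt0.
have cS0 : 0 < c * S by rewrite mulr_gt0.
have FP k z y : U z -> U y -> F (t0 * q ^+ k) z y <= cF * 2 `^ alphaF * B ^+ k * F (rad `^ beta) z0 z0.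
  move=> Uz Uy.
  have dm u u' : U u -> U u' -> mdist u u' `^ beta <= rad `^ beta.
    move=> Uu Uu'.
    by apply: ge0_ler_powR; rewrite ?nnegrE ?mdist_ge0 ?(ltW beta0) ?(ltW rad0)//; exact: diamU.
  have := @F_le t0 (rad `^ beta) z0 z0 z y k (rad `^ beta) t00 (ltW t0R) (lexx _) Uz0 Uz0 Uz Uy
    (lexx _) (dm _ _ Uz0 Uz) (dm _ _ Uz0 Uy).
  by rewrite Et0.
have lb0 : 0 <= late_bound by rewrite !mulr_ge0 ?addr_ge0 ?powR_ge0 ?mulr_ge0// ltW.
have kappa0 : (0 <= \int[mu]_(y in A) late_bound%:E)%E by apply: integral_ge0 => y _; rewrite lee_fin.
have Hz z : ~ N z -> ('Pr[X]_(Some z : MD) (at_time t0 A) <= \int[mu]_(y in A) late_bound%:E)%E.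
  move=> Nz.
  apply: (le_trans (@bound_le z A t0 rad _ (cst (F (rad `^ beta) z0 z0)) Nz mA AV A0 t0R' _ (ltW t0R) H0 _ _ _)) => //.
  - by rewrite rad0/=.
  - by move=> y _; exact: ltW.
  - by move=> k z' y Uz' _ Ay; apply: FP => //; exact: AU.
  have J0 : (0 <= \int[mu]_(y in A) (F (rad `^ beta) z0 z0)%:E)%E.
    by apply: integral_ge0 => y _; rewrite lee_fin ltW.
  have -> : (\int[mu]_(y in A) late_bound%:E =
      (cF * 2 `^ alphaF * (1 + c * S))%:E * \int[mu]_(y in A) (F (rad `^ beta) z0 z0)%:E)%E.
    rewrite -ge0_integralZl_EFin//.
    - by move=> y _; rewrite lee_fin ltW.
    - exact: mulr_ge0 (ltW H0) (addr_ge0 ler01 (ltW cS0)).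
  rewrite mulrDr mulr1 EFinD ge0_muleDl; [|by rewrite lee_fin; exact: ltW
    |by rewrite lee_fin; exact: mulr_ge0 (ltW H0) (ltW cS0)].
  apply: leeD; last first.
    apply: lee_wpmul2r => //; rewrite lee_fin -[leRHS]mulr1 [cF * _ * _]mulrC.
    apply: ler_wpM2l; first exact: mulr_ge0 (ltW cS0) (ltW H0).
    by rewrite expR_le1 oppr_le0 mulr_ge0 ?powR_ge0// ltW.
  have [fz|fz] := ltP (eps * rad / 2) (dist_to A z).
    by rewrite stay_far// mule_ge0// lee_fin ltW.
  have err : eps * rad / 2 < eps * rad by exact: half_lt.
  have Uz : U z.
    have [a Aa za] := dist_to_lt A0 (le_lt_trans fz err).
    by apply: (inner_part_sub (AV _ Aa)); rewrite metric_sym ltW.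
  apply: (le_trans (stay_near A0 t0R' mA AV Uz Nz err)).
  have t0R2 : 0 < t0 <= rad `^ beta by rewrite t00 ltW.
  rewrite -ge0_integralZl_EFin//; first last.
  - exact: ltW.
  - by move=> y _; rewrite lee_fin ltW.
  apply: ge0_le_integral => //.
  - by move=> y Ay; rewrite lee_fin ltW// F0//; exact: AU.
  - apply/measurable_EFinP; apply: (measurable_funS _ AU).
      exact: open_measurable_borel.
    exact: measurable_F_section.
  - move=> y Ay; rewrite -EFinM lee_fin.
    by have := FP 0%N z y Uz (AU _ Ay); rewrite expr0 mulr1 expr0 mulr1.
have s0 : 0 <= t - t0 by rewrite subr_ge0; apply: le_trans tR; exact: ltW.
have mNC : measurable (~` N) by exact: measurableC.
have FL : natural_filtration X (t - t0)%:E (at_time (t - t0) (~` N)).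
  by apply: natural_filtration_at_time => //; rewrite s0 lexx.
have := @markov_at_time_le _ _ _ _ X (Some x) (t - t0) t0 (at_time (t - t0) (~` N)) (~` N) A _
  s0 (ltW t00) mA FL (@subset_refl _ _) kappa0 Hz.
rewrite subrK => h.
have PN : 'Pr[X]_(Some x : MD) (at_time (t - t0) N) = 0%E by exact: at_time_exceptional.
have t0' : 0 <= t by apply: le_trans tR; exact: ltW.
have mAt : measurable (at_time t A) by exact: measurable_at_time.
have mL : measurable (at_time (t - t0) (~` N)) by exact: measurable_at_time.
have mN' : measurable (at_time (t - t0) N) by exact: measurable_at_time.
apply: (@le_trans _ _ ('Pr[X]_(Some x : MD) ((at_time (t - t0) (~` N) `&` at_time t A)
    `|` at_time (t - t0) N))).
  apply: le_measure; rewrite ?inE//; first by apply: measurableU => //; exact: measurableI.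
  move=> w Aw; case E : (X (t - t0)%:E w) => [y|]; last first.
    have tt : t - t0 <= t by rewrite gerBl ltW.
    by have := dead_mono tt s0 E; case: Aw => y _ <-.
  by have [Ny|Ny] := pselect (N y); [right; exists y|left; split => //; exists y].
apply: (le_trans (measureU2 _ _ _)) => //; first exact: measurableI.
rewrite [X in (_ + X)%E](_ : _ = 0%E)// adde0; apply: (le_trans h).
by rewrite -[leRHS]mule1; apply: lee_wpmul2l => //; exact: probability_le1.
Qed.

Lemma F_le_infF s t m : 0 < t -> t <= s -> s <= rad `^ beta -> s <= m -> rad `^ beta <= m ->
  F t z0 z0 <= cF * (m / t) `^ alphaF * infF s.
Proof.
move=> t0 ts sR sm Rm; have m0 : 0 < m by apply: lt_le_trans Rm; exact: powR_gt0.
have K0 : 0 < cF * (m / t) `^ alphaF by rewrite mulr_gt0// powR_gt0// divr_gt0.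
rewrite mulrC -ler_pdivrMr//; apply: lb_le_inf.
  by exists (F s z0 z0); exists z0 => //; exists z0.
move=> _ [z Uz [w Uw <-]]; rewrite ler_pdivrMr// mulrC.
have dm u v : U u -> U v -> mdist u v `^ beta <= m.
  move=> Uu Uv; apply: le_trans Rm.
  by apply: ge0_ler_powR; rewrite ?nnegrE ?mdist_ge0 ?(ltW beta0) ?(ltW rad0)//; exact: diamU.
have := @F_le t s z w z0 z0 0%N m t0 ts sR Uz Uw Uz0 Uz0 sm (dm _ _ Uz Uz0) (dm _ _ Uw Uz0).
by rewrite !expr0 !mulr1.
Qed.

(** Passing from the value at [z0] to the infimum uses condition (i) a second time and squares the
    polynomial factor; this is why [C2] is chosen for the power 2 alphaF. *)
Lemma outside_bound_le t : 0 < t < rad `^ beta ->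
  outside_bound t <= c * S * cF * cF * C2 * infF (Num.min (2 * t) (rad `^ beta)) *
    expR (- gamma_eps * (rad `^ beta / t) `^ b).
Proof.
move=> /andP[t0 tR].
set s := Num.min _ _; pose v := rad `^ beta / t.
have ts : t <= s by rewrite le_min ler_peMl ?(ltW t0) ?ler1n//= ltW.
have sR : s <= rad `^ beta by rewrite ge_min lexx orbT.
have hF := F_le_infF t0 ts sR sR (lexx _).
have v1 : 1 <= v by rewrite ler_pdivlMr// mul1r ltW.
have infF0 : 0 <= infF s.
  apply: lb_le_inf; first by exists (F s z0 z0); exists z0 => //; exists z0.
  by move=> _ [z Uz [w Uw <-]]; apply: ltW; apply: F0 => //; rewrite sR (lt_le_trans t0).
rewrite /outside_bound -/v.
have K1 : 0 <= c * S * cF * v `^ alphaF * expR (- (E1 * v `^ b)).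
  by rewrite !mulr_ge0 ?powR_ge0 ?expR_ge0// ltW.
apply: (le_trans (ler_wpM2l K1 hF)); rewrite -/v.
have vE : v `^ alphaF * v `^ alphaF = v `^ (2 * alphaF).
  have vn0 : v != 0 by rewrite gt_eqF// (lt_le_trans ltr01 v1).
  rewrite -powRD; last by rewrite vn0 implybT.
  by congr (_ `^ _); ring.
have -> : c * S * cF * v `^ alphaF * expR (- (E1 * v `^ b)) * (cF * v `^ alphaF * infF s) =
    c * S * cF * cF * infF s * (v `^ alphaF * v `^ alphaF * expR (- (E1 * v `^ b))) by ring.
have -> : c * S * cF * cF * C2 * infF s * expR (- gamma_eps * v `^ b) =
    c * S * cF * cF * infF s * (C2 * expR (- gamma_eps * v `^ b)) by ring.
apply: ler_wpM2l; first by rewrite !mulr_ge0// ltW.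
rewrite vE.
have -> : - gamma_eps * v `^ b = (E1 - gamma_eps) * v `^ b + - (E1 * v `^ b) by ring.
by rewrite expRD mulrA ler_pM2r ?expR_gt0//; exact: hC2.
Qed.

Lemma late_bound_le : late_bound <= cF * 2 `^ alphaF * (1 + c * S) * cF * infF (rad `^ beta).
Proof.
have R0 : 0 < rad `^ beta by exact: powR_gt0.
have := F_le_infF R0 (lexx _) (lexx _) (lexx _) (lexx _).
rewrite divff ?gt_eqF// powR1 mulr1 => h.
rewrite /late_bound -[leRHS]mulrA; apply: ler_wpM2l h.
by rewrite !mulr_ge0 ?powR_ge0 ?addr_ge0 ?mulr_ge0// ltW.
Qed.

End core.

(** * Jointly measurable densities *)

(** Terms for unions and differences. Their encoding as trees makes them countable, so the ring of
    sets generated by a sequence can itself be enumerated as a sequence. *)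
Inductive ring_code :=
  | RingBase of nat | RingU of ring_code & ring_code | RingD of ring_code & ring_code.

Fixpoint ring_encode (c : ring_code) : GenTree.tree nat :=
  match c with
  | RingBase n => GenTree.Leaf n
  | RingU a b => GenTree.Node 0 [:: ring_encode a; ring_encode b]
  | RingD a b => GenTree.Node 1 [:: ring_encode a; ring_encode b]
  end.

Fixpoint ring_decode (t : GenTree.tree nat) : ring_code :=
  match t with
  | GenTree.Leaf n => RingBase n
  | GenTree.Node 0 [:: a; b] => RingU (ring_decode a) (ring_decode b)
  | GenTree.Node _ [:: a; b] => RingD (ring_decode a) (ring_decode b)
  | _ => RingBase 0
  end.

Lemma ring_encodeK : cancel ring_encode ring_decode.
Proof. by elim=> [n|a IHa b IHb|a IHa b IHb] //=; rewrite IHa IHb. Qed.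

Section countable_ring.
Context {T : Type}.
Implicit Type B : nat -> set T.

Fixpoint ring_set B (c : ring_code) : set T :=
  match c with
  | RingBase n => B n
  | RingU a b => ring_set B a `|` ring_set B b
  | RingD a b => ring_set B a `\` ring_set B b
  end.

Definition ring_enum B (n : nat) : set T :=
  ring_set B (ring_decode (odflt (GenTree.Leaf 0%N) (unpickle n))).

Lemma range_ring_enum B : range (ring_enum B) = range (ring_set B).
Proof.
apply/seteqP; split => _ [x _ <-]; first by eexists.
by exists (pickle (ring_encode x)) => //; rewrite /ring_enum pickleK/= ring_encodeK.
Qed.

Lemma setring_ring_enum B : setring (range (ring_enum B)).
Proof.
rewrite range_ring_enum; split.
- by exists (RingD (RingBase 0) (RingBase 0)) => //=; rewrite setDv.
- by move=> _ _ [a _ <-] [b _ <-]; exists (RingU a b).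
- by move=> _ _ [a _ <-] [b _ <-]; exists (RingD a b).
Qed.

Lemma ring_enum_base B n : range (ring_enum B) (B n).
Proof. by rewrite range_ring_enum; exists (RingBase n). Qed.

Lemma ring_enum_sub B (G : set (set T)) : setring G -> (forall n, G (B n)) ->
  forall n, G (ring_enum B n).
Proof.
move=> [_ GU GD] GB n; rewrite /ring_enum.
by elim: ring_decode => //= [a ? b ?|a ? b ?]; [exact: GU|exact: GD].
Qed.

End countable_ring.

Section separable_space.
Context {R : realType} {M : pmetricType R}.

Lemma mdist_ball_open (x : M) (r : R) : open (ball x r).
Proof. rewrite ballEmdist; exact: (open_lip_lt r (mdist_lip x)). Qed.

Lemma separable_dense_seq : separable M -> exists e : nat -> M,
  forall (x : M) (r : R), 0 < r -> exists n, mdist x (e n) < r.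
Proof.
move=> [D [/countable_injP[f finj] dD]].
exists (fun n => xget point [set x | D x /\ f x = n]) => x r r0.
have [y [xy Dy]] : (ball x r `&` D) !=set0.
  by apply: dD; [exists x; exact: ballxx|exact: mdist_ball_open].
exists (f y); case: xgetP => [z _ [Dz fz]|/(_ y)]; last by case.
have -> : z = y by apply: finj => //; rewrite inE.
by move: xy; rewrite ballEmdist.
Qed.

(** The ring is generated by the balls of radius 1 / (k + 1) around a dense sequence, together with
    the whole space, which turns the generated sigma-ring into a sigma-algebra. By the monotone
    class theorem, later arguments only have to treat monotone limits. *)
Lemma separable_countable_ring : separable M -> exists A : nat -> set (borel M),
  (forall n, measurable (A n)) /\ forall B, measurable B -> <<M range A >> B.
Proof.
move=> /separable_dense_seq[e he].
pose B n : set M := if n is n'.+1 then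
  if unpickle n' is Some ik then ball (e ik.1) (ik.2.+1%:R^-1 : R) else setT else setT.
have oB n : open (B n).
  by rewrite /B; case: n => [|n]; [exact: openT|case: unpickle => [ik|]; [exact: mdist_ball_open|exact: openT]].
exists (ring_enum B); have ringB := setring_ring_enum B.
have mB n : measurable (B n : set (borel M)) by exact: open_measurable_borel.
have BT : range (ring_enum B) setT by exact: (ring_enum_base B 0).
split => //.
- apply: (@ring_enum_sub _ B (measurable : set (set (borel M)))) => //.
  by split; [exact: measurable0|move=> *; exact: measurableU|move=> *; exact: measurableD].
move=> A mA; rewrite g_monotone_g_sigma_ring//.
have [sr0 srD srU] := @smallest_sigma_ring _ (range (ring_enum B)).
have srT := sub_g_sigma_ring BT.
move: A mA; apply: smallest_sub.
  split => // A; exact: srD.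
move=> O oO.
have -> : O = \bigcup_n (if pselect (B n `<=` O) then B n else set0).
  apply/seteqP; split => [x Ox|x [n _]]; last by case: pselect => // BO /BO.
  have /nbhs_ballP[r /= r0 rO] : nbhs x O by exact: open_nbhs_nbhs.
  have [k hk] : exists k : nat, (k.+1%:R^-1 : R) < r / 2.
    exists (Num.truncn (r / 2)^-1).
    rewrite invf_plt ?posrE ?divr_gt0 ?ltr0n//; exact: truncnS_gt.
  have [i hi] := he x (k.+1%:R^-1 : R) ltac:(by rewrite invr_gt0 ltr0n).
  exists (pickle (i, k)).+1 => //.
  have BE : B (pickle (i, k)).+1 = ball (e i) (k.+1%:R^-1 : R) by rewrite /B pickleK.
  have BO : B (pickle (i, k)).+1 `<=` O.
    rewrite BE => y; rewrite ballEmdist /= => iy.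
    apply: rO; rewrite ballEmdist /=; apply: (le_lt_trans (metric_triangle x (e i) y)).
    by rewrite [r]splitr; apply: ltrD; [exact: lt_trans hi hk|exact: lt_trans iy hk].
  case: pselect => // BO' /=.
  suff: B (pickle (i, k)).+1 x by [].
  by rewrite BE ballEmdist /= metric_sym.
apply: srU => n; case: pselect => //= ?.
by apply: sub_g_sigma_ring; exact: ring_enum_base.
Qed.

End separable_space.

(** * Convergence and countable dense subsets in L^1 *)

Section L1.
Context {d} {T : measurableType d} {R : realType} (mu : {measure set T -> \bar R}).
Local Open Scope ereal_scope.
Implicit Types f g h : T -> R.

Definition l1 f g : \bar R := \int[mu]_x (`|f x - g x|)%:E.

Lemma integrable_indic_lty A : measurable A -> mu A < +oo ->
  mu.-integrable setT (fun x => (\1_A x)%:E).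
Proof.
move=> mA Aoo; apply/integrableP; split.
  by apply/measurable_EFinP; exact: measurable_indic.
rewrite (eq_integral (fun x => (\1_A x)%:E)); last first.
  by move=> x _; rewrite gee0_abs// lee_fin.
by rewrite integral_indic// setIT.
Qed.

Lemma l1_ge0 f g : 0 <= l1 f g.
Proof. by apply: integral_ge0 => x _; rewrite lee_fin. Qed.

Lemma measurable_l1 f g : measurable_fun setT f -> measurable_fun setT g ->
  measurable_fun setT (fun x => (`|f x - g x|)%:E).
Proof.
move=> mf mg; apply/measurable_EFinP; apply: (@measurableT_comp _ _ _ _ _ _ (@Num.norm _ R)).
  exact: normr_measurable.
exact: measurable_funB.
Qed.

Lemma l1_triangle f g h : measurable_fun setT f -> measurable_fun setT g ->
  measurable_fun setT h -> l1 f h <= l1 f g + l1 g h.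
Proof.
move=> mf mg mh; rewrite /l1 -ge0_integralD//.
- apply: ge0_le_integral => //.
  + exact: measurable_l1.
  + by apply: emeasurable_funD; exact: measurable_l1.
  + by move=> x _; rewrite -EFinD lee_fin ler_distD.
- exact: measurable_l1.
- exact: measurable_l1.
Qed.

Lemma l1D f f' g g' : measurable_fun setT f -> measurable_fun setT g ->
  measurable_fun setT f' -> measurable_fun setT g' ->
  l1 (f \+ f')%R (g \+ g')%R <= l1 f g + l1 f' g'.
Proof.
move=> mf mg mf' mg'; rewrite /l1 -ge0_integralD//.
- apply: ge0_le_integral => //.
  + by apply: measurable_l1; exact: measurable_funD.
  + by apply: emeasurable_funD; exact: measurable_l1.
  + by move=> x _; rewrite -EFinD lee_fin /= opprD addrACA ler_normD.
- exact: measurable_l1.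
- exact: measurable_l1.
Qed.

(** The series of the |f - h_j| has a finite integral, hence a finite sum almost everywhere, and its
    terms tend to 0 there. *)
Lemma ae_cvg_l1 (C : R) f (h : nat -> T -> R) : (0 <= C)%R -> measurable_fun setT f ->
  (forall j, measurable_fun setT (h j)) ->
  (forall j, l1 f (h j) <= (C * 2 ^- j)%:E) ->
  {ae mu, forall x, h ^~ x @ \oo --> f x}.
Proof.
move=> C0 mf mh fh; pose u j x := (`|f x - h j x|)%:E.
have mu_ j : measurable_fun setT (u j) by exact: measurable_l1.
have u0 j x : 0 <= u j x by rewrite lee_fin.
have Iu : \int[mu]_x (\sum_(j <oo) u j x) < +oo.
  rewrite integral_nneseries//.
  apply: (@le_lt_trans _ _ (2 * C)%:E); last exact: ltry.
  apply: lime_le; first by apply: is_cvg_nneseries => n _ _; exact: l1_ge0.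
  apply: nearW => n; apply: (@le_trans _ _ (\sum_(0 <= j < n) (C * 2 ^- j)%:E)).
    by apply: lee_sum => j _; exact: fh.
  rewrite sumEFin lee_fin -mulr_sumr mulrC; apply: ler_wpM2r => //.
  by rewrite big_mkord; exact: sum_half_le.
have : mu.-integrable setT (fun x => \sum_(j <oo) u j x).
  apply/integrableP; split.
    by apply: ge0_emeasurable_sum => // j x _ _; exact: u0.
  rewrite (_ : \int[mu]_x _ = \int[mu]_x (\sum_(j <oo) u j x))//.
  by apply: eq_integral => x _; rewrite gee0_abs// nneseries_ge0// => j _ _; exact: u0.
move=> /(integrable_ae measurableT); apply: filterS => x /(_ I) fx.
have tail : \sum_(n <= k <oo) u k x @[n --> \oo] --> 0.
  have := @nneseries_tail_cvg _ (u ^~ x) xpredT; apply => //.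
  by rewrite ltey_eq fx.
have u_0 : u j x @[j --> \oo] --> 0.
  apply: (@squeeze_cvge _ _ _ _ (cst 0) _ (fun n => \sum_(n <= k <oo) u k x)) => //.
  - apply: nearW => n; rewrite u0/=.
    have := @nneseries_lim_ge R (u ^~ x) xpredT n n.+1 (fun k _ _ => u0 k x).
    by rewrite big_nat1.
  - exact: cvg_cst.
have {}u_0 : (`|f x - h j x|)%R @[j --> \oo] --> 0%R by move/fine_cvg : u_0.
apply/cvgrPdist_lt => e e0; move/cvgrPdist_lt : u_0 => /(_ e e0).
by apply: filterS => j; rewrite sub0r normrN normr_id.
Qed.

End L1.

Section approximation.
Context {d} {T : measurableType d} {R : realType} (mu : {sigma_finite_measure set T -> \bar R}).
Local Open Scope ereal_scope.
Variable A_ : nat -> set T.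
Hypotheses (mA_ : forall n, measurable (A_ n))
  (genA : forall B, measurable B -> <<M range A_>> B).

Lemma monotone_ring_ind (Q : set T -> Prop) : (forall n, Q (A_ n)) ->
  (forall F : (set T)^nat, nondecreasing_seq F -> (forall n, measurable (F n)) ->
    (forall n, Q (F n)) -> Q (\bigcup_n F n)) ->
  (forall F : (set T)^nat, nonincreasing_seq F -> (forall n, measurable (F n)) ->
    (forall n, Q (F n)) -> Q (\bigcap_n F n)) ->
  forall B, measurable B -> Q B.
Proof.
move=> QA QU QI B mB.
suff: <<M range A_>> `<=` [set B | measurable B /\ Q B] by move=> /(_ B (genA mB))[].
apply: smallest_sub; last by move=> _ [n _ <-]; split.
split => F Fmon FQ; have mF n := (FQ n).1; have {}FQ n := (FQ n).2.
- by split; [exact: bigcup_measurable|exact: QU].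
- by split; [exact: bigcapT_measurable|exact: QI].
Qed.

Definition symdiff (A B : set T) := (A `\` B) `|` (B `\` A).

Lemma symdiff_triangle A B C : symdiff A C `<=` symdiff A B `|` symdiff B C.
Proof.
move=> x [[Ax nCx]|[Cx nAx]]; have [Bx|nBx] := pselect (B x).
- by right; left.
- by left; left.
- by left; right.
- by right; right.
Qed.

Lemma measurable_symdiff A B : measurable A -> measurable B -> measurable (symdiff A B).
Proof. by move=> mA mB; apply: measurableU; exact: measurableD. Qed.

(** A monotone limit is replaced by one of its terms at the cost of e / 2. The set F of finite
    measure provides the continuity from above that this step uses. *)
Lemma symdiff_approx (F : set T) B : measurable F -> mu F < +oo -> measurable B ->
  forall e : R, (0 < e)%R -> exists i, mu (symdiff B (A_ i) `&` F) < e%:E.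
Proof.
move=> mF Foo; move: B; apply: monotone_ring_ind.
- move=> n e e0; exists n.
  by rewrite /symdiff setDv setU0 set0I measure0 lte_fin.
- move=> G Gnd mG IH e e0.
  have mU : measurable (\bigcup_n G n) by exact: bigcup_measurable.
  have e20 : (0 < e / 2)%R by rewrite divr_gt0.
  have [n hn] : exists n, mu (symdiff (\bigcup_n G n) (G n) `&` F) < (e / 2)%:E.
    have mD n : measurable (symdiff (\bigcup_n G n) (G n) `&` F).
      by apply: measurableI => //; exact: measurable_symdiff.
    have I0 : \bigcap_n (symdiff (\bigcup_n G n) (G n) `&` F) = set0.
      apply/seteqP; split => // x H.
      have [k _ Gx] : (\bigcup_n G n) x.
        by have [[[]//|[Gx _]] _] := H 0%N I; exists 0%N.
      have [[[_ nGx]|[_ nUx]] _] := H k I; first exact: nGx.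
      by apply: nUx; exists k.
    have := @nonincreasing_cvg_mu _ _ _ mu (fun n => symdiff (\bigcup_n G n) (G n) `&` F).
    rewrite I0 measure0 => /(_ _ mD measurable0) H.
    have /fine_cvgP[_ /cvgrPdist_lt/(_ _ e20)] : (mu \o (fun n => symdiff (\bigcup_n G n) (G n) `&` F)) @ \oo --> 0.
      apply: H.
      - by apply: le_lt_trans Foo; apply: le_measure; rewrite ?inE.
      - move=> n m nm; apply/subsetPset => x [[[Ux nGx]|[Gx nUx]] Fx]; last by exfalso; apply: nUx; exists m.
        split => //; left; split => // Gnx; apply: nGx.
        by have /subsetPset := Gnd _ _ nm; exact.
    move=> [N _ /(_ N (leqnn _))]; rewrite sub0r normrN ger0_norm ?fine_ge0//= => h.
    exists N; rewrite -[X in X < _]fineK ?lte_fin//.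
    by rewrite ge0_fin_numE//; apply: le_lt_trans Foo; apply: le_measure; rewrite ?inE.
  have [i hi] := IH n _ e20; exists i.
  apply: (@le_lt_trans _ _ (mu (symdiff (\bigcup_n G n) (G n) `&` F `|` symdiff (G n) (A_ i) `&` F))).
    apply: le_measure; rewrite ?inE.
    + by apply: measurableI => //; exact: measurable_symdiff.
    + by apply: measurableU; apply: measurableI => //; exact: measurable_symdiff.
    + by rewrite -setIUl; apply: setSI; exact: symdiff_triangle.
  apply: (le_lt_trans (measureU2 _ _ _)).
  + by apply: measurableI => //; exact: measurable_symdiff.
  + by apply: measurableI => //; exact: measurable_symdiff.
  by rewrite [e]splitr EFinD lteD.
- move=> G Gni mG IH e e0.
  have mU : measurable (\bigcap_n G n) by exact: bigcapT_measurable.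
  have e20 : (0 < e / 2)%R by rewrite divr_gt0.
  have [n hn] : exists n, mu (symdiff (\bigcap_n G n) (G n) `&` F) < (e / 2)%:E.
    have mD n : measurable (symdiff (\bigcap_n G n) (G n) `&` F).
      by apply: measurableI => //; exact: measurable_symdiff.
    have I0 : \bigcap_n (symdiff (\bigcap_n G n) (G n) `&` F) = set0.
      apply/seteqP; split => // x H.
      have [[[Ix nGx]|[_ nIx]] _] := H 0%N I; first by apply: nGx; exact: Ix.
      apply: (nIx) => m _; have [[[Ix _]|[Gx _]] _] := H m I => //.
    have := @nonincreasing_cvg_mu _ _ _ mu (fun n => symdiff (\bigcap_n G n) (G n) `&` F).
    rewrite I0 measure0 => /(_ _ mD measurable0) H.
    have /fine_cvgP[_ /cvgrPdist_lt/(_ _ e20)] : (mu \o (fun n => symdiff (\bigcap_n G n) (G n) `&` F)) @ \oo --> 0.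
      apply: H.
      - by apply: le_lt_trans Foo; apply: le_measure; rewrite ?inE.
      - move=> n m nm; apply/subsetPset => x [[[Ix nGx]|[Gx nIx]] Fx]; first by exfalso; apply: nGx; exact: Ix.
        split => //; right; split => //.
        by have /subsetPset := Gni _ _ nm; exact.
    move=> [N _ /(_ N (leqnn _))]; rewrite sub0r normrN ger0_norm ?fine_ge0//= => h.
    exists N; rewrite -[X in X < _]fineK ?lte_fin//.
    by rewrite ge0_fin_numE//; apply: le_lt_trans Foo; apply: le_measure; rewrite ?inE.
  have [i hi] := IH n _ e20; exists i.
  apply: (@le_lt_trans _ _ (mu (symdiff (\bigcap_n G n) (G n) `&` F `|` symdiff (G n) (A_ i) `&` F))).
    apply: le_measure; rewrite ?inE.
    + by apply: measurableI => //; exact: measurable_symdiff.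
    + by apply: measurableU; apply: measurableI => //; exact: measurable_symdiff.
    + by rewrite -setIUl; apply: setSI; exact: symdiff_triangle.
  apply: (le_lt_trans (measureU2 _ _ _)).
  + by apply: measurableI => //; exact: measurable_symdiff.
  + by apply: measurableI => //; exact: measurable_symdiff.
  by rewrite [e]splitr EFinD lteD.
Qed.


Variable F_ : nat -> set T.
Hypotheses (mF_ : forall m, measurable (F_ m)) (F_oo : forall m, mu (F_ m) < +oo)
  (F_nd : nondecreasing_seq F_) (F_T : \bigcup_m F_ m = setT).

(** Rational coefficients and sets cut by an exhaustion of finite measure: a countable family of
    integrable functions. *)
Definition step_fun (s : seq (rat * nat * nat)) (x : T) : R :=
  (\sum_(c <- s) ratr c.1.1 * \1_(A_ c.1.2 `&` F_ c.2) x)%R.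

Let mAF i m : measurable (A_ i `&` F_ m).
Proof. exact: measurableI. Qed.

Lemma measurable_step_fun s : measurable_fun setT (step_fun s).
Proof.
by apply: measurable_sum => c; apply: measurable_funM.
Qed.

Lemma integrable_step_fun s : mu.-integrable setT (EFin \o step_fun s).
Proof.
rewrite (_ : EFin \o _ = (fun x => \sum_(c <- s) (ratr c.1.1 * \1_(A_ c.1.2 `&` F_ c.2) x)%:E)); last first.
  by apply/funext => x /=; rewrite /step_fun -sumEFin.
apply: integrable_sum => // c _ /=.
rewrite (_ : (fun x => _) = (fun x => (ratr c.1.1)%:E * (\1_(A_ c.1.2 `&` F_ c.2) x)%:E)).
  apply: (@integrableZl _ _ _ mu _ measurableT); apply: integrable_indic_lty => //.
  by apply: le_lt_trans (F_oo c.2); apply: le_measure; rewrite ?inE.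
by apply/funext.
Qed.

Definition step_approx (f : T -> R) := measurable_fun setT f /\
  forall e : R, (0 < e)%R -> exists s, l1 mu f (step_fun s) < e%:E.

Lemma step_approx_closed (f : T -> R) : measurable_fun setT f ->
  (forall e : R, (0 < e)%R -> exists h, step_approx h /\ l1 mu f h < e%:E) ->
  step_approx f.
Proof.
move=> mf H; split => // e e0; have e20 : (0 < e / 2)%R by rewrite divr_gt0.
have [h [[mh /(_ _ e20)[s hs]] fh]] := H _ e20; exists s.
apply: le_lt_trans (l1_triangle mu mf mh (measurable_step_fun s)) _.
by rewrite [e]splitr EFinD lteD.
Qed.

Lemma step_approxD f g : step_approx f -> step_approx g -> step_approx (f \+ g)%R.
Proof.
move=> [mf Hf] [mg Hg]; split; first exact: measurable_funD.
move=> e e0; have e20 : (0 < e / 2)%R by rewrite divr_gt0.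
have [s hs] := Hf _ e20; have [r hr] := Hg _ e20; exists (s ++ r).
rewrite (_ : step_fun (s ++ r) = (step_fun s \+ step_fun r)%R); last first.
  by apply/funext => x; rewrite /step_fun big_cat.
apply: le_lt_trans (l1D mu mf (measurable_step_fun s) mg (measurable_step_fun r)) _.
by rewrite [e]splitr EFinD lteD.
Qed.

Lemma step_approxZ (k : R) f : (0 < k)%R -> step_approx f -> step_approx (fun x => k * f x)%R.
Proof.
move=> k0 [mf Hf]; apply: step_approx_closed.
  exact: measurable_funM.
move=> e e0; have [s hs] := Hf _ (divr_gt0 e0 k0).
exists (fun x => k * step_fun s x)%R; split; last first.
  rewrite /l1 (eq_integral (fun x => k%:E * (`|f x - step_fun s x|)%:E)); last first.
    by move=> x _; rewrite -mulrBr normrM (gtr0_norm k0).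
  rewrite ge0_integralZl_EFin//; [|by apply: measurable_l1 => //; exact: measurable_step_fun|exact: ltW].
  by rewrite muleC -lte_pdivlMr.
have mks : measurable_fun setT (fun x => k * step_fun s x)%R.
  by apply: measurable_funM => //; exact: measurable_step_fun.
split => // {hs} {}e {}e0.
have Is : l1 mu (step_fun s) (cst 0)%R < +oo.
  have /integrableP[_] := integrable_step_fun s.
  by congr (_ < _); apply: eq_integral => x _ /=; rewrite subr0.
have Is0 := l1_ge0 mu (step_fun s) (cst 0)%R.
pose L := fine (l1 mu (step_fun s) (cst 0)%R).
have LE : l1 mu (step_fun s) (cst 0)%R = L%:E by rewrite fineK// ge0_fin_numE.
have L0 : (0 <= L)%R by rewrite fine_ge0.
have L10 : (0 < L + 1)%R by rewrite ltr_wpDl.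
(* The real factor k is replaced by a nearby rational; the denominator is L + 1 because the norm L
   may be 0. *)
have [q] := @rat_in_itvoo R (k - e / (L + 1))%R k ltac:(by rewrite ltrBlDr ltrDl divr_gt0).
rewrite in_itv/= => /andP[q1 q2].
exists [seq ((q * c.1.1)%R, c.1.2, c.2) | c <- s].
have -> : step_fun [seq ((q * c.1.1)%R, c.1.2, c.2) | c <- s] = (fun x => ratr q * step_fun s x)%R.
  apply/funext => x; rewrite /step_fun big_map mulr_sumr; apply: eq_bigr => c _ /=.
  by rewrite rmorphM/= mulrA.
rewrite /l1 (eq_integral (fun x => (k - ratr q)%:E * (`|step_fun s x - 0|)%:E)); last first.
  by move=> x _; rewrite -mulrBl normrM subr0 (gtr0_norm (_ : 0 < k - ratr q)%R)// subr_gt0.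
have mm : measurable_fun setT (fun x => `|step_fun s x - 0|%:E).
  by apply: (@measurable_l1 _ _ _ (step_fun s) (cst 0)%R) => //; exact: measurable_step_fun.
rewrite ge0_integralZl_EFin//; last by rewrite subr_ge0 ltW.
rewrite -[X in _ * X]/(l1 mu (step_fun s) (cst 0)%R) LE -EFinM lte_fin.
have kq : (0 < k - ratr q)%R by rewrite subr_gt0.
apply: (@lt_le_trans _ _ ((k - ratr q) * (L + 1))%R).
  by rewrite ltr_pM2l// ltrDl.
by rewrite -ler_pdivlMr// lerBlDl -lerBlDr ltW.
Qed.

Lemma step_approx_cvg (h : nat -> T -> R) (f : T -> R) : measurable_fun setT f ->
  mu.-integrable setT (EFin \o f) -> (forall n, step_approx (h n)) ->
  (forall n x, 0 <= h n x <= f x)%R -> (forall x, h ^~ x @ \oo --> f x) ->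
  step_approx f.
Proof.
move=> mf If hh h0 hf; apply: step_approx_closed => // e e0.
have hfn n x : `|(EFin \o h n) x| <= (EFin \o f) x.
  by have /andP[? ?] := h0 n x; rewrite lee_fin ger0_norm.
have [_ H _] : [/\ mu.-integrable setT (EFin \o f),
    \int[mu]_x `|(EFin \o h n) x - (EFin \o f) x| @[n --> \oo] --> 0 &
    \int[mu]_x (EFin \o h n) x @[n --> \oo] --> \int[mu]_x (EFin \o f) x].
  apply: (dominated_convergence measurableT _ _ _ If).
  - by move=> n; apply/measurable_EFinP; exact: (hh n).1.
  - exact/measurable_EFinP.
  - by apply: aeW => x _; apply: cvg_EFin; [exact: nearW|exact: hf].
  - by apply: aeW => x n _; exact: hfn.
move/fine_cvgP : H => [[N1 _ N1P] /cvgrPdist_lt/(_ _ e0)[N2 _ N2P]].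
pose n := maxn N1 N2; exists (h n); split => //.
have -> : l1 mu f (h n) = \int[mu]_x `|(EFin \o h n) x - (EFin \o f) x|.
  by apply: eq_integral => x _ /=; rewrite distrC.
have /= fin := N1P n (leq_maxl _ _).
have /= := N2P n (leq_maxr _ _).
rewrite sub0r normrN ger0_norm.
  by rewrite -lte_fin fineK.
by rewrite fine_ge0// integral_ge0.
Qed.

Lemma step_approx_indic B : measurable B -> mu B < +oo -> step_approx (\1_B).
Proof.
move=> mB Boo; apply: (@step_approx_cvg (fun m => \1_(B `&` F_ m))) => //.
- exact: integrable_indic_lty.
- move=> m; split; first by apply: measurable_indic; exact: measurableI.
  move=> e e0; have [i hi] := symdiff_approx (mF_ m) (F_oo m) mB e0.
  exists [:: (1%R, i, m)].
  rewrite /l1 (eq_integral (fun x => (\1_(symdiff B (A_ i) `&` F_ m) x)%:E)); last first.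
    move=> x _; rewrite /step_fun big_seq1/= rmorph1 mul1r !indicE.
    congr EFin; rewrite /symdiff !(in_setI,in_setU,in_setD).
    by case: (x \in B); case: (x \in A_ i); case: (x \in F_ m); rewrite /= ?subrr ?subr0 ?sub0r ?normrN ?normr1 ?normr0.
  rewrite integral_indic// ?setIT//.
  by apply: measurableI => //; exact: measurable_symdiff.
- move=> n x; rewrite !indicE in_setI; case: (x \in B); case: (x \in F_ n) => /=; rewrite ?lexx ?ler01//.
- move=> x; have [m _ Fx] : (\bigcup_m F_ m) x by rewrite F_T.
  apply: cvg_near_cst; exists m => // n /= mn.
  rewrite !indicE in_setI; suff -> : x \in F_ n by rewrite andbT.
  by rewrite inE; have /subsetPset := F_nd mn; exact.
Qed.

Lemma step_approx_integrable (f : T -> R) : measurable_fun setT f -> (forall x, 0 <= f x)%R ->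
  mu.-integrable setT (EFin \o f) -> step_approx f.
Proof.
move=> mf f0 If.
(* Finiteness and integrability are premises of the property proved by induction, to be passed down
   to the summands and to the approximating functions. *)
suff H (g : T -> \bar R) : measurable_fun setT g -> (forall x, 0 <= g x) ->
    (forall x, g x \is a fin_num) -> mu.-integrable setT g -> step_approx (fine \o g).
  have -> : f = fine \o (EFin \o f) by apply/funext.
  by apply: H => //; exact/measurable_EFinP.
move=> mg g0; move: g mg g0; apply: ge0_measurable_fun_ind.
- move=> B mB _ IB; apply: step_approx_indic => //.
  have /integrableP[_] := IB; congr (_ < _).
  rewrite (eq_integral (fun x => (\1_B x)%:E)); last by move=> x _; rewrite gee0_abs ?lee_fin.
  by rewrite integral_indic// setIT.
- move=> k f1 f2 k0 mf1 mf2 f10 f20 H1 H2 fin Ik.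
  (* For k = 0 the sum gives no information on [f1], which may be infinite or fail to be
     integrable. *)
  move: k0; rewrite le_eqVlt => /predU1P[k0|k0].
    have E : (fun x => k%:E * f1 x + f2 x) = f2.
      by apply/funext => x; rewrite -k0 mul0e add0e.
    rewrite E in Ik *; apply: H2 => // x.
    by move: (fin x); rewrite -k0 mul0e add0e.
  have fin1 x : f1 x \is a fin_num.
    move: (fin x) (f10 x) (f20 x); case: (f1 x) => //; rewrite gt0_muley ?lte_fin//.
    by case: (f2 x).
  have fin2 x : f2 x \is a fin_num.
    by move: (fin x) (f20 x); rewrite -(fineK (fin1 x)) -EFinM; case: (f2 x).
  have I2 : mu.-integrable setT f2.
    apply: le_integrable Ik => // x _; rewrite gee0_abs// gee0_abs; last first.
      by rewrite adde_ge0// mule_ge0// lee_fin ltW.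
    by rewrite leeDr// mule_ge0// lee_fin ltW.
  have I1 : mu.-integrable setT f1.
    have : mu.-integrable setT (fun x => k%:E * f1 x).
      apply: le_integrable Ik => //; first exact: measurable_funeM.
      move=> x _; have k1 : 0 <= k%:E * f1 x by rewrite mule_ge0// lee_fin ltW.
      by rewrite gee0_abs// gee0_abs ?adde_ge0// leeDl.
    move=> Ikf1; have := integrableZl measurableT (k^-1)%R Ikf1.
    apply: eq_integrable => // x _ /=.
    by rewrite muleA -EFinM mulVf ?mul1e// gt_eqF.
  have := step_approxD (step_approxZ k0 (H1 fin1 I1)) (H2 fin2 I2).
  congr step_approx; apply/funext => x /=.
  by rewrite -(fineK (fin1 x)) -(fineK (fin2 x)).
- move=> h g mh h0 hnd hg H fin Ig.
  have mg : measurable_fun setT g by case/integrableP: Ig.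
  have hle n x : h n x <= g x.
    have <- := cvg_lim _ (hg x) => //.
    apply: lime_ge; first by apply/cvg_ex; eexists; exact: hg.
    by exists n => // m /= nm; exact: hnd.
  have finh n x : h n x \is a fin_num.
    rewrite ge0_fin_numE//; apply: le_lt_trans (hle n x) _.
    by rewrite -ge0_fin_numE// (le_trans _ (hle n x)).
  apply: (@step_approx_cvg (fun n => fine \o h n)).
  + by apply: measurableT_comp => //; exact: measurable_fine.
  + by move: Ig; apply: eq_integrable => // x _ /=; rewrite fineK.
  + move=> n; apply: H => //.
    apply: le_integrable Ig => // x _; rewrite gee0_abs// gee0_abs//.
    exact: le_trans (hle n x).
  + by move=> n x /=; rewrite fine_ge0//= fine_le.
  + by move=> x; apply: fine_cvg; rewrite fineK.
Qed.

End approximation.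

(** * Densities selected measurably in a parameter *)

Section joint_density.
Context {d d'} {T : measurableType d} {S : measurableType d'} {R : realType}
  (mu : {sigma_finite_measure set T -> \bar R}).
Local Open Scope ereal_scope.

Lemma integral_cvg_set (h : T -> \bar R) (G : (set T)^nat) (G' : set T) :
  mu.-integrable setT h -> (forall x, h x \is a fin_num) ->
  (forall n, measurable (G n)) -> measurable G' ->
  (forall x, \forall n \near \oo, G n x <-> G' x) ->
  \int[mu]_(x in G n) h x @[n --> \oo] --> \int[mu]_(x in G') h x.
Proof.
move=> Ih fh mG mG' GG'; have mh : measurable_fun setT h by case/integrableP: Ih.
rewrite integral_mkcond; under eq_fun do rewrite integral_mkcond.
have [//|||||_ _] := @dominated_convergence _ _ _ mu setT measurableT
  (fun n => h \_ (G n)) (h \_ G') (abse \o h).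
- by move=> n; apply/(measurable_restrictT _ (mG n)); exact: measurable_funTS.
- by apply/(measurable_restrictT _ mG'); exact: measurable_funTS.
- apply: aeW => x _; apply: cvg_near_cst; apply: filterS (GG' x) => n Gx.
  by rewrite !patchE; congr (if _ then _ else _); apply/idP/idP; rewrite !inE; apply Gx.
- exact: integrable_abse.
- apply: aeW => x n _; rewrite patchE /=; case: ifP => // _.
  by rewrite abse0.
exact.
Qed.

(** Joint measurability is free when the parameter acts only through a measurable index in a
    countable set: the preimage is a countable union of rectangles. *)
Lemma measurable_select d2 (U : measurableType d2) (k : S -> nat) (G : nat -> T -> U) :
  (forall n, measurable (k @^-1` [set n])) -> (forall n, measurable_fun setT (G n)) ->
  measurable_fun setT (fun z : S * T => G (k z.1) z.2).
Proof.
move=> mk mG _ B mB; rewrite setTI.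
rewrite (_ : _ @^-1` _ = \bigcup_n ((k @^-1` [set n]) `*` (G n @^-1` B))).
  apply: bigcup_measurable => n _; apply: measurableX => //.
  by rewrite -[X in measurable X]setTI; exact: mG.
apply/seteqP; split => [[s x] /= Bx|[s x] [n _ [/= <-]]//].
by exists (k s).
Qed.

Variable A_ : nat -> set T.
Hypotheses (mA_ : forall n, measurable (A_ n))
  (genA : forall B, measurable B -> <<M range A_>> B).

(** The bound on the A_i extends to all measurable sets by monotone class. Applied to {f >= g} and
    to its complement it controls both parts of f - g, whence the factor 2. *)
Lemma l1_le_sets (C : R) (f g : T -> R) :
  mu.-integrable setT (EFin \o f) -> mu.-integrable setT (EFin \o g) ->
  (forall i, `|\int[mu]_(x in A_ i) (f x - g x)%:E| <= C%:E) ->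
  l1 mu f g <= (C * 2)%:E.
Proof.
move=> If Ig fg.
have Ih : mu.-integrable setT (fun x => (f x - g x)%:E).
  by have := integrableB measurableT If Ig.
have mh : measurable_fun setT (fun x => (f x - g x)%:E) by case/integrableP: Ih.
have mh' : measurable_fun setT (fun x => f x - g x)%R by exact/measurable_EFinP.
have all B : measurable B -> `|\int[mu]_(x in B) (f x - g x)%:E| <= C%:E.
  have lim (G : (set T)^nat) G' : (forall n, measurable (G n)) -> measurable G' ->
      (forall x, \forall n \near \oo, G n x <-> G' x) ->
      (forall n, `|\int[mu]_(x in G n) (f x - g x)%:E| <= C%:E) ->
      `|\int[mu]_(x in G') (f x - g x)%:E| <= C%:E.
    move=> mG mG' GG' GC.
    have H : `|\int[mu]_(x in G n) (f x - g x)%:E| @[n --> \oo] --> `|\int[mu]_(x in G') (f x - g x)%:E|.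
      by apply: cvg_abse; exact: integral_cvg_set.
    rewrite -(cvg_lim _ H)//; apply: lime_le; last exact: nearW.
    by apply/cvg_ex; eexists; exact: H.
  move: B; apply: (monotone_ring_ind mA_ genA) => //.
  - move=> G Gnd mG; apply: lim => //; first exact: bigcup_measurable.
    move=> x; have [[n _ Gx]|nG] := pselect ((\bigcup_n G n) x).
      exists n => // m /= nm; split => [?|_]; first by exists m.
      by have /subsetPset := Gnd _ _ nm; exact.
    by apply: nearW => n; split => // Gx; exists n.
  - move=> G Gni mG; apply: lim => //; first exact: bigcapT_measurable.
    move=> x; have [IG|nI] := pselect ((\bigcap_n G n) x).
      by apply: nearW => n; split => // _; exact: IG.
    have [n nG] : exists n, ~ G n x.
      by apply/existsNP => H; apply: nI => n _; exact: H.
    exists n => // m /= nm; split => [Gx|/nI//]; exfalso; apply: nG.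
    by have /subsetPset := Gni _ _ nm; exact.
pose P := [set x | 0 <= f x - g x]%R.
have mP : measurable P.
  have -> : P = setT `&` (fun x => f x - g x)%R @^-1` `[0%R, +oo[%classic.
    by rewrite setTI; apply/seteqP; split => x; rewrite /P /= in_itv/= andbT.
  exact: mh'.
have mabs : measurable_fun setT (fun x => (`|f x - g x|)%:E).
  by apply/measurable_EFinP; exact: measurableT_comp.
have mCP : measurable (~` P) by exact: measurableC.
rewrite /l1 -(setUv P) integral_setU//=; last 2 first.
- by rewrite setUv.
- by apply/disj_setPCl.
rewrite mulr2n mulrDr mulr1 EFinD; apply: leeD.
- apply: le_trans (all P mP); apply: le_trans (lee_abs _).
  rewrite le_eqVlt; apply/orP; left; apply/eqP; apply: eq_integral => x.
  by rewrite inE => Px; rewrite ger0_norm.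
- apply: le_trans (all _ mCP).
  rewrite [X in _ <= `|X|](eq_integral (fun x => - (`|f x - g x|)%:E)).
    by rewrite integral_ge0N// abseN; exact: lee_abs.
  move=> x; rewrite inE /P /= => /negP; rewrite -ltNge => Px.
  by rewrite ltr0_norm// opprK.
Qed.

Section family.
Variables (K : S -> set T -> \bar R) (D : set S).
Hypothesis mK : forall A, measurable A -> measurable_fun setT (K ^~ A).
Hypothesis hK : forall s, D s -> exists f : T -> \bar R,
  [/\ forall x, 0 <= f x, forall x, f x \is a fin_num, mu.-integrable setT f &
      forall A, measurable A -> K s A = \int[mu]_(x in A) f x].

(* The j-th approximation is the first step function whose integrals over all A_i
   are 2^-j-close to those of the density; this condition is measurable in s and
   bounds the L^1 distance by 2 * 2^-j. *)
Theorem joint_density : exists p : S * T -> R,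
  [/\ measurable_fun setT p, forall z, (0 <= p z)%R &
      forall s A, D s -> measurable A -> K s A = \int[mu]_(x in A) (p (s, x))%:E].
Proof.
have [F FT Ffin] := sigma_finiteT mu.
pose F_ m := \big[setU/set0]_(i < m) F i.
have mF_ m : measurable (F_ m) by apply: bigsetU_measurable => i _; exact: (Ffin i).1.
have F_oo m : mu (F_ m) < +oo.
  apply: (@le_lt_trans _ _ (\sum_(i < m) mu (F i))).
    by apply: Boole_inequality => i _; exact: (Ffin i).1.
  by apply: lte_sum_pinfty => i _; exact: (Ffin i).2.
have F_nd : nondecreasing_seq F_.
  by move=> m n mn; apply/subsetPset; exact: subset_bigsetU.
have F_T : \bigcup_m F_ m = setT.
  apply/seteqP; split => // x; rewrite FT => -[m _ Fx].
  exists m.+1 => //; rewrite /F_ big_ord_recr; by right.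
pose gs n : T -> R := step_fun A_ F_ (odflt [::] (unpickle n)).
have mgs n : measurable_fun setT (gs n) by exact: measurable_step_fun.
have Igs n : mu.-integrable setT (EFin \o gs n) by exact: integrable_step_fun.
have gsE s : exists n, gs n = step_fun A_ F_ s by exists (pickle s); rewrite /gs pickleK.
pose close j n := [set s | forall i,
  `|K s (A_ i) - \int[mu]_(x in A_ i) (gs n x)%:E| <= (2 ^- j)%:E].
have mclose j n : measurable (close j n).
  rewrite (_ : close j n = \bigcap_i [set s |
    `|K s (A_ i) - \int[mu]_(x in A_ i) (gs n x)%:E| <= (2 ^- j)%:E]); last first.
    by apply/seteqP; split => s H i; [move=> _; exact: H|exact: H].
  apply: bigcapT_measurable => i.
  rewrite -[X in measurable X]setTI; apply: measurable_lee => //.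
  apply: measurableT_comp => //; apply: emeasurable_funB => //; exact: mK.
pose isleast j n := close j n `&` \bigcap_m [set s | (m < n)%N -> ~ close j m s].
(* The default 0 is used only where no index is close, which does not happen for s in D. *)
pose k j s : nat := xget 0%N [set n | isleast j n s].
have least_uniq j s n m : isleast j n s -> isleast j m s -> n = m.
  move=> [cn ln] [cm lm]; apply/eqP; rewrite eqn_leq; apply/andP; split; rewrite leqNgt; apply/negP.
    by move=> mn; exact: (ln m I mn).
  by move=> nm; exact: (lm n I nm).
have misleast j n : measurable (isleast j n).
  apply: measurableI => //; apply: bigcapT_measurable => m.
  have [mn|nm] := boolP (m < n)%N.
    rewrite (_ : [set s | _] = ~` close j m); first exact: measurableC.
    by apply/seteqP; split => [s /(_ isT)|s ns _].
  by rewrite (_ : [set s | _] = setT)//; apply/seteqP; split.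
have mk j n : measurable (k j @^-1` [set n]).
  rewrite (_ : _ @^-1` _ = isleast j n `|` (if n == 0%N then ~` \bigcup_m isleast j m else set0)).
    apply: measurableU => //; case: ifP => // _; apply: measurableC.
    exact: bigcup_measurable.
  apply/seteqP; split => [s /=|s [|]].
  - rewrite /k; case: xgetP => [m -> /= ls <-|nls <-]; first by left.
    by right; rewrite eqxx => -[m _ /nls].
  - rewrite /= /k => ls; case: xgetP => [m _ ms|/(_ n)//]; exact: (least_uniq j s).
  - case: eqP => // -> nls; rewrite /= /k; case: xgetP => // m _ ms; exfalso.
    by apply: nls; exists m.
have kclose j s : (exists n, close j n s) -> close j (k j s) s.
  move=> [n cn]; have : exists n, `[< close j n s >] by exists n; apply/asboolP.
  move=> ex; pose n0 := ex_minn ex.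
  have ln0 : isleast j n0 s.
    rewrite /n0; case: ex_minnP => m /asboolP cm minm; split => // l _ /= lm cl.
    by have /minm := asboolT cl; rewrite leqNgt lm.
  by rewrite /k; case: xgetP => [m -> []//|/(_ _ ln0)].
pose h j (z : S * T) := gs (k j z.1) z.2.
have mh j : measurable_fun setT (h j) by exact: measurable_select.
(* The upper limit exists everywhere and is measurable. The maximum with 0 and [fine] make [p]
   nonnegative and real, and change nothing where the sequence converges to the given density. *)
pose p z := fine (maxe 0 (limn_esup (fun j => (h j z)%:E))).
have mp : measurable_fun setT p.
  apply: measurableT_comp => //.
  apply: measurable_maxe => //; apply: measurable_fun_limn_esup => j.
  exact/measurable_EFinP.
exists p; split => //.
- by move=> z; rewrite fine_ge0// le_max lexx.
move=> s A Ds mA; have [f [f0 ffin If Kf]] := hK Ds.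
rewrite Kf//.
have mf : measurable_fun setT f by case/integrableP: If.
pose f' := fine \o f; have f'E : EFin \o f' = f by apply/funext => x /=; rewrite fineK.
have mf' : measurable_fun setT f' by apply: measurableT_comp.
have If' : mu.-integrable setT (EFin \o f') by rewrite f'E.
have KB B n : measurable B -> K s B - \int[mu]_(x in B) (gs n x)%:E = \int[mu]_(x in B) (f' x - gs n x)%:E.
  move=> mB; rewrite Kf// -f'E -integralB//.
  - exact: integrableS If'.
  - exact: integrableS (Igs n).
have exclose j : exists n, close j n s.
  have [_ /(_ (2 ^- j)%R)] := step_approx_integrable mA_ genA mF_ F_oo F_nd F_T mf'
     (fun x => fine_ge0 (f0 x)) If'.
  move=> /(_ ltac:(by rewrite invr_gt0 exprn_gt0))[l].
  have [n <-] := gsE l => fn; exists n => i; rewrite KB//.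
  apply: (le_trans (le_abse_integral _ _ _)) => //.
    by apply/measurable_EFinP; apply: measurable_funTS; exact: measurable_funB.
  apply: le_trans (ltW fn); apply: ge0_subset_integral => //.
  exact: measurable_l1.
have cl j := kclose j s (exclose j).
have fl1 j : l1 mu f' (fun x => h j (s, x)) <= (2 * 2 ^- j)%:E.
  rewrite mulrC; apply: l1_le_sets => //; first exact: (Igs (k j s)).
  by move=> i; have := cl j i; rewrite KB.
have fh : {ae mu, forall x, h j (s, x) @[j --> \oo] --> f' x}.
  apply: (@ae_cvg_l1 _ _ _ mu 2%R f' (fun j x => h j (s, x)) _ mf' _ fl1) => //.
  by move=> j; exact: (mgs (k j s)).
apply: ae_eq_integral => //.
- exact: measurable_funTS.
- apply/measurable_EFinP; apply: measurable_funTS.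
  exact: (measurableT_comp mp (measurable_pair1 s)).
apply: filterS fh => x hx _.
have hx' : (h j (s, x))%:E @[j --> \oo] --> f x.
  by rewrite -[f x]fineK//; apply: cvg_EFin; [exact: nearW|exact: hx].
rewrite /p (is_cvg_limn_esupE (cvgP _ hx')) (cvg_lim _ hx')//.
by rewrite max_r// fineK.
Qed.

End family.

(* If p0 is a density, then K s <= int b implies p0 <= b a.e., so that min(p0, b)
   is still a density. *)
Theorem bounded_joint_density (K : S -> {finite_measure set T -> \bar R}) (D : set S) (V : set T)
    (b : S * T -> R) :
  (forall A, measurable A -> measurable_fun setT (K ^~ A)) ->
  measurable D -> measurable V -> measurable_fun (D `*` V) b ->
  (forall s y, D s -> V y -> (0 <= b (s, y))%R) ->
  (forall s A, D s -> measurable A -> A `<=` V ->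
     K s A <= \int[mu]_(y in A) (b (s, y))%:E) ->
  exists p : S * T -> R,
  [/\ measurable_fun (D `*` V) p, forall s y, D s -> V y -> (0 <= p (s, y) <= b (s, y))%R &
      forall s A, D s -> measurable A -> A `<=` V -> K s A = \int[mu]_(y in A) (p (s, y))%:E].
Proof.
move=> mK mD mV mb b0 Kb.
have mDV : measurable (D `*` V) by exact: measurableX.
have [||p0 [mp0 p00 Kp0]] := @joint_density (fun s A => K s (A `&` V)) D.
- by move=> A mA; apply: mK; exact: measurableI.
- move=> s Ds.
  have Voo : K s V < +oo by rewrite ltey_eq fin_num_measure.
  (* On V the bound b gives absolute continuity: the integral of b over a null set is 0. *)
  have nu_mu : mfrestr mV Voo `<< mu.
    apply/null_content_dominatesP => A mA A0; apply/eqP.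
    rewrite /mfrestr/= /mrestr eq_le measure_ge0 andbT.
    apply: le_trans (Kb s _ Ds (measurableI _ _ mA mV) (@subIsetr _ _ _)) _.
    rewrite null_set_integral//.
    + exact: measurableI.
    + apply/measurable_EFinP; apply: (measurable_comp mDV _ mb).
        by move=> _ [y [_ Vy] <-].
      by apply: measurable_funTS; exact: pair1_measurable.
    + by apply: (subset_measure0 _ mA _ A0) => //; exact: measurableI.
  exact: radon_nikodym_sigma_finite nu_mu.
exists (fun z => Num.min (p0 z) (b z)); split.
- by apply: measurable_minr => //; exact: measurable_funTS.
- by move=> s y Ds Vy; rewrite le_min p00 b0//= ge_min lexx orbT.
move=> s A Ds mA AV.
have mp0A : measurable_fun setT (fun y => p0 (s, y)).
  exact: (measurableT_comp mp0 (pair1_measurable s)).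
have mbA : measurable_fun A (fun y => b (s, y)).
  apply: (measurable_comp mDV _ mb); last by apply: measurable_funTS; exact: pair1_measurable.
  by move=> _ [y Ay <-]; split => //; exact: AV.
have KE B : measurable B -> B `<=` A -> K s B = \int[mu]_(y in B) (p0 (s, y))%:E.
  move=> mB BA; rewrite -Kp0// setIidl//; exact: subset_trans AV.
(* On [A2] the minimum is b and the assumed bound on K applies directly; on the rest of A the
   minimum is the density [p0] itself. *)
pose A2 := A `&` [set y | b (s, y) < p0 (s, y)]%R.
have mA2 : measurable A2.
  have : measurable_fun A (fun y => b (s, y) < p0 (s, y))%R.
    by apply: measurable_fun_ltr => //; exact: measurable_funTS.
  by move=> /(_ mA [set true] I).
have A2A : A2 `<=` A by exact: subIsetl.
have AE : A = A2 `|` (A `\` A2) by rewrite setDUK.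
have mA1 : measurable (A `\` A2) by exact: measurableD.
apply/eqP; rewrite eq_le; apply/andP; split; last first.
  rewrite KE//; apply: ge0_le_integral => //.
  - by move=> y Ay; rewrite lee_fin le_min p00 b0//; exact: AV.
  - by apply/measurable_EFinP; apply: measurable_minr => //; exact: measurable_funTS.
  - by apply/measurable_EFinP; exact: measurable_funTS.
  - by move=> y _; rewrite lee_fin ge_min lexx.
rewrite [in leRHS]AE ge0_integral_setU//; last 3 first.
- rewrite -AE; apply/measurable_EFinP; apply: measurable_minr => //; exact: measurable_funTS.
- by rewrite -AE => y Ay; rewrite lee_fin le_min p00 b0//; exact: AV.
- by apply/disj_setPS => y [? []].
rewrite [X in K s X]AE measureU//; last by apply/seteqP; split => // y [? []].
apply: leeD.
- apply: le_trans (Kb s A2 Ds mA2 (subset_trans A2A AV)) _.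
  apply: ge0_le_integral => //.
  + by move=> y /A2A/AV Vy; rewrite lee_fin b0.
  + by apply/measurable_EFinP; exact: measurable_funS mbA.
  + apply/measurable_EFinP; apply: measurable_minr; first exact: measurable_funTS.
    exact: measurable_funS mbA.
  + by move=> y [_ /= /ltW py]; rewrite lee_fin min_r.
- apply: (@le_trans _ _ (\int[mu]_(y in A `\` A2) (p0 (s, y))%:E)); first by rewrite -KE.
  apply: ge0_le_integral => //.
  + by move=> y _; rewrite lee_fin.
  + by apply/measurable_EFinP; exact: measurable_funTS.
  + apply/measurable_EFinP; apply: measurable_minr; first exact: measurable_funTS.
    by apply: measurable_funS mbA => //; exact: subDsetl.
  + by move=> y [Ay nA2]; rewrite lee_fin min_l// leNgt; apply/negP => py; apply: nA2.
Qed.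

End joint_density.

(** * Joint measurability of the transition probabilities *)

Section transition_kernel.
Context {R : realType} {M : pmetricType R} {d : measure_display}
  {Omega : measurableType d}.
Local Notation MD := (one_point_compactification M).
Variable X : hunt_process M Omega.
Local Open Scope ereal_scope.

(* The first time of the grid of mesh 1/(n+1) after t. *)
Definition later (n : nat) (t : R) : R := ((Num.truncn (t * n.+1%:R)).+1%:R / n.+1%:R)%R.

Lemma later_gt n t : (t < later n t)%R.
Proof. by rewrite /later ltr_pdivlMr ?ltr0n// truncnS_gt. Qed.

Lemma later_le n t : (0 <= t)%R -> (later n t <= t + n.+1%:R^-1)%R.
Proof.
move=> t0; rewrite /later ler_pdivrMr ?ltr0n// mulrDl mulVf ?pnatr_eq0//.
by rewrite -natr1 lerD2r truncn_le mulr_ge0.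
Qed.

Lemma path_right_continuous (phi : M -> R) (t : R) w : (0 <= t)%R -> continuous phi ->
  ext (EFin \o phi) (X (later n t)%:E w) @[n --> \oo] --> ext (EFin \o phi) (X t%:E w).
Proof.
move=> t0 cphi; case E : (X t%:E w) => [y|]; last first.
  apply: cvg_near_cst; apply: nearW => n.
  by rewrite (dead_mono _ t0 E)//; exact/ltW/later_gt.
apply/fine_cvgP; split.
  by apply: nearW => n; case: (X _ w).
apply/cvgrPdist_lt => e e0.
have oG : open [set z | (`|phi y - phi z| < e)%R].
  have c z : {for z, continuous (fun z => `|phi y - phi z|%R)}.
    apply: cvg_norm; apply: cvgB; [exact: cvg_cst|exact: cphi].
  exact: (open_comp (fun x _ => c x) (@open_lt R e)).
have tG : at_time X t [set z | (`|phi y - phi z| < e)%R] w.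
  by exists y => //=; rewrite subrr normr0.
have tt1 : (t < t + 1)%R by rewrite ltrDl.
have [u [tu _ uG]] := right_open t0 tt1 oG tG.
have [n hn] : exists n : nat, (n.+1%:R^-1 < u - t)%R.
  exists (Num.truncn (u - t)^-1).
  by rewrite invf_plt ?posrE ?subr_gt0 ?ltr0n//; exact: truncnS_gt.
exists n => // m /= nm.
have mn : (m.+1%:R^-1 <= n.+1%:R^-1 :> R)%R.
  by rewrite lef_pV2 ?posrE ?ltr0n// ler_nat.
have [|z /= ez <-//] := uG (later m t).
rewrite later_gt/=; apply: (le_lt_trans (later_le _ t0)).
by rewrite -ltrBrDl; exact: le_lt_trans mn hn.
Qed.

(** For a fixed mesh the later grid time takes countably many values, so measurability in x is
    enough. As the mesh tends to 0, the value of [phi] follows the right-continuous path, and the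
    expectations converge by domination by 1. *)
Lemma measurable_trans_continuous (phi : M -> R) : continuous phi ->
  (forall x, 0 <= phi x <= 1)%R ->
  measurable_fun setT (fun z : R * borel M => trans X (Num.max z.1 0%R) (EFin \o phi) z.2).
Proof.
move=> cphi phi01.
have phi0 x : 0 <= (EFin \o phi) x by rewrite lee_fin; case/andP: (phi01 x).
have mphi : measurable_fun setT (EFin \o phi : borel M -> \bar R).
  by apply/measurable_EFinP; exact: measurable_continuous_borel.
apply: (emeasurable_fun_cvg (fun n (z : R * borel M) => trans X (later n (Num.max z.1 0%R)) (EFin \o phi) z.2)).
- move=> n.
  apply: (@measurable_select _ _ (borel M) R _ (\bar R)
    (fun t : R => Num.truncn (Num.max t 0%R * n.+1%:R))
    (fun k => trans X (k.+1%:R / n.+1%:R) (EFin \o phi))).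
  + move=> k; rewrite (_ : _ @^-1` _ = (fun t => Num.max t 0%R * n.+1%:R)%R @^-1` `[k%:R, k.+1%:R[%classic).
      rewrite -[X in measurable X]setTI.
      by apply: measurable_funM => //; apply: measurable_maxr.
    apply/seteqP; split => t /=; rewrite in_itv/= -truncn_eq ?mulr_ge0// ?le_max ?lexx ?orbT//.
    * by move=> ->.
    * by move/eqP.
  + by move=> k; apply: measurable_trans => //; rewrite divr_ge0.
- move=> [t x] _ /=.
  have t0 : (0 <= Num.max t 0)%R by rewrite le_max lexx orbT.
  move: (Num.max t 0)%R t0 => {}t t0.
  have lt0 n : (0 <= later n t)%R by apply: le_trans t0 (ltW (later_gt _ _)).
  have [//|||||_ _] := @dominated_convergence _ _ _ ('Pr[X]_(Some x)) setT measurableT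
    (fun n w => ext (EFin \o phi) (X (later n t)%:E w)) (fun w => ext (EFin \o phi) (X t%:E w)) (cst 1).
  + by move=> n; exact: measurable_ext_path.
  + exact: measurable_ext_path.
  + by apply: aeW => w _; exact: path_right_continuous.
  + exact: finite_measure_integrable_cst.
  + apply: aeW => w n _; case: (X (later n t)%:E w) => [y|] /=; last by rewrite normr0 lee_fin.
    by have /andP[? ?] := phi01 y; rewrite lee_fin ger0_norm.
  exact.
Qed.

Lemma indic_open_cvg (A : set M) : open A -> exists phi : nat -> M -> R,
  [/\ forall n, continuous (phi n), forall n x, (0 <= phi n x <= 1)%R,
      forall x, nondecreasing_seq (phi ^~ x) & forall x, phi ^~ x @ \oo --> (\1_A x : R)].
Proof.
(* Otherwise the approximation is min(1, n d(x, M \ A)); the distance to an empty complement carries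
   no information, so the whole space is treated apart. *)
move=> oA; have [A0|/set0P A0] := eqVneq (~` A) set0.
  exists (fun _ _ => 1%R); split => //.
  - by move=> n x; exact: cvg_cst.
  - by move=> n x; rewrite ler01 lexx.
  - by move=> x n m _.
  - move=> x; rewrite indicE mem_set; first exact: cvg_cst.
    by rewrite -[A]setCK A0 setC0.
pose f := dist_to (~` A); have lf : lip f := dist_to_lip A0.
have f0 x : (0 <= f x)%R by apply: le_dist_to => // y _; exact: mdist_ge0.
exists (fun n x => Num.min 1 (n%:R * f x))%R; split.
- move=> n x; apply: (@continuous_min _ _ (cst 1%R) (fun x => n%:R * f x)%R).
    exact: cvg_cst.
  by apply: cvgMr; exact: lip_continuous.
- by move=> n x; rewrite le_min ler01 mulr_ge0//= ge_min lexx.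
- by move=> x n m nm; rewrite le_min ge_min lexx/= ge_min ler_wpM2r ?ler_nat ?orbT.
- move=> x; rewrite indicE; case: (boolP (x \in A)) => [|/negP nA].
    rewrite inE => Ax.
    have fx : (0 < f x)%R.
      have /nbhs_ballP[r /= r0 rA] : nbhs x A by exact: open_nbhs_nbhs.
      apply: (lt_le_trans r0); apply: le_dist_to => // y nAy; rewrite leNgt; apply/negP => xy.
      by apply: nAy; apply: rA; rewrite ballEmdist.
    apply: cvg_near_cst; exists (Num.truncn (f x)^-1).+1 => // n /= nf.
    rewrite min_l// -ler_pdivrMr// mul1r; apply: le_trans (ltW (truncnS_gt _)) _.
    by rewrite ler_nat.
  apply: cvg_near_cst; apply: nearW => n.
  have -> : f x = 0%R.
    apply/eqP; rewrite eq_le f0 andbT -(mdistxx x); apply: dist_to_le.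
    by move=> Ax; apply: nA; rewrite inE.
  by rewrite mulr0 min_r.
Qed.

Lemma measurable_open_kernel (A : set M) : open A ->
  measurable_fun setT (fun z : R * borel M => 'Pr[X]_(Some z.2 : MD) (at_time X (Num.max z.1 0%R) A)).
Proof.
move=> oA; have [phi [cphi phi01 phind phiA]] := indic_open_cvg oA.
have phi0 n x : 0 <= (EFin \o phi n) x by rewrite lee_fin; case/andP: (phi01 n x).
apply: (emeasurable_fun_cvg (fun n (z : R * borel M) => trans X (Num.max z.1 0%R) (EFin \o phi n) z.2)).
  by move=> n; exact: measurable_trans_continuous.
move=> [t x] _ /=; rewrite -trans_indic; last 2 first.
- by rewrite le_max lexx orbT.
- exact: open_measurable_borel.
apply: trans_cvg => //.
- by rewrite le_max lexx orbT.
- by move=> n; apply/measurable_EFinP; exact: measurable_continuous_borel.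
- by move=> y; apply: cvg_EFin; [exact: nearW|exact: phiA].
Qed.

Lemma at_time_sigma_additive (x : MD) (t : R) : (0 <= t)%R ->
  semi_sigma_additive (fun A : set (borel M) => 'Pr[X]_x (at_time X t A)).
Proof.
move=> t0 F mF tF mU.
have -> : at_time X t (\bigcup_n F n) = \bigcup_n at_time X t (F n).
  apply/seteqP; split => w.
  + by move=> [y [k _ Fk] yX]; exists k => //; exists y.
  + by move=> [k _ [y Fk yX]]; exists y => //; exists k.
apply: (@measure_semi_sigma_additive _ _ _ ('Pr[X]_x) (fun n => at_time X t (F n))).
- by move=> k; exact: measurable_at_time.
- apply/trivIsetP => i j _ _ ij; apply/seteqP; split => // w [[y Fi yX] [z Fj zX]].
  have /trivIsetP/(_ i j I I ij) := tF; move/seteqP => [/(_ y) + _]; apply; split => //.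
  by move: zX; rewrite -yX => -[<-].
- by apply: bigcup_measurable => k _; exact: measurable_at_time.
Qed.

(* Negative times are sent to 0 to get a function defined on the whole of R. *)
Definition path_law (z : R * borel M) (A : set (borel M)) : \bar R :=
  'Pr[X]_(Some z.2 : MD) (at_time X (Num.max z.1 0%R) A).

Let max0 (t : R) : (0 <= Num.max t 0)%R. Proof. by rewrite le_max lexx orbT. Qed.

Let path_law0 z : path_law z set0 = 0.
Proof. by rewrite /path_law /at_time image_set0 preimage_set0 measure0. Qed.

Let path_law_ge0 z A : 0 <= path_law z A.
Proof. exact: measure_ge0. Qed.

Let path_law_sigma_additive z : semi_sigma_additive (path_law z).
Proof. exact: at_time_sigma_additive. Qed.

HB.instance Definition _ z := isMeasure.Build _ _ _ (path_law z)
  (path_law0 z) (path_law_ge0 z) (@path_law_sigma_additive z).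

Let path_law_fin z : fin_num_fun (path_law z).
Proof. by move=> A mA; rewrite fin_num_measure//; exact: measurable_at_time. Qed.

HB.instance Definition _ z := @Measure_isFinite.Build _ _ _ (path_law z) (path_law_fin z).

Lemma measurable_path_law (A : set (borel M)) : measurable A -> measurable_fun setT (path_law ^~ A).
Proof.
move: A; apply: (@dynkin_induction _ (borel M) (@open M)) => //.
- by move=> A B; exact: openI.
- exact: measurable_open_kernel openT.
- by move=> A oA; exact: measurable_open_kernel.
- move=> A mA HA.
  rewrite (_ : path_law ^~ _ = (fun z => path_law z setT - path_law z A)).
    by apply: emeasurable_funB => //; exact: measurable_open_kernel openT.
  by apply/funext => z; rewrite -setTD measureD// ?setTI// ltey_eq fin_num_measure.
- move=> F mF tF HF.
  rewrite (_ : path_law ^~ _ = (fun z => \sum_(k <oo) path_law z (F k))).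
    by apply: ge0_emeasurable_sum.
  apply/funext => z; rewrite measure_bigcup//.
  by apply: eq_eseriesl => k; rewrite in_setT.
Qed.

End transition_kernel.

Section measurable_distance.
Context {R : realType} {M : pmetricType R}.
Local Open Scope ereal_scope.

Lemma measurable_mdist : separable M ->
  measurable_fun setT (fun z : borel M * borel M => mdist z.1 z.2).
Proof.
move=> /separable_dense_seq[e he]; apply/measurable_EFinP.
have mde n := measurable_mdist_section (e n).
rewrite (_ : EFin \o _ = (fun z : borel M * borel M =>
    einfs (fun n => (mdist (e n) z.1 + mdist (e n) z.2)%:E) 0%N)).
  apply: (measurable_fun_einfs (f := fun n (z : borel M * borel M) =>
    (mdist (e n) z.1 + mdist (e n) z.2)%:E)) => n.
  apply/measurable_EFinP; apply: measurable_funD.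
    exact: (measurableT_comp (mde n) measurable_fst).
  exact: (measurableT_comp (mde n) measurable_snd).
apply/funext => -[x y] /=; apply/eqP; rewrite eq_le; apply/andP; split.
  apply: le_ereal_inf_tmp => _ [n _ <-]; rewrite lee_fin (metric_sym (e n) x).
  exact: metric_triangle.
apply/lee_addgt0Pr => r r0; have [n hn] := he x (r / 2)%R (divr_gt0 r0 (ltr0n _ 2)).
apply: (@le_trans _ _ (mdist (e n) x + mdist (e n) y)%:E).
  by apply: ereal_inf_lbound; exists n.
rewrite -EFinD lee_fin; have tri := metric_triangle (e n) x y.
by rewrite (metric_sym x (e n)) in hn; move: (mdist _ _) (mdist _ _) (mdist _ _) hn tri => u v s; lra.
Qed.

End measurable_distance.

(** * Joint measurability of the bound *)

Section density_bound.
Context {R : realType} {M : pmetricType R}.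
Variables (N : set (borel M)) (U V : set M) (F : R -> M -> M -> R) (T : R) (z0 : M).
Hypotheses (sM : separable M) (mN : measurable N) (oU : open U) (oV : open V)
  (VU : V `<=` U) (T0 : 0 < T) (Uz0 : U z0)
  (mF : measurable_fun
    (([set t : R | 0 < t <= T] `*` U `*` U) : set (R * borel M * borel M))
    (fun z => F z.1.1 z.1.2 z.2)).

Let mU : measurable (U : set (borel M)). Proof. exact: open_measurable_borel. Qed.

Let mFdom : measurable (([set t : R | 0 < t <= T] `*` U `*` U) : set (R * borel M * borel M)).
Proof.
apply: measurableX => //; apply: measurableX => //.
by rewrite (_ : [set t | _] = `]0, T]%classic).
Qed.

Let mD : measurable (([set t : R | 0 < t] `*` ~` N `*` V) : set (R * borel M * borel M)).
Proof.
apply: measurableX; last exact: open_measurable_borel.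
apply: measurableX; last exact: measurableC.
rewrite (_ : [set t | _] = `]0, +oo[%classic)//.
by apply/seteqP; split => t /=; rewrite in_itv/= andbT.
Qed.

Let mt : measurable_fun setT (fun z : R * borel M * borel M => z.1.1).
Proof. exact: (measurableT_comp measurable_fst measurable_fst). Qed.

Let mx : measurable_fun setT (fun z : R * borel M * borel M => z.1.2).
Proof. exact: (measurableT_comp measurable_snd measurable_fst). Qed.

Let mR : measurable_fun setT (fun z : R * borel M * borel M => z.1.1^-1).
Proof.
apply: (@measurableT_comp _ _ _ _ _ _ (fun t : R => t^-1)); last exact: mt.
(* Inversion as the real power -1, extended to negative numbers by oddness. *)
have -> : (fun t : R => t^-1) = (fun t : R => if 0 <= t then t `^ (-1) else - (- t) `^ (-1)).
  apply/funext => t; case: ifPn => [t0|]; first by rewrite powR_inv1.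
  by rewrite -ltNge => t0; rewrite powR_inv1 ?oppr_ge0 ?ltW// invrN opprK.
apply: measurable_fun_ifT; [exact: measurable_fun_ler|exact: measurable_powR|].
apply: measurableT_comp => //; apply: (@measurableT_comp _ _ _ _ _ _ (fun u : R => u `^ (-1))) => //.
Qed.

Lemma measurable_density_bound (K K' L a a' b g E : R) :
  measurable_fun (([set t : R | 0 < t] `*` ~` N `*` V) : set (R * borel M * borel M))
    (fun z => if z.1.1 < T then
       (if z.1.2 \in U then K * (F z.1.1 z.1.2 z.2 * expR (g * (mdist z.1.2 z.2 `^ a / z.1.1) `^ b))
        else K' * (T / z.1.1) `^ a' * expR (- (E * (T / z.1.1) `^ b)) * F z.1.1 z0 z0)
     else L).
Proof.
have mpow (h : R * borel M * borel M -> R) r : measurable_fun setT h ->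
    measurable_fun setT (fun z => h z `^ r).
  by move=> mh; apply: (@measurableT_comp _ _ _ _ _ _ (fun u : R => u `^ r)) mh; exact: measurable_powR.
have mexp (h : R * borel M * borel M -> R) : measurable_fun setT h ->
    measurable_fun setT (fun z => expR (h z)).
  by move=> mh; apply: (@measurableT_comp _ _ _ _ _ _ (@expR R)) mh; exact: measurable_expR.
have mdst : measurable_fun setT (fun z : R * borel M * borel M => mdist z.1.2 z.2).
  apply: (@measurableT_comp _ _ _ _ _ _ (fun z : borel M * borel M => mdist z.1 z.2)
    _ (fun z : R * borel M * borel M => (z.1.2, z.2))).
    exact: measurable_mdist.
  exact: measurable_fun_pair.
have mlt : measurable_fun setT (fun z : R * borel M * borel M => z.1.1 < T).
  exact: measurable_fun_ltr.
have mUx : measurable_fun setT (fun z : R * borel M * borel M => z.1.2 \in U).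
  apply: (measurable_fun_bool true); rewrite setTI.
  rewrite (_ : _ @^-1` _ = (fun z : R * borel M * borel M => z.1.2) @^-1` U).
    by rewrite -[X in measurable X]setTI; exact: mx.
  by apply/seteqP; split => z /=; [move=> /set_mem|move=> /mem_set].
have m1 := mpow _ b (measurable_funM (mpow _ a mdst) mR).
have mTR := measurable_funM (measurable_cst T) mR.
have m2 := mpow _ a' mTR; have m3 := mpow _ b mTR.
have mD1 := measurable_funTS mlt mD (I : measurable [set true]).
apply: measurable_fun_if => //; first exact: measurable_funTS.
apply: measurable_fun_if => //; first exact: measurable_funTS.
- apply: measurable_funM; first exact: measurable_cst.
  apply: measurable_funM; last first.
    by apply: measurable_funTS; exact: mexp (measurable_funM (measurable_cst g) m1).
  apply: (measurable_funS mFdom _ mF) => -[[t x] y] /= [[[[t0 _] Vy] tT] /set_mem Ux].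
  by rewrite t0 ltW//; split => //; exact: VU.
- apply: measurable_funM.
    apply: measurable_funTS; apply: measurable_funM; last first.
      exact: mexp (measurableT_comp (@oppr_measurable R _) (measurable_funM (measurable_cst E) m3)).
    exact: measurable_funM (measurable_cst K') m2.
  apply: (@measurable_comp _ _ _ _ _ _ _ (fun z : R * borel M * borel M => F z.1.1 z.1.2 z.2) _
    (fun z : R * borel M * borel M => (z.1.1, z0, z0)) mFdom _ mF).
    by move=> _ [[[t x] y] /= [[[[t0 _] Vy] tT] _] <-] /=; rewrite t0 ltW.
  apply: measurable_funTS; apply: measurable_fun_pair => //.
  exact: measurable_fun_pair.
Qed.

End density_bound.

(** * Choice of the constants and construction of the density *)

Theorem theorem1p1 (R : realType) (beta cF alphaF c gamma eps : R) :
  1 < beta -> 0 < cF -> 0 < alphaF -> 0 < c -> 0 < gamma -> 0 < eps < 1 ->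
  let gamma_eps := (eps / 5) `^ (beta / (beta - 1)) * gamma in
  exists c_eps : R, 0 < c_eps /\
  forall (M : pmetricType R)
    (mu : {sigma_finite_measure set (borel M) -> \bar R})
    (d : measure_display) (Omega : measurableType d)
    (X : hunt_process M Omega) (N : set (borel M))
    (rad : R) (U : set M) (F : R -> M -> M -> R),
  locally_compact [set: M] -> separable M ->
  measurable N ->
  (forall x : M, ~ N x ->
    {ae 'Pr[X]_(Some x), forall w,
      (forall t : R, 0 <= t -> (~` (Some @` N)) (X t%:E w)) /\
      {within [set t : R | 0 <= t /\ (t%:E < lifetime X w)%E],
        continuous (fun t : R => X t%:E w)}}) ->
  0 < rad -> U !=set0 -> open U -> (diam U <= rad%:E)%E ->
  measurable_fun
    (([set t : R | 0 < t <= rad `^ beta] `*` U `*` U)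
      : set (R * borel M * borel M))
    (fun z => F z.1.1 z.1.2 z.2) ->
  (forall t x y, 0 < t <= rad `^ beta -> U x -> U y -> 0 < F t x y) ->
  (forall t x y s z w, 0 < t <= rad `^ beta -> U x -> U y ->
    0 < s <= rad `^ beta -> U z -> U w -> s <= t ->
    F s z w / F t x y <=
    cF * (Num.max (Num.max t (mdist x z `^ beta)) (mdist y w `^ beta) / s)
           `^ alphaF) ->
  (forall t x (A : set (borel M)), 0 < t < rad `^ beta -> U x -> ~ N x ->
    measurable A -> A `<=` U ->
    ('Prc[X]_(Some x) ((X t%:E @^-1` (Some @` A)) `&`
                       [set w | t%:E < exit_time X U w])
     <= \int[mu]_(y in A) (F t x y)%:E)%E) ->
  (forall x r t, U x -> ~ N x -> 0 < r < rad -> ball x r `<=` U -> 0 < t ->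
    ('Prc[X]_(Some x) [set w | exit_time X (ball x r) w <= t%:E]
     <= (c * expR (- gamma * (r `^ beta / t) `^ (beta - 1)^-1))%:E)%E) ->
  let V := inner_part U (eps * rad) in
  let infF s := inf [set F s z w | z in U & w in U] in
  exists p : R -> M -> M -> R,
  [/\ measurable_fun
        (([set t : R | 0 < t] `*` ~` N `*` V)
          : set (R * borel M * borel M))
        (fun z => p z.1.1 z.1.2 z.2),
      forall t x y, 0 < t -> ~ N x -> V y -> 0 <= p t x y,
      forall t x (A : set (borel M)), 0 < t -> ~ N x ->
        measurable A -> A `<=` V ->
        'Pr[X]_(Some x) (X t%:E @^-1` (Some @` A)) =
        (\int[mu]_(y in A) (p t x y)%:E)%E
    & forall t x y, 0 < t -> ~ N x -> V y ->
        [/\ t < rad `^ beta -> U x ->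
              p t x y <= c_eps * F t x y *
                expR (- gamma_eps * (mdist x y `^ beta / t) `^ (beta - 1)^-1),
            t < rad `^ beta -> ~ U x ->
              p t x y <= c_eps * infF (Num.min (2 * t) (rad `^ beta)) *
                expR (- gamma_eps * (rad `^ beta / t) `^ (beta - 1)^-1)
          & rad `^ beta <= t ->
              p t x y <= c_eps * infF (rad `^ beta)]].
Proof.
move=> beta1 cF0 alphaF0 c0 gamma0 eps01 gamma_eps.
have /andP[eps0 _] := eps01.
have b0 : 0 < (beta - 1)^-1 by rewrite invr_gt0 subr_gt0.
pose E1 := gamma * (9 / 40 * eps) `^ (beta / (beta - 1)).
pose E2 := gamma * (19 / 90 * eps) `^ (beta / (beta - 1)).
have E10 : 0 < E1 by rewrite mulr_gt0// powR_gt0// mulr_gt0// divr_gt0.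
have B0 : 0 < ((2 `^ (1 - 2 * beta))^-1) `^ alphaF :> R.
  by rewrite powR_gt0// invr_gt0 powR_gt0.
(* S, C1 and C2 depend on the parameters alone, hence are fixed before the space and the process are
   introduced. *)
have [S S0 hS] := sum_expr_expR_le B0 E10.
have s1 : 0 < E1 - E2 by rewrite subr_gt0; exact: E2_lt_E1.
have [C1 C10 hC1] := powR_le_expR alphaF0 b0 s1.
have s2 : 0 < E1 - gamma_eps by rewrite subr_gt0; exact: gamma_eps_lt_E1.
have a2 : 0 < 2 * alphaF by rewrite mulr_gt0.
have [C2 C20 hC2] := powR_le_expR a2 b0 s2.
pose nc := @near_const R beta cF alphaF c gamma eps S.
pose fc := @far_const R beta cF alphaF c S C1.
(* One constant for each of the three cases of the bound; their sum serves all of them. *)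
pose K1 := nc + fc.
pose K2 := c * S * cF * cF * C2.
pose K3 := cF * 2 `^ alphaF * (1 + c * S) * cF.
have nc0 : 0 < nc by rewrite !(mulr_gt0, addr_gt0, expR_gt0, powR_gt0).
have fc0 : 0 < fc by rewrite !(mulr_gt0, powR_gt0).
have K10 : 0 < K1 by rewrite addr_gt0.
have K20 : 0 < K2 by rewrite !mulr_gt0.
have K30 : 0 < K3 by rewrite !(mulr_gt0, addr_gt0, powR_gt0).
exists (K1 + K2 + K3); split; first by rewrite !addr_gt0.
move=> M mu d Omega X N rad U F _ sM mN goodN rad0 [z0 Uz0] oU dU mF F0 HF Hker Hexit V infF.
have diamU x y : U x -> U y -> mdist x y <= rad.
  move=> Ux Uy; rewrite -lee_fin; apply: le_trans dU.
  by apply: ereal_sup_ubound; exists x => //; exists y.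
have eR0 : 0 <= eps * rad by rewrite mulr_ge0 ?ltW.
have VU : V `<=` U by exact: inner_part_subset.
have oV : open V := open_inner_part U (eps * rad).
have T0 : 0 < rad `^ beta by exact: powR_gt0.
pose ob := outside_bound (cF := cF) (alphaF := alphaF) (beta := beta) (c := c) (gamma := gamma) (eps := eps) rad F S z0.
pose lb := late_bound (cF := cF) (alphaF := alphaF) (beta := beta) (c := c) rad F S z0.
pose kb := kernel_bound (beta := beta) (gamma := gamma) (eps := eps) F.
(* Outside U and at late times b uses the value of F at [z0], which is measurable in t, whereas this
   is not evident for an infimum over all of U x U. The comparison with the infimum is made
   pointwise at the end. *)
pose b (z : R * borel M * borel M) := if z.1.1 < rad `^ beta then
  (if z.1.2 \in U then K1 * kb z.1.1 z.1.2 z.2 else ob z.1.1) else lb.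
have [A_ [mA_ genA]] := separable_countable_ring sM.
pose D : set (R * borel M) := [set t : R | 0 < t] `*` ~` N.
have mD : measurable D.
  apply: measurableX; last exact: measurableC.
  rewrite (_ : [set t | _] = `]0, +oo[%classic)//.
  by apply/seteqP; split => t /=; rewrite in_itv/= andbT.
have mb : measurable_fun (D `*` (V : set (borel M))) b.
  exact: measurable_density_bound.
have b_ge0 s y : D s -> V y -> 0 <= b (s, y).
  case: s => t x [/= t0 Nx] Vy; rewrite /b /=; case: ifPn => tT; last first.
    by rewrite !mulr_ge0 ?powR_ge0 ?addr_ge0 ?mulr_ge0 ?(ltW cF0) ?(ltW c0) ?(ltW S0)// ltW// F0// T0 lexx.
  have tT' : 0 < t <= rad `^ beta by rewrite t0 ltW.
  case: ifPn => [/set_mem Ux|_].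
    by rewrite mulr_ge0 ?(ltW K10)// mulr_ge0 ?expR_ge0// ltW// F0//; exact: VU.
  by rewrite mulr_ge0// ?mulr_ge0 ?powR_ge0 ?expR_ge0 ?(ltW cF0) ?(ltW c0) ?(ltW S0)// ltW// F0.
have Kb s (A : set (borel M)) : D s -> measurable A -> A `<=` V ->
    (path_law X s A <= \int[mu]_(y in A) (b (s, y))%:E)%E.
  case: s => t x [/= t0 Nx] mA AV; rewrite /path_law /b /= max_l ?(ltW t0)//.
  have [tT|tT] := ltP t (rad `^ beta).
    have tT' : 0 < t < rad `^ beta by rewrite t0.
    case: (boolP (x \in U)) => [/set_mem Ux|/negP nUx].
      exact: (inside_le beta1 cF0 alphaF0 c0 gamma0 eps01 mN goodN rad0 oU mF F0 Hker Hexit S0 hS diamU HF C10 hC1).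
    have {}nUx : ~ U x by move=> Ux; apply: nUx; exact: mem_set.
    exact: (outside_le beta1 cF0 alphaF0 c0 gamma0 eps01 mN goodN rad0 oU mF F0 Hker Hexit S0 hS diamU HF Uz0).
  exact: (late_le beta1 cF0 alphaF0 c0 gamma0 eps01 mN goodN rad0 oU mF F0 Hker Hexit S0 hS diamU HF Uz0).
have mV : measurable (V : set (borel M)) by exact: open_measurable_borel.
have [p [mp pb Kp]] := bounded_joint_density mA_ genA (@measurable_path_law _ _ _ _ X) mD mV mb b_ge0 Kb.
exists (fun t x y => p (t, x, y)); split.
- by apply: eq_measurable_fun mp => -[[t x] y].
- by move=> t x y t0 Nx Vy; have /andP[] := pb (t, x) y (conj t0 Nx) Vy.
- move=> t x A t0 Nx mA AV; rewrite -(Kp (t, x) A (conj t0 Nx) mA AV).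
  by rewrite /= /path_law /= max_l// ltW.
move=> t x y t0 Nx Vy.
have /andP[_ pbz] := pb (t, x) y (conj t0 Nx) Vy.
have infF_ge0 s : 0 < s <= rad `^ beta -> 0 <= infF s.
  move=> sT; apply: lb_le_inf; first by exists (F s z0 z0); exists z0 => //; exists z0.
  by move=> _ [z Uz [w Uw <-]]; apply: ltW; exact: F0.
split=> [tT Ux|tT nUx|tT]; apply: (le_trans pbz); rewrite /b /=.
- rewrite tT mem_set// -mulrA; apply: ler_wpM2r.
    by rewrite mulr_ge0 ?expR_ge0// ltW// F0//; [rewrite t0 ltW|exact: VU].
  by rewrite -addrA lerDl addr_ge0// ltW.
- rewrite tT memNset//.
  apply: (le_trans (outside_bound_le beta1 cF0 alphaF0 c0 rad0 F0 S0 diamU HF hC2 Uz0 _)); first by rewrite t0.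
  apply: ler_wpM2r; first exact: expR_ge0.
  apply: ler_wpM2r; last by rewrite addrAC lerDr addr_ge0// ltW.
  by apply: infF_ge0; rewrite lt_min mulr_gt0// T0 ge_min lexx orbT.
- rewrite ltNge tT/=.
  apply: (le_trans (late_bound_le beta1 cF0 alphaF0 c0 rad0 F0 S0 diamU HF Uz0)).
  apply: ler_wpM2r; last by rewrite lerDr addr_ge0// ltW.
  by apply: infF_ge0; rewrite T0 lexx.
Qed.
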